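(* Let $f\in C^\sigma(\mathbb R^n,\mathbb R^n)$ with $n\in\mathbb N$, $\sigma\ge 1$, and consider the ODE $\dot x=f(x)$. Let $K\subset\mathbb R^n$ be a compact, connected and positively invariant set which does not contain any equilibrium. Let $M\in C^1(K,\mathbb S^n)$ be a Riemannian metric on $K$ (i.e. $M(x)$ is positive definite for all $x\in K$), and let $\nu>0$ be such that $L_M(x)\le-\nu<0$ for all $x\in K$, where $$L_M(x)=\max_{v\in\mathbb R^n,\ v^TM(x)v=1,\ v^Tf(x)=0}L_M(x;v),$$ $$L_M(x;v)=\frac12 v^T\Big(M'(x)+Df(x)^TM(x)+M(x)Df(x)-\frac{M(x)f(x)f(x)^T(Df(x)+Df(x)^T)}{\|f(x)\|^2}-\frac{(Df(x)+Df(x)^T)f(x)f(x)^TM(x)}{\|f(x)\|^2}\Big)v .$$ Then there is one and only one periodic orbit $\Omega\subset K$; it is exponentially stable, and the real parts of all its Floquet exponents apart from the trivial one are $\le-\nu$. Moreover, $K\subset A(\Omega)$.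
   Context: $\mathbb S^n$ denotes the real symmetric $n\times n$ matrices; $\|\cdot\|$ is the Euclidean norm; $Df(x)$ is the Jacobian matrix of $f$ at $x$. $S_tx$ denotes the solution at time $t$ of $\dot x=f(x)$ with initial value $x$ at time $0$; $K$ is positively invariant if $S_tK\subset K$ for all $t\ge0$. $M'(x)$ is the matrix of orbital derivatives, $(M'(x))_{ij}=(\nabla M_{ij}(x))^Tf(x)$. $C^1(K,\mathbb S^n)$ means $C^1$ on an open neighbourhood of $K$. Connected sets are understood to be nonempty. A periodic orbit is the orbit of a nonconstant periodic solution. The Floquet exponents of $\Omega$ are those of the linear periodic equation $\dot\phi(t)=Df(S_tp)\phi(t)$ with $p\in\Omega$; the trivial one is the exponent $0$ associated with the solution $f(S_tp)$. $A(\Omega)=\{x\in\mathbb R^n: \mathrm{dist}(S_tx,\Omega)\to0 \text{ as } t\to\infty\}$ is the basin of attraction of $\Omega$. *)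

(* Defs.v *)
(* Points of R^n are column vectors 'cV[R]_n over a
   realType R, so that the matrix formulas read as on paper. The library's
   norm on 'cV[R]_n is the sup norm; it induces the Euclidean topology, but
   wherever a norm or a distance occurs explicitly, enorm is meant. *)
From HB Require Import structures.
From mathcomp Require Import all_boot all_order all_algebra.
From mathcomp Require Import all_classical all_reals all_analysis.
From mathcomp Require Import complex.

Set Implicit Arguments.
Unset Strict Implicit.
Unset Printing Implicit Defensive.

Import Order.TTheory GRing.Theory Num.Theory.
Import numFieldNormedType.Exports.

Local Open Scope classical_set_scope.
Local Open Scope ring_scope.

Section Euclidean.
Context {R : realType} {n : nat}.
Implicit Types (x u v : 'cV[R]_n) (A : 'M[R]_n).

Definition dotp u v : R := (u^T *m v) 0 0.

Definition enorm x : R := Num.sqrt (\sum_i x i 0 ^+ 2).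

Definition edistance x (X : set 'cV[R]_n) : R :=
  inf [set enorm (x - y) | y in X].

Definition quadf A v : R := (v^T *m A *m v) 0 0.

Definition posdefmx A := forall v, v != 0 -> 0 < quadf A v.

Definition symmx A := A^T = A.

End Euclidean.

Section Calculus.
Context {R : realType} {n : nat}.

(* C^k on an open set U. As v ranges over all directions, 'D_v g ranges over
   the linear combinations of the partial derivatives of g. *)
Fixpoint Ck_on {W : normedModType R} (U : set 'cV[R]_n) (k : nat)
    (g : 'cV[R]_n -> W) {struct k} : Prop :=
  if k is k'.+1 then
    (forall x, U x -> differentiable g x) /\
    (forall v, Ck_on U k' (fun x => 'D_v g x))
  else forall x, U x -> {for x, continuous g}.

Definition gradient (g : 'cV[R]_n -> R) (x : 'cV[R]_n) : 'cV[R]_n :=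
  \col_j 'D_(delta_mx j 0) g x.

(* The library's jacobian is for row vectors and acts on the right. *)
Definition Jac (f : 'cV[R]_n -> 'cV[R]_n) (x : 'cV[R]_n) : 'M[R]_n :=
  \matrix_(i, j) 'D_(delta_mx j 0) (fun y => f y i 0) x.

Definition orbital_deriv (f : 'cV[R]_n -> 'cV[R]_n) (M : 'cV[R]_n -> 'M[R]_n)
    (x : 'cV[R]_n) : 'M[R]_n :=
  \matrix_(i, j) dotp (gradient (fun y => M y i j) x) (f x).

Definition C1_sym_on (K : set 'cV[R]_n) (M : 'cV[R]_n -> 'M[R]_n) : Prop :=
  exists U : set 'cV[R]_n,
    [/\ open U, K `<=` U, forall x, U x -> symmx (M x) & Ck_on U 1 M].

End Calculus.

Section Flow.
Context {R : realType} {n : nat}.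
Variable f : 'cV[R]_n -> 'cV[R]_n.
Implicit Types (x p : 'cV[R]_n) (t : R) (K Om : set 'cV[R]_n).

(* y is the value at time t (of either sign) of a solution of x' = f(x)
   starting at x. The derivatives at the end points 0 and t are two-sided,
   i.e. the solution lives on an open interval around [0, t]; for f of class
   C^1 this is no restriction. *)
Definition reaches x t y : Prop := exists u : R -> 'cV[R]_n,
  [/\ u 0 = x, u t = y &
      forall s, Num.min 0 t <= s <= Num.max 0 t -> is_derive s 1 u (f (u s))].

(* f is not assumed to be complete: flow t x, i.e. S_t x, is meaningful only
   when flow_defined t x holds, and has an unspecified value otherwise. *)
Definition flow_defined t x : Prop := exists y, reaches x t y.

Definition flow t x : 'cV[R]_n := get [set y | reaches x t y].

Definition positively_invariant K : Prop :=
  forall t x, 0 <= t -> K x -> flow_defined t x /\ K (flow t x).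

Definition periodic_orbit Om : Prop := exists (u : R -> 'cV[R]_n) (T : R),
  [/\ 0 < T,
      forall t, is_derive t 1 u (f (u t)),
      forall t, u (t + T) = u t,
      exists t, u t != u 0
    & Om = range u].

Definition basin Om : set 'cV[R]_n :=
  [set x | (forall t, 0 <= t -> flow_defined t x) /\
           edistance (flow t x) Om @[t --> +oo] --> (0 : R)].

Definition exponentially_stable Om : Prop := exists delta C mu : R,
  [/\ 0 < delta, 0 < C, 0 < mu &
      forall x, edistance x Om < delta -> forall t, 0 <= t ->
        flow_defined t x /\
        edistance (flow t x) Om <= C * expR (- mu * t) * edistance x Om].

Definition minimal_period p T : Prop :=
  [/\ 0 < T, flow_defined T p, flow T p = p &
      forall s, 0 < s < T -> flow s p != p].

Definition cexp (z : complex R) : complex R :=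
  Complex (expR (complex.Re z) * cos (complex.Im z))
          (expR (complex.Re z) * sin (complex.Im z)).

(* Ls lists the Floquet exponents of Om with their algebraic multiplicities:
   for the principal fundamental matrix Phi of phi' = Df(S_t p) phi and the
   minimal period T, the numbers exp(l T) for l in Ls are the eigenvalues of
   the monodromy matrix Phi(T). An exponent is determined modulo 2 i pi / T
   only; Ls contains one representative of each. *)
Definition floquet_exponents Om (Ls : seq (complex R)) : Prop :=
  exists (p : 'cV[R]_n) (T : R) (Phi : R -> 'M[R]_n),
  [/\ Om p,
      minimal_period p T,
      Phi 0 = 1%:M,
      forall t, is_derive t 1 Phi (Jac f (flow t p) *m Phi t)
    & char_poly (map_mx (real_complex R) (Phi T)) =
      \prod_(l <- Ls) ('X - (cexp (l * real_complex R T))%:P)].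

End Flow.

Section ContractionRate.
Context {R : realType} {n : nat}.
Variables (f : 'cV[R]_n -> 'cV[R]_n) (M : 'cV[R]_n -> 'M[R]_n).

Definition LMv (x v : 'cV[R]_n) : R :=
  let D := Jac f x in
  2^-1 * quadf (orbital_deriv f M x + D^T *m M x + M x *m D
    - (enorm (f x) ^+ 2)^-1 *: (M x *m f x *m (f x)^T *m (D + D^T))
    - (enorm (f x) ^+ 2)^-1 *: ((D + D^T) *m f x *m (f x)^T *m M x)) v.

(* For M x positive definite the supremum is over a compact set of v, hence a
   maximum; it is -oo if that set is empty (n = 1). *)
Definition LM (x : 'cV[R]_n) : \bar R :=
  ereal_sup [set (LMv x v)%:E | v in
    [set v | quadf (M x) v = 1 /\ dotp v (f x) = 0]].

End ContractionRate.

(* Main.v *)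
Require Import Defs.
From HB Require Import structures.
From mathcomp Require Import all_boot all_order all_algebra.
From mathcomp Require Import all_classical all_reals all_analysis.
From mathcomp Require Import complex.
From mathcomp Require Import ring lra.

Set Implicit Arguments.
Unset Strict Implicit.
Unset Printing Implicit Defensive.

Import Order.TTheory GRing.Theory Num.Theory.
Import numFieldNormedType.Exports.

Local Open Scope classical_set_scope.
Local Open Scope ring_scope.

(** For x in K and v perpendicular to f(x), 2 L_M(x;v) is the derivative of
v^T M v along the solution through x when v obeys the variational equation
corrected by the multiple of f that keeps v perpendicular to f. The correction
amounts to changing the time parametrization of the neighbouring solution, so
the hypothesis on L_M says that neighbouring orbits converge exponentially once
time shifts are allowed.

The nonlinear form of this is [shadowing]: if x is in K and y is close to x
with y - x perpendicular to f(x), there is a time change th with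
|S_(th t) y - S_t x| <= C exp(- mu t) |y - x| for all t >= 0. The deviation
w(t) = S_(th t) y - S_t x solves an equation w' = H(S_t x, w) in which the
speed th' is chosen so that w stays perpendicular to f(S_t x); this H agrees
with the corrected variational equation up to an error o(|w|) uniform on K.
The equation for w is solved first, with w clamped to a small cube so that it is
globally Lipschitz ([picard], [tube_solution]); the decay of w^T M w then shows
that the clamp is never active ([tube_quadf_decay], [continuity_bootstrap]), and
the solution through y is read off from w. In this way M and L_M are evaluated
at points of K only, y ranges over a full neighbourhood in the hyperplane, and
the solution through y is shown to exist for all positive times.

Existence of a periodic orbit. By compactness some positive orbit in K comes
back close to itself after a time at least 2, and short time shifts make the
difference of the two points perpendicular to f ([transversal_crossing]).
Shadowing then gives points q and times tau in a bounded interval [1, b] with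
S_tau q - q arbitrarily small, so S_tau q = q for some q and tau >= 1
([almost_periodic_closes]). As f has no zero in K, q is not an equilibrium.

Attraction and uniqueness. Of two points of K that are close enough, either both
or neither are attracted by the periodic orbit Omega. The attracted points thus
form a nonempty open and closed part of K, which is K by connectedness
([all_attracted]). A second periodic orbit in K is attracted by Omega, hence
contained in it.

Exponential stability is shadowing applied to a point y near Omega and a point
of Omega nearest to y: their difference is perpendicular to f.

Floquet exponents. The monodromy matrix A fixes f(p). Let B be A followed by
the orthogonal projection along f(p). Then (X - 1) det(X - B) = X det(X - A)
([char_poly_deflation]), so the nontrivial multipliers, counted with
multiplicity, are eigenvalues of B. The linear form of the contraction says that
B shrinks v^T M(p) v by the factor exp(- 2 nu T) on the vectors perpendicular to
f(p) ([transversal_monodromy_contraction]), whence the bound on their modulus. *)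

(** * Norms and the scalar product *)

Section Norms.
Context {R : realType}.

Lemma ler_of_eq (x y : R) : x = y -> x <= y.
Proof. by move=> ->. Qed.

Lemma ler_norm_entry m n (A : 'M[R]_(m, n)) i j : `|A i j| <= `|A|.
Proof.
rewrite [leRHS]/Num.Def.normr /= mx_normrE.
exact: (le_bigmax _ (fun ij => `|A ij.1 ij.2|) (i, j)).
Qed.

Lemma ler_norm_mx m n (A : 'M[R]_(m, n)) c :
  0 <= c -> (forall i j, `|A i j| <= c) -> `|A| <= c.
Proof.
move=> c0 Ac; rewrite [leLHS]/Num.Def.normr /= mx_normrE.
by apply: bigmax_le => // -[i j] _; exact: Ac.
Qed.

Lemma ler_norm_cV n (x : 'cV[R]_n) c :
  0 <= c -> (forall i, `|x i 0| <= c) -> `|x| <= c.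
Proof. by move=> c0 xc; apply: ler_norm_mx => // i j; rewrite ord1. Qed.

Lemma ler_norm_mulmx m n p (A : 'M[R]_(m, n)) (B : 'M[R]_(n, p)) :
  `|A *m B| <= n%:R * `|A| * `|B|.
Proof.
apply: ler_norm_mx => [|i j]; first by rewrite !mulr_ge0.
rewrite mxE (le_trans (ler_norm_sum _ _ _))//.
apply: (@le_trans _ _ (\sum_(k < n) `|A| * `|B|)).
  by apply: ler_sum => k _; rewrite normrM ler_pM// ler_norm_entry.
by rewrite sumr_const card_ord -mulrA mulr_natl.
Qed.

Variable n : nat.
Implicit Types (u v w : 'cV[R]_n) (A : 'M[R]_n).

Lemma dotpE u v : dotp u v = \sum_i u i 0 * v i 0.
Proof. by rewrite /dotp mxE; apply: eq_bigr => i _; rewrite mxE. Qed.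

Lemma dotpC u v : dotp u v = dotp v u.
Proof. by rewrite !dotpE; apply: eq_bigr => i _; rewrite mulrC. Qed.

Lemma dotpDl u v w : dotp (u + v) w = dotp u w + dotp v w.
Proof. by rewrite /dotp linearD mulmxDl mxE. Qed.

Lemma dotpZl c u v : dotp (c *: u) v = c * dotp u v.
Proof. by rewrite /dotp linearZ -scalemxAl mxE. Qed.

Lemma dotpDr u v w : dotp u (v + w) = dotp u v + dotp u w.
Proof. by rewrite dotpC dotpDl !(dotpC u). Qed.

Lemma dotpZr c u v : dotp u (c *: v) = c * dotp u v.
Proof. by rewrite dotpC dotpZl dotpC. Qed.

Lemma dotpNl u v : dotp (- u) v = - dotp u v.
Proof. by rewrite -scaleN1r dotpZl mulN1r. Qed.

Lemma dotpNr u v : dotp u (- v) = - dotp u v.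
Proof. by rewrite dotpC dotpNl dotpC. Qed.

Lemma dotpBl u v w : dotp (u - v) w = dotp u w - dotp v w.
Proof. by rewrite dotpDl dotpNl. Qed.

Lemma dotpBr u v w : dotp u (v - w) = dotp u v - dotp u w.
Proof. by rewrite dotpDr dotpNr. Qed.

Lemma dotp0l u : dotp 0 u = 0.
Proof. by rewrite -(scale0r (0 : 'cV_n)) dotpZl mul0r. Qed.

Lemma dotp0r u : dotp u 0 = 0.
Proof. by rewrite dotpC dotp0l. Qed.

Lemma dotp_ge0 u : 0 <= dotp u u.
Proof. by rewrite dotpE; apply: sumr_ge0 => i _; rewrite -expr2 sqr_ge0. Qed.

Lemma sqr_norm_le_dotp u : `|u| ^+ 2 <= dotp u u.
Proof.
rewrite -[leRHS]sqr_sqrtr ?dotp_ge0// ler_pXn2r ?nnegrE ?sqrtr_ge0//.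
apply: ler_norm_cV => [|i]; first by rewrite sqrtr_ge0.
rewrite -sqrtr_sqr ler_wsqrtr// dotpE (bigD1 i)//= -expr2 lerDl.
by apply: sumr_ge0 => j _; rewrite -expr2 sqr_ge0.
Qed.

Lemma ler_norm_dotp u v : `|dotp u v| <= n%:R * `|u| * `|v|.
Proof.
rewrite dotpE (le_trans (ler_norm_sum _ _ _))//.
apply: (@le_trans _ _ (\sum_(k < n) `|u| * `|v|)).
  by apply: ler_sum => k _; rewrite normrM ler_pM// ler_norm_entry.
by rewrite sumr_const card_ord -mulrA mulr_natl.
Qed.

Lemma dotp_le_sqr_norm u : dotp u u <= n%:R * `|u| ^+ 2.
Proof. by rewrite expr2 mulrA (le_trans _ (ler_norm_dotp _ _)) ?ler_norm. Qed.

Lemma dotp_eq0 u : (dotp u u == 0) = (u == 0).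
Proof.
apply/eqP/eqP => [u0|->]; last by rewrite dotp0l.
apply/eqP; rewrite -normr_eq0 -sqrf_eq0 eq_le sqr_ge0 andbT -u0.
exact: sqr_norm_le_dotp.
Qed.

Lemma dotp_gt0 u : u != 0 -> 0 < dotp u u.
Proof. by move=> u0; rewrite lt0r dotp_eq0 u0 dotp_ge0. Qed.

Lemma enormE u : enorm u = Num.sqrt (dotp u u).
Proof. by rewrite dotpE; congr Num.sqrt; apply: eq_bigr => i _; rewrite expr2. Qed.

Lemma sqr_enorm u : enorm u ^+ 2 = dotp u u.
Proof. by rewrite enormE sqr_sqrtr ?dotp_ge0. Qed.

Lemma enorm_ge0 u : 0 <= enorm u.
Proof. by rewrite enormE sqrtr_ge0. Qed.

Lemma norm_le_enorm u : `|u| <= enorm u.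
Proof.
by rewrite -(@ler_pXn2r _ 2) ?nnegrE ?enorm_ge0// sqr_enorm sqr_norm_le_dotp.
Qed.

Lemma enorm_le_norm u : enorm u <= n%:R * `|u|.
Proof.
rewrite -(@ler_pXn2r _ 2) ?nnegrE ?enorm_ge0 ?mulr_ge0// sqr_enorm.
rewrite (le_trans (dotp_le_sqr_norm _))// exprMn ler_wpM2r ?sqr_ge0//.
by case: n => [|k]; rewrite ?expr2 ?mul0r// ler_peMr// ler1n.
Qed.

Lemma dotp_mulmxT A u v : dotp u (A *m v) = dotp (A^T *m u) v.
Proof. by rewrite /dotp trmx_mul trmxK mulmxA. Qed.

Lemma quadfE A v : quadf A v = dotp v (A *m v).
Proof. by rewrite /quadf /dotp mulmxA. Qed.

Lemma quadfZ A c v : quadf A (c *: v) = c ^+ 2 * quadf A v.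
Proof. by rewrite !quadfE -scalemxAr dotpZl dotpZr mulrA. Qed.

End Norms.

(** * Derivatives of curves and differential inequalities *)

Section Derivatives.
Context {R : realType}.
Implicit Types (s t a b k : R).

Lemma is_derive_mxP m n (u : R -> 'M[R]_(m, n)) t (du : 'M[R]_(m, n)) :
  is_derive t 1 u du <->
  forall i j, is_derive t 1 (fun s => u s i j) (du i j).
Proof.
split=> [[dru <-] i j|du_].
  rewrite derive_mx// mxE; apply: derivableP.
  by have /derivable_mxP := dru; apply.
have dru : derivable u t 1 by apply/derivable_mxP => i j; case: (du_ i j).
apply: DeriveDef => //; rewrite derive_mx//; apply/matrixP => i j.
by rewrite mxE; case: (du_ i j).
Qed.

Lemma is_derive_sum1 n (h : 'I_n -> R -> R) t (dh : 'I_n -> R) :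
  (forall i, is_derive t 1 (h i) (dh i)) ->
  is_derive t 1 (fun s => \sum_i h i s) (\sum_i dh i).
Proof.
move=> hd; rewrite (_ : (fun s => _) = \sum_i h i); first exact: is_derive_sum.
by apply/funext => s; rewrite fct_sumE.
Qed.

Lemma is_derive_mulmx m n p (A : R -> 'M[R]_(m, n)) (B : R -> 'M[R]_(n, p))
    t dA dB : is_derive t 1 A dA -> is_derive t 1 B dB ->
  is_derive t 1 (fun s => A s *m B s) (dA *m B t + A t *m dB).
Proof.
move=> /is_derive_mxP hA /is_derive_mxP hB; apply/is_derive_mxP => i j.
rewrite !mxE -big_split /=.
rewrite (_ : (fun s => _) = fun s => \sum_k A s i k * B s k j); last first.
  by apply/funext => s; rewrite mxE.
apply: is_derive_sum1 => k.
by apply: is_derive_eq; rewrite /GRing.scale /= addrC mulrC; congr (_ + _); rewrite mulrC.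
Qed.

Lemma is_derive_trmx m n (A : R -> 'M[R]_(m, n)) t dA :
  is_derive t 1 A dA -> is_derive t 1 (fun s => (A s)^T) dA^T.
Proof.
move=> /is_derive_mxP hA; apply/is_derive_mxP => i j; rewrite mxE.
by rewrite (_ : (fun s => _) = fun s => A s j i)//; apply/funext => s; rewrite mxE.
Qed.

Lemma is_derive_dotp n (u v : R -> 'cV[R]_n) t du dv :
  is_derive t 1 u du -> is_derive t 1 v dv ->
  is_derive t 1 (fun s => dotp (u s) (v s)) (dotp du (v t) + dotp (u t) dv).
Proof.
move=> hu hv; have /is_derive_mxP/(_ 0 0) := is_derive_mulmx (is_derive_trmx hu) hv.
by rewrite mxE.
Qed.

(** Symmetry of A merges the two terms that differentiate v. *)
Lemma is_derive_quadf n (A : R -> 'M[R]_n) (v : R -> 'cV[R]_n) t dA dv :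
  (A t)^T = A t ->
  is_derive t 1 A dA -> is_derive t 1 v dv ->
  is_derive t 1 (fun s => quadf (A s) (v s))
    (quadf dA (v t) + 2 * dotp (v t) (A t *m dv)).
Proof.
move=> symA hA hv.
rewrite (_ : (fun s => _) = fun s => dotp (v s) (A s *m v s)); last first.
  by apply/funext => s; rewrite quadfE.
apply: is_derive_eq (is_derive_dotp hv (is_derive_mulmx hA hv)) _.
rewrite quadfE dotpDr (dotp_mulmxT (A t) (v t) dv) symA (dotpC _ dv).
ring.
Qed.

Lemma is_derive_mul (g h : R -> R) t dg dh :
  is_derive t 1 g dg -> is_derive t 1 h dh ->
  is_derive t 1 (fun s => g s * h s) (dg * h t + g t * dh).
Proof.
move=> hg hh; apply: is_derive_eq (is_deriveM hg hh) _.
by rewrite /GRing.scale /= addrC mulrC.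
Qed.

Lemma is_derive_scale n (c : R -> R) (v : R -> 'cV[R]_n) t dc dv :
  is_derive t 1 c dc -> is_derive t 1 v dv ->
  is_derive t 1 (fun s => c s *: v s) (dc *: v t + c t *: dv).
Proof.
move=> hc /is_derive_mxP hv; apply/is_derive_mxP => i j.
rewrite !mxE (_ : (fun s => _) = fun s => c s * v s i j); last first.
  by apply/funext => s; rewrite mxE.
exact: is_derive_mul.
Qed.

Lemma is_derive_continuous (V : normedModType R) (u : R -> V) t du :
  is_derive t 1 u du -> {for t, continuous u}.
Proof.
by move=> [/derivable1_diffP h _]; exact: differentiable_continuous.
Qed.

(** Curves glued from several solutions are differentiated with this: near each time
they coincide with one of the pieces. *)
Lemma is_derive_near (V : normedModType R) (u v : R -> V) t d :
  (\forall s \near t, u s = v s) -> is_derive t 1 u d -> is_derive t 1 v d.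
Proof.
move=> uv [du <-].
have vu : \near t, v t = u t by near=> s; rewrite (near uv s).
apply: DeriveDef; first exact: near_eq_derivable uv du.
by apply/esym; apply: near_eq_derive uv.
Unshelve. all: by end_near. Qed.

Lemma is_derive_comp (V W : normedModType R) (g : V -> W) (u : R -> V) t du :
  differentiable g (u t) -> is_derive t 1 u du ->
  is_derive t 1 (fun s => g (u s)) ('d g (u t) du).
Proof.
move=> dg [/derivable1_diffP dut <-].
have dc : differentiable (g \o u) t by exact: differentiable_comp.
apply: DeriveDef; first exact/derivable1_diffP.
by rewrite -[LHS]/('D_1 (g \o u) t) deriveE// diff_comp//= -(deriveE (1 : R^o) dut).
Qed.

Lemma is_derive_comp1 (V : normedModType R) (z : R -> V) (h : R -> R) t dh (dz : V) :
  is_derive t 1 h dh -> is_derive (h t) 1 z dz ->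
  is_derive t 1 (fun s => z (h s)) (dh *: dz).
Proof.
move=> hh [/derivable1_diffP dzt <-].
have := is_derive_comp dzt hh.
by rewrite -[X in 'd z (h t) X]mulr1 -[dh * 1]/(dh *: (1 : R^o)) linearZ /= deriveE.
Qed.

Lemma is_derive_mulc a t : is_derive t 1 (fun s => a * s) a.
Proof. by apply: is_derive_eq; rewrite /GRing.scale /= mulr1. Qed.

Lemma is_derive_translate (V : normedModType R) (u : R -> V) a t d :
  is_derive (t + a) 1 u d -> is_derive t 1 (fun s => u (s + a)) d.
Proof.
have h : is_derive t 1 (fun s : R => s + a) 1 by apply: is_derive_eq; rewrite addr0.
by move=> hu; have := is_derive_comp1 h hu; rewrite scale1r.
Qed.

Lemma is_derive_reverse (V : normedModType R) (u : R -> V) t d :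
  is_derive (- t) 1 u d -> is_derive t 1 (fun s => u (- s)) (- d).
Proof.
have h : is_derive t 1 (fun s : R => - s) (- 1) by apply: is_derive_eq.
by move=> hu; have := is_derive_comp1 h hu; rewrite scaleN1r.
Qed.

Lemma nondecreasing_is_derive (g dg : R -> R) a b :
  (forall s, a <= s <= b -> is_derive s 1 g (dg s)) ->
  (forall s, a <= s <= b -> 0 <= dg s) -> a <= b -> g a <= g b.
Proof.
move=> gd dg0 ab.
have [||c cab] := @MVT_segment _ g dg a b ab.
- by move=> x; rewrite in_itv /= => /andP[ax xb]; apply: gd; rewrite !ltW.
- apply: continuous_in_subspaceT => x; rewrite inE /= in_itv /= => xab.
  exact: is_derive_continuous (gd _ xab).
move/eqP; rewrite subr_eq addrC => /eqP ->.
by rewrite lerDl mulr_ge0 ?subr_ge0// dg0//; move: cab; rewrite in_itv.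
Qed.

Lemma ler_is_derive (g h dg dh : R -> R) a b :
  (forall s, a <= s <= b -> is_derive s 1 g (dg s)) ->
  (forall s, a <= s <= b -> is_derive s 1 h (dh s)) ->
  (forall s, a <= s <= b -> dg s <= dh s) -> a <= b ->
  g b - g a <= h b - h a.
Proof.
move=> gd hd le_d ab.
have : (h - g) a <= (h - g) b.
  apply: (@nondecreasing_is_derive (h - g) (fun s => dh s - dg s)) => // s sab.
    by have := gd s sab; have := hd s sab => *; exact: is_deriveB.
  by rewrite subr_ge0 le_d.
rewrite -[(h - g) a]/(h a - g a) -[(h - g) b]/(h b - g b); lra.
Qed.

Lemma ler_norm_is_derive (g h dg dh : R -> R) a b :
  (forall s, a <= s <= b -> is_derive s 1 g (dg s)) ->
  (forall s, a <= s <= b -> is_derive s 1 h (dh s)) ->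
  (forall s, a <= s <= b -> `|dg s| <= dh s) -> a <= b ->
  `|g b - g a| <= h b - h a.
Proof.
move=> gd hd le_d ab; rewrite ler_norml; apply/andP; split; last first.
  by apply: (ler_is_derive gd hd) => // s sab; rewrite (le_trans (ler_norm _))// le_d.
have gNd s : a <= s <= b -> is_derive s 1 (- g) (- dg s).
  by move=> /gd ?; exact: is_deriveN.
have := ler_is_derive gNd hd _ ab.
rewrite -[(- g) a]/(- g a) -[(- g) b]/(- g b) => H.
suff : - g b - - g a <= h b - h a by lra.
by apply: H => s sab; rewrite (le_trans _ (le_d s sab))// -normrN ler_norm.
Qed.

Lemma is_derive_expRM k t : is_derive t 1 (fun s : R => expR (k * s)) (k * expR (k * t)).
Proof.
have := is_derive_mulc k t => h.
by apply: is_derive_eq; rewrite /GRing.scale /= mulrC.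
Qed.

(** The function exp(- k s) g(s) is nonincreasing. *)
Lemma gronwall (g dg : R -> R) k a b :
  (forall s, a <= s <= b -> is_derive s 1 g (dg s)) ->
  (forall s, a <= s <= b -> dg s <= k * g s) -> a <= b ->
  g b <= expR (k * (b - a)) * g a.
Proof.
move=> gd le_d ab.
pose h s := expR ((- k) * s) * g s.
have hd s : a <= s <= b -> is_derive s 1 (fun s => - h s) (expR (- k * s) * (k * g s - dg s)).
  move=> sab; have := gd _ sab; have := is_derive_expRM (- k) s => h1 h2.
  rewrite /h; apply: is_derive_eq; rewrite /GRing.scale /=; ring.
have : - h a <= - h b.
  apply: (nondecreasing_is_derive hd) => // s sab.
  by rewrite mulr_ge0 ?expR_ge0// subr_ge0 le_d.
rewrite lerN2 /h => hab.
have -> : k * (b - a) = k * b - k * a by ring.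
rewrite expRB -(ler_pM2l (expR_gt0 (- k * b))) (le_trans hab)//.
have -> : expR (- k * a) = (expR (k * a))^-1 by rewrite mulNr expRN.
have : expR (- k * b) * expR (k * b) = 1 by rewrite -expRD mulNr addNr expR0.
by move=> h1; rewrite !mulrA h1 mul1r.
Qed.

End Derivatives.

(** * Global solutions of Lipschitz differential equations *)

Section Picard.
Context {R : realType}.
Implicit Types (s t a b : R).

Lemma norm_ltD1 s t : `|t - s| < 1 -> `|s| < `|t| + 1.
Proof.
move=> ts; have := ler_normD t (s - t).
by rewrite addrC subrK => /le_lt_trans; apply; rewrite ltrD2l distrC.
Qed.

Lemma antiderivative1 (g : R -> R) : continuous g ->
  exists G : R -> R, G 0 = 0 /\ forall t, is_derive t 1 G (g t).
Proof.
move=> cg.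
(* The primitive starting at - N is differentiable on ]- N, +oo[; those for
   different N agree up to a constant. *)
pose P N t := (\int[lebesgue_measure]_(x in [set` `[- N, t]]) g x)%R.
have Pd N t : - N < t -> is_derive t 1 (P N) (g t).
  move=> Nt; have ltt1 : t < t + 1 by rewrite ltrDl.
  have intg : lebesgue_measure.-integrable `[- N, t + 1] (EFin \o g).
    apply: continuous_compact_integrable; first exact: segment_compact.
    exact: continuous_subspaceT.
  have [d1 d2] := continuous_FTC1_closed ltt1 intg Nt (cg t).
  by apply: DeriveDef; [exact: d1|rewrite -derive1E; exact: d2].
have PP (N N' : R) t : `|t| < N -> `|t| < N' -> P N t - P N 0 = P N' t - P N' 0.
  move=> tN tN'.
  have cst_ a b : `|a| < N -> `|b| < N -> `|a| < N' -> `|b| < N' -> a <= b ->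
      P N b - P N' b = P N a - P N' a.
    move=> aN bN aN' bN' ab; apply/eqP; rewrite -subr_eq0 -normr_le0.
    have := @ler_norm_is_derive _ (P N \- P N')%R (fun=> 0) (fun=> 0) (fun=> 0) a b.
    rewrite subrr; apply => // s /andP[as_ sb]; last by rewrite normr0.
    have Ns m : `|a| < m -> - m < s.
      by rewrite ltr_norml => /andP[h _]; exact: lt_le_trans as_.
    have ? := Pd _ _ (Ns _ aN); have ? := Pd _ _ (Ns _ aN').
    by rewrite -(subrr (g s)); exact: is_deriveB.
  have N0 : `|0 : R| < N by rewrite normr0; exact: le_lt_trans tN.
  have N'0 : `|0 : R| < N' by rewrite normr0; exact: le_lt_trans tN'.
  by have [t0|/ltW t0] := leP 0 t; [have := cst_ _ _ N0 tN N'0 tN' t0 |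
    have := cst_ _ _ tN N0 tN' N'0 t0]; lra.
exists (fun t => P (`|t| + 1) t - P (`|t| + 1) 0); split=> [|t].
  by rewrite subrr.
apply: (@is_derive_near _ _ (fun s => P (`|t| + 2) s - P (`|t| + 2) 0)).
  near=> s; apply: PP; last by rewrite ltrDl.
  have : `|t - s| < 1.
    by near: s; apply: (@cvgr_dist_lt _ _ _ _ _ id); [exact: cvg_id|].
  by move=> /norm_ltD1; lra.
have /ltr_normlW : `|- t| < `|t| + 2 by rewrite normrN ltrDl.
rewrite ltrNl => /Pd ?.
by apply: is_derive_eq; rewrite subr0.
Unshelve. all: by end_near. Qed.

Lemma cV_entry_continuous n (u : R -> 'cV[R]_n) i :
  continuous u -> continuous (fun t => u t i 0).
Proof.
by move=> cu t; apply: (@continuous_comp _ _ _ u (fun x : 'cV[R]_n => x i 0));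
   [exact: cu|exact: coord_continuous].
Qed.

Lemma antiderivative n (g : R -> 'cV[R]_n) : continuous g ->
  exists G : R -> 'cV[R]_n, G 0 = 0 /\ forall t, is_derive t 1 G (g t).
Proof.
move=> cg.
have /choice[G Gg] : forall i : 'I_n, exists Gi : R -> R,
    Gi 0 = 0 /\ forall t, is_derive t 1 Gi (g t i 0).
  by move=> i; apply: antiderivative1; exact: cV_entry_continuous.
exists (fun t => \col_i G i t); split=> [|t].
  by apply/matrixP => i j; rewrite !mxE; case: (Gg i).
apply/is_derive_mxP => i j; rewrite ord1.
rewrite (_ : (fun s => _) = G i); last by apply/funext => s; rewrite mxE.
by case: (Gg i).
Qed.

(** Integrating exp(k |s|) gains a factor 1 / k. This makes the Picard operator a
contraction for the norm weighted by exp(- 2 L |t|), without restriction on the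
length of the time interval. *)
Lemma growth_is_derive n (u du : R -> 'cV[R]_n) (C k : R) t : 0 < k -> 0 <= C ->
  (forall s, is_derive s 1 u (du s)) ->
  (forall s, `|du s| <= C * expR (k * `|s|)) ->
  `|u t - u 0| <= C / k * expR (k * `|t|).
Proof.
move=> k0 C0.
have pos_t (v dv : R -> 'cV[R]_n) (r : R) : (forall s, is_derive s 1 v (dv s)) ->
    (forall s, `|dv s| <= C * expR (k * `|s|)) -> 0 <= r ->
    `|v r - v 0| <= C / k * expR (k * r).
  move=> vd dvC r0; apply: ler_norm_cV => [|i].
    by rewrite !mulr_ge0 ?invr_ge0 ?expR_ge0// ltW.
  rewrite !mxE.
  have H := @ler_norm_is_derive _ (fun s => v s i 0) (fun s => C / k * expR (k * s))
    (fun s => dv s i 0) (fun s => C * expR (k * s)) 0 r.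
  have {H} : `|v r i 0 - v 0 i 0| <= C / k * expR (k * r) - C / k * expR (k * 0).
    apply: H => // s /andP[s0 sr].
    - by have /is_derive_mxP/(_ i 0) := vd s.
    - have h1 := is_derive_expRM k s.
      apply: is_derive_eq (is_derive_mul (is_derive_cst (C / k) s 1) h1) _.
      by rewrite mul0r add0r mulrA divfK// gt_eqF.
    - by rewrite (le_trans (ler_norm_entry _ _ _))// (le_trans (dvC _))// ger0_norm.
  move=> /le_trans; apply; rewrite gerBl.
  by rewrite !mulr_ge0 ?invr_ge0 ?expR_ge0// ltW.
move=> ud duC; have [t0|t0] := leP 0 t; first by rewrite ger0_norm// pos_t.
have := pos_t (fun s => u (- s)) (fun s => - du (- s)) (- t).
rewrite opprK oppr0 ltr0_norm//; apply => [s|s|]; last by rewrite oppr_ge0 ltW.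
  exact: is_derive_reverse.
by rewrite normrN (le_trans (duC _))// normrN.
Qed.

Lemma le0_geometric (x C : R) : (forall k : nat, x <= C * 2 ^- k) -> x <= 0.
Proof.
move=> xC; rewrite leNgt; apply/negP => x0.
have C0 : 0 < C by have := xC 0%N; rewrite expr0 invr1 mulr1; exact: lt_le_trans.
have [k kC] : exists k : nat, C / x < k%:R.
  by exists (Num.truncn (C / x)).+1; exact: truncnS_gt.
have /(lt_le_trans kC) : k%:R <= 2 ^+ k :> R.
  by rewrite -natrX ler_nat ltnW// ltn_expl.
rewrite ltr_pdivrMr// => h; have := xC k; rewrite leNgt; apply/negP/negPn.
by rewrite ltr_pdivrMr ?exprn_gt0// mulrC.
Qed.

(** The sequences u k - 2 E 2^-k and u k + 2 E 2^-k are monotone and enclose the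
limit, which is obtained as a supremum together with an explicit rate. *)
Lemma geometric_cvg (u : nat -> R) (E : R) :
  (forall k : nat, `|u k.+1 - u k| <= E * 2 ^- k) ->
  exists l, forall k : nat, `|u k - l| <= 2 * E * 2 ^- k.
Proof.
move=> uE.
pose e (k : nat) := 2 * E * 2 ^- k.
have eS k : e k.+1 = e k - E * 2 ^- k.
  by rewrite /e exprS invfM; field; rewrite expf_neq0.
have E0 : 0 <= E by have := uE 0%N; rewrite expr0 invr1 mulr1; exact: le_trans.
have e0 k : 0 <= e k by rewrite /e !mulr_ge0// invr_ge0 exprn_ge0.
have ubE k m : (u k - e k <= u (k + m)%N - e (k + m)%N) /\
               (u (k + m)%N + e (k + m)%N <= u k + e k).
  elim: m => [|m [ih1 ih2]]; first by rewrite addn0.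
  rewrite addnS eS; move: (uE (k + m)%N); rewrite ler_norml => /andP[h1 h2].
  split; lra.
have ae j k : u j - e j <= u k + e k.
  have [/subnKC <-|/ltnW/subnKC <-] := leqP j k.
    by have [] := ubE j (k - j)%N; have := e0 (j + (k - j))%N; lra.
  by have [_] := ubE k (j - k)%N; have := e0 (k + (j - k))%N; lra.
pose A := range (fun k => u k - e k).
have A0 : A !=set0 by exists (u 0%N - e 0%N), 0%N.
exists (sup A) => k.
have ubA : ubound A (u k + e k) by move=> _ [j _ <-]; exact: ae.
have h1 : sup A <= u k + e k by exact: ge_sup.
have h2 : u k - e k <= sup A.
  by apply: ub_le_sup; [exists (u k + e k)|exists k].
by rewrite -/(e k) ler_norml; lra.
Qed.

(** Picard iteration on the whole time axis. The iterates satisfy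
|y_(k+1) t - y_k t| <= D 2^-k exp(2 L |t|), by [growth_is_derive]. *)
Lemma picard n (F : R -> 'cV[R]_n -> 'cV[R]_n) (L B : R) (c : 'cV[R]_n) :
  0 < L -> 0 <= B ->
  (forall t x y, `|F t x - F t y| <= L * `|x - y|) ->
  (forall t, `|F t c| <= B) ->
  (forall y : R -> 'cV[R]_n, continuous y -> continuous (fun t => F t (y t))) ->
  exists y : R -> 'cV[R]_n, y 0 = c /\ forall t, is_derive t 1 y (F t (y t)).
Proof.
move=> L0 B0 FL Fc Fcont.
have /choice[T TP] : forall y : R -> 'cV[R]_n, exists z : R -> 'cV[R]_n,
    continuous y -> z 0 = c /\ forall t, is_derive t 1 z (F t (y t)).
  move=> y; have [cy|ncy] := pselect (continuous y); last by exists y.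
  have [G [G0 Gd]] := antiderivative (Fcont _ cy).
  exists (fun t => c + G t) => _; rewrite G0 addr0; split=> // t.
  have ? := Gd t; rewrite -[F t (y t)]add0r; exact: is_deriveD.
have Tc y : continuous y -> continuous (T y).
  by move=> /TP[_ Td] t; exact: is_derive_continuous (Td t).
pose y k := iter k T (fun=> c).
have cy k : continuous (y k).
  by elim: k => [|k ih]; [exact: cst_continuous|exact: Tc].
have yS0 k : y k.+1 0 = c by have [] := TP _ (cy k).
have ySd k t : is_derive t 1 (y k.+1) (F t (y k t)) by have [_] := TP _ (cy k).
pose D := B / (2 * L).
have D0 : 0 <= D by rewrite /D divr_ge0// mulr_ge0// ltW.
have L20 : 0 < 2 * L by rewrite mulr_gt0.
pose E t := expR (2 * L * `|t|).
have E0 t : 0 <= E t by exact: expR_ge0.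
have step (z1 z2 y1 y2 : R -> 'cV[R]_n) (C : R) t : 0 <= C -> z1 0 = z2 0 ->
    (forall s, is_derive s 1 z1 (F s (y1 s))) ->
    (forall s, is_derive s 1 z2 (F s (y2 s))) ->
    (forall s, `|y1 s - y2 s| <= C * E s) ->
    `|z1 t - z2 t| <= C / 2 * E t.
  move=> C0 z0 z1d z2d yC.
  have zd s : is_derive s 1 (z1 - z2) (F s (y1 s) - F s (y2 s)).
    by have := z1d s; have := z2d s => ? ?; exact: is_deriveB.
  have := @growth_is_derive _ _ _ (L * C) (2 * L) t L20 _ zd.
  rewrite -[(z1 - z2) t]/(z1 t - z2 t) -[(z1 - z2) 0]/(z1 0 - z2 0) z0 subrr subr0.
  have -> : L * C / (2 * L) = C / 2 by field; rewrite gt_eqF.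
  apply; first by rewrite mulr_ge0// ltW.
  by move=> s; rewrite (le_trans (FL _ _ _))// -mulrA ler_wpM2l// ltW.
have dy k t : `|y k.+1 t - y k t| <= D * 2 ^- k * E t.
  elim: k t => [t|k ih t].
    rewrite expr0 invr1 mulr1.
    have := @growth_is_derive _ _ _ B (2 * L) t L20 B0 (ySd 0%N).
    rewrite yS0; apply => s; rewrite (le_trans (Fc _))// ler_peMr//.
    by rewrite -expR0 ler_expR !mulr_ge0// ltW.
  have -> : D * 2 ^- k.+1 = D * 2 ^- k / 2 by rewrite exprSr invfM mulrA.
  apply: (step _ _ (y k.+1) (y k)) => //.
    by rewrite mulr_ge0// invr_ge0 exprn_ge0.
  by rewrite !yS0.
have /choice[z zy] : forall t, exists x : 'cV[R]_n, forall k, `|y k t - x| <= 2 * (D * E t) * 2 ^- k.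
  move=> t.
  have /choice[l lP] : forall i, exists l, forall k, `|y k t i 0 - l| <= 2 * (D * E t) * 2 ^- k.
    move=> i; apply: geometric_cvg => k; rewrite mulrAC.
    apply: le_trans (dy k t); apply: le_trans (ler_norm_entry _ i 0).
    by rewrite !mxE.
  exists (\col_i l i) => k; apply: ler_norm_cV => [|i]; last by rewrite !mxE.
  by rewrite mulr_ge0 ?invr_ge0 ?exprn_ge0// mulr_ge0// mulr_ge0// E0.
have cz : continuous z.
  move=> t; apply/cvgrPdist_le => /= e e0.
  (* C 2^-k bounds the distance of the k-th iterate to the limit at all times
     within 1 of t. *)
  pose C := 2 * (D * E (`|t| + 1)).
  have [k Ck] : exists k : nat, C * 2 ^- k < e / 4.
    apply: contrapT => /forallNP H.
    have : e / 4 <= 0.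
      apply: (@le0_geometric _ C) => k; rewrite leNgt; exact/negP/H.
    by lra.
  near=> s.
  have ts : `|t - s| < 1.
    by near: s; apply: (@cvgr_dist_lt _ _ _ _ _ id); [exact: cvg_id|].
  have yts : `|y k t - y k s| <= e / 4.
    by near: s; apply: (@cvgr_dist_le _ _ _ _ _ _ _ (cy k t)); lra.
  have EC r : `|r| <= `|t| + 1 -> `|y k r - z r| <= e / 4.
    move=> r1; rewrite (le_trans (zy _ _))// (le_trans _ (ltW Ck))//.
    rewrite ler_wpM2r ?invr_ge0 ?exprn_ge0// ler_wpM2l// ler_wpM2l// /E ler_expR.
    by apply: ler_wpM2l; [exact: ltW|rewrite (le_trans r1)// ler_norm].
  have h1 : `|y k t - z t| <= e / 4 by apply: EC; lra.
  have h2 : `|y k s - z s| <= e / 4.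
    by apply: EC; exact: ltW (norm_ltD1 ts).
  have -> : z t - z s = (z t - y k t) + (y k t - y k s) + (y k s - z s).
    by rewrite !subrKA.
  apply: (le_trans (ler_normD _ _)); apply: (@le_trans _ _ (e / 4 + e / 4 + e / 4)).
    apply: lerD => //; apply: (le_trans (ler_normD _ _)); apply: lerD => //.
    by rewrite distrC.
  by lra.
have [Tz0 Tzd] := TP _ cz.
have zT t : z t = T z t.
  apply/eqP; rewrite -subr_eq0 -normr_le0.
  apply: (@le0_geometric _ (2 * (D * E t))) => k.
  have h1 := zy t k.+1.
  have h2 : `|y k.+1 t - T z t| <= 2 * D * 2 ^- k / 2 * E t.
    apply: (step _ _ (y k) z) => //; last 1 first.
    - by move=> s; apply: (le_trans (zy s k)); apply: ler_of_eq; ring.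
    - by rewrite mulr_ge0 ?invr_ge0 ?exprn_ge0// mulr_ge0.
    - by rewrite yS0 Tz0.
  have -> : z t - T z t = (z t - y k.+1 t) + (y k.+1 t - T z t) by rewrite addrA subrK.
  apply: (le_trans (ler_normD _ _)); rewrite distrC (le_trans (lerD h1 h2))//.
  apply: ler_of_eq.
  by rewrite exprS invfM; field; rewrite expf_neq0.
exists z; split=> [|t]; first by rewrite zT.
by rewrite (_ : z = T z); [rewrite -[X in F _ (X t)](_ : z = _)//; apply/funext|apply/funext].
Unshelve. all: by end_near. Qed.

End Picard.

(** * Continuously differentiable vector fields *)

Section Chain.
Context {R : realType}.
Implicit Types (s t a b : R).

(** Convergence of matrices is entrywise because the norm is the maximum of finitely
many entries. *)
Lemma cvg_mx (T : Type) (F : set_system T) {FF : Filter F} m n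
    (u : T -> 'M[R]_(m, n)) (l : 'M[R]_(m, n)) :
  (forall i j, u x i j @[x --> F] --> l i j) -> u x @[x --> F] --> l.
Proof.
move=> ul; apply/cvgrPdist_le => e e0.
have H : \forall x \near F, forall ij : 'I_m * 'I_n, `|l ij.1 ij.2 - u x ij.1 ij.2| <= e.
  by apply: filter_forall => -[i j] /=; have /cvgrPdist_le := ul i j; exact.
near=> x; apply: ler_norm_mx => [|i j]; first exact: ltW.
by have := near H x; rewrite !mxE => /(_ _ (i, j)); apply.
Unshelve. all: by end_near. Qed.

Lemma continuous_mx (T : topologicalType) m n (u : T -> 'M[R]_(m, n)) :
  (forall i j, continuous (fun x => u x i j)) -> continuous u.
Proof.
by move=> cu x; apply: (@cvg_mx _ (nbhs x) _ _ _ u) => i j; exact: cu.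
Qed.

Variable n : nat.
Implicit Types (x y v w : 'cV[R]_n).

Lemma diff_gradient (g : 'cV[R]_n -> R) x v :
  differentiable g x -> 'd g x v = dotp (gradient g x) v.
Proof.
move=> dg; rewrite dotpE {1}(matrix_sum_delta v) linear_sum /=.
apply: eq_bigr => i _; rewrite big_ord1 linearZ mxE deriveE//.
by rewrite /GRing.scale /= mulrC.
Qed.

Lemma diff_Jac (g : 'cV[R]_n -> 'cV[R]_n) x v :
  differentiable g x -> 'd g x v = Jac g x *m v.
Proof.
move=> dg; rewrite {1}(matrix_sum_delta v) linear_sum /=.
apply/matrixP => i j; rewrite ord1 mxE summxE.
apply: eq_bigr => k _; rewrite big_ord1 linearZ /= !mxE -deriveE//.
rewrite derive_mx ?mxE; last exact: diff_derivable.
by rewrite mulrC.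
Qed.

Lemma is_derive_gradient (g : 'cV[R]_n -> R) (u : R -> 'cV[R]_n) t du :
  differentiable g (u t) -> is_derive t 1 u du ->
  is_derive t 1 (fun s => g (u s)) (dotp (gradient g (u t)) du).
Proof. by move=> dg hu; rewrite -diff_gradient//; exact: is_derive_comp. Qed.

Lemma is_derive_Jac (g : 'cV[R]_n -> 'cV[R]_n) (u : R -> 'cV[R]_n) t du :
  differentiable g (u t) -> is_derive t 1 u du ->
  is_derive t 1 (fun s => g (u s)) (Jac g (u t) *m du).
Proof. by move=> dg hu; rewrite -diff_Jac//; exact: is_derive_comp. Qed.

(** The orbital derivative of the statement is the time derivative of M along a
solution, by the chain rule applied to each entry. *)
Lemma is_derive_orbital (f : 'cV[R]_n -> 'cV[R]_n) (M : 'cV[R]_n -> 'M[R]_n)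
    (u : R -> 'cV[R]_n) t :
  differentiable M (u t) -> is_derive t 1 u (f (u t)) ->
  is_derive t 1 (fun s => M (u s)) (orbital_deriv f M (u t)).
Proof.
move=> dM hu; apply/is_derive_mxP => i j; rewrite mxE.
apply: (is_derive_gradient (g := fun y => M y i j)) => //.
have := differentiable_comp dM (differentiable_coord (M (u t)) i j).
by [].
Qed.

End Chain.

Section C1.
Context {R : realType} {n : nat}.
Implicit Types (s t a b : R) (x y v w : 'cV[R]_n).

Definition C1map (f : 'cV[R]_n -> 'cV[R]_n) :=
  (forall x, differentiable f x) /\ (forall v, continuous (fun x => 'D_v f x)).

Lemma Ck_on_C1map sigma f : (1 <= sigma)%N -> Ck_on setT sigma f -> C1map f.
Proof.
case: sigma => // k _ [df Df]; split=> [x|v x]; first exact: df.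
case: k Df => [|k] Df; first exact: (Df v x I).
by have [h _] := Df v; exact/differentiable_continuous/h.
Qed.

Lemma C1mapN f : C1map f -> C1map (fun x => - f x).
Proof.
move=> [df Df]; split=> [x|v x]; first exact: (differentiableN (df x)).
have E y : 'D_v (fun x => - f x) y = - 'D_v f y.
  by rewrite -deriveN//; exact: diff_derivable.
rewrite (_ : (fun x => _) = fun x => - 'D_v f x); last by apply/funext.
exact: (cvgN (Df v x)).
Qed.

Variable f : 'cV[R]_n -> 'cV[R]_n.
Hypothesis fC1 : C1map f.

Lemma C1map_continuous : continuous f.
Proof. by move=> x; apply: differentiable_continuous; exact: fC1.1. Qed.

Lemma JacE x i j : Jac f x i j = 'D_(delta_mx j 0) f x i 0.
Proof. by rewrite mxE derive_mx ?mxE//; exact: diff_derivable (fC1.1 x). Qed.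

Lemma Jac_continuous : continuous (Jac f).
Proof.
apply: continuous_mx => i j x.
rewrite (_ : (fun y => _) = fun y => 'D_(delta_mx j 0) f y i 0); last first.
  by apply/funext => y; exact: JacE.
apply: (@continuous_comp _ _ _ (fun y => 'D_(delta_mx j 0) f y) (fun z : 'cV[R]_n => z i 0)).
  exact: fC1.2.
exact: coord_continuous.
Qed.

Lemma is_derive_segment x v s : is_derive s 1 (fun s => x + s *: v) v.
Proof.
have h : is_derive s 1 (fun s : R => s *: v) v.
  have := is_derive_scale (is_derive_id s 1) (is_derive_cst v s 1).
  by rewrite scale1r scaler0 addr0.
by rewrite -[X in is_derive _ _ _ X]add0r; exact: is_deriveD.
Qed.

(** The mean value inequality along the segment from x to x + v, applied to f minus
the linear map with value c: with c = 0 it gives Lipschitz bounds, with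
c = Df(x) v the Taylor remainder. *)
Lemma mean_value_ineq x v c e :
  (forall s, 0 <= s <= 1 -> `|Jac f (x + s *: v) *m v - c| <= e) ->
  `|f (x + v) - f x - c| <= e.
Proof.
move=> Je.
have e0 : 0 <= e by apply: le_trans (Je 0 _); rewrite ?lexx ?ler01.
apply: ler_norm_cV => // i.
pose g s := (f (x + s *: v) - s *: c) i 0.
have := @ler_norm_is_derive _ g (fun s => e * s)
  (fun s => (Jac f (x + s *: v) *m v - c) i 0) (fun=> e) 0 1.
rewrite /g scale1r scale0r addr0 scale1r scale0r subr0 mulr0 mulr1 subr0.
rewrite !mxE (addrAC (f (x + v) i 0)); apply => // s s01.
- have h1 := is_derive_Jac (fC1.1 _) (is_derive_segment x v s).
  have h2 := is_derive_scale (is_derive_id s 1) (is_derive_cst c s 1).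
  rewrite scale1r scaler0 addr0 in h2.
  by have /is_derive_mxP/(_ i 0) := is_deriveB h1 h2.
- exact: is_derive_mulc.
- by rewrite (le_trans (ler_norm_entry _ _ _))// Je.
Qed.

End C1.

Section Compactness.
Context {R : realType} {n : nat}.
Implicit Types (K : set 'cV[R]_n).

Lemma compact_ball (r : R) : compact [set x : 'cV[R]_n | `|x| <= r].
Proof.
have [r0|r0] := leP 0 r; last first.
  rewrite (_ : mkset _ = set0); first exact: compact0.
  apply/seteqP; split => // x /= xr; have := normr_ge0 x.
  by rewrite leNgt (le_lt_trans xr).
have cA : compact [set v : 'rV[R]_n | forall i, `[- r, r]%classic (v ord0 i)].
  by apply: (@rV_compact _ _ (fun=> `[- r, r]%classic)) => i; exact: segment_compact.
have ct : continuous (fun v : 'rV[R]_n => v^T).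
  apply: continuous_mx => i j.
  rewrite (_ : (fun x : 'rV_n => _) = fun x => x j i); last by apply/funext => x; rewrite mxE.
  exact: coord_continuous.
rewrite (_ : mkset _ = (fun v : 'rV[R]_n => v^T) @` [set v : 'rV[R]_n | forall i, `[- r, r]%classic (v ord0 i)]).
  by apply: continuous_compact => //; exact: continuous_subspaceT.
apply/seteqP; split=> [x xr /=|_ [v vr <-]].
  exists x^T; last by rewrite trmxK.
  by move=> i; rewrite mxE /= in_itv /= -ler_norml (le_trans (ler_norm_entry _ _ _)).
apply: ler_norm_cV => // i; rewrite mxE ler_norml.
by have := vr i; rewrite /= in_itv.
Qed.

Lemma compact_norm_bounded (T : topologicalType) (V : normedModType R) (g : T -> V) (A : set T) :
  compact A -> {in A, continuous g} -> exists2 C, 0 <= C & forall x, A x -> `|g x| <= C.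
Proof.
move=> cA cg.
have /compact_bounded[C [_ Cg]] : compact (g @` A).
  by apply: continuous_compact => //; exact: continuous_in_subspaceT.
exists (Num.max 0 (C + 1)); first by rewrite le_max lexx.
move=> x Ax; rewrite le_max; apply/orP; right; apply: Cg; last by exists x.
by rewrite ltrDl.
Qed.

End Compactness.

Section Lipschitz.
Context {R : realType} {n : nat}.
Implicit Types (s t a b : R) (x y v w : 'cV[R]_n) (K : set 'cV[R]_n).
Variable f : 'cV[R]_n -> 'cV[R]_n.
Hypothesis fC1 : C1map f.

Lemma C1_lipschitz_ball (r : R) : exists2 L, 0 < L &
  forall x y, `|x| <= r -> `|y| <= r -> `|f x - f y| <= L * `|x - y|.
Proof.
have [C C0 JC] := compact_norm_bounded (@compact_ball _ _ r) (fun x _ => @Jac_continuous _ _ _ fC1 x).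
exists (n%:R * C + 1); first by rewrite ltr_wpDl// mulr_ge0.
move=> x y xr yr.
have := @mean_value_ineq _ _ _ fC1 y (x - y) 0 ((n%:R * C + 1) * `|x - y|).
rewrite subr0 (addrC y) subrK; apply => s /andP[s0 s1]; rewrite subr0.
apply: (le_trans (ler_norm_mulmx _ _)); rewrite ler_wpM2r//.
apply: (@le_trans _ _ (n%:R * C)); last by rewrite lerDl.
rewrite ler_wpM2l//; apply: JC => /=.
have -> : y + s *: (x - y) = (1 - s) *: y + s *: x.
  by rewrite scalerBr scalerBl scale1r addrA addrAC.
rewrite (le_trans (ler_normD _ _))// !normrZ !ger0_norm ?subr_ge0//.
apply: (@le_trans _ _ ((1 - s) * r + s * r)).
  by apply: lerD; rewrite ler_wpM2l// subr_ge0.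
by rewrite -mulrDl subrK mul1r.
Qed.

(** Df is continuous, so by compactness Df(x + w) - Df(x) is small uniformly for x in
K when w is small, and [mean_value_ineq] turns this into a bound on the remainder. *)
Lemma uniform_taylor K : compact K -> forall e, 0 < e -> exists2 d, 0 < d &
  forall x w, K x -> `|w| <= d -> `|f (x + w) - f x - Jac f x *m w| <= e * `|w|.
Proof.
move=> cK e e0.
pose e' := e / (n%:R + 1).
have n1 : 0 < n%:R + 1 :> R by rewrite ltr_wpDl.
have e'0 : 0 < e' by rewrite divr_gt0.
have H : \forall w \near (0 : 'cV[R]_n), K `<=` (fun x => `|Jac f (x + w) - Jac f x| <= e').
  apply: ((compact_near_coveringP K).1 cK _ (nbhs (0 : 'cV[R]_n))
    (fun w x => `|Jac f (x + w) - Jac f x| <= e')) => x Kx.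
  have h1 : (Jac f (p.1 + p.2) - Jac f p.1) @[p --> (x, 0 : 'cV[R]_n)] --> Jac f (x + 0) - Jac f x.
    apply: cvgB.
      apply: continuous_cvg; first exact: (@Jac_continuous _ _ _ fC1).
      by apply: cvgD; [exact: cvg_fst|exact: cvg_snd].
    by apply: continuous_cvg; [exact: (@Jac_continuous _ _ _ fC1)|exact: cvg_fst].
  rewrite addr0 subrr in h1.
  have /cvgr0Pnorm_le /(_ _ e'0) := h1.
  by [].
have /nbhs_ballP[d /= d0 dH] := H.
exists (d / 2); first by rewrite divr_gt0.
move=> x w Kx wd; apply: (@mean_value_ineq _ _ _ fC1) => s /andP[s0 s1].
rewrite -mulmxBl; apply: (le_trans (ler_norm_mulmx _ _)); rewrite ler_wpM2r//.
apply: (@le_trans _ _ (n%:R * e')); last first.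
  by rewrite /e' mulrCA ler_piMr ?(ltW e0)// ler_pdivrMr// mul1r lerDl.
rewrite ler_wpM2l//; apply: (dH (s *: w)) => //.
rewrite -ball_normE /= sub0r normrN normrZ ger0_norm//.
apply: (@le_lt_trans _ _ (d / 2)); last by rewrite ltr_pdivrMr// ltr_pMr// ltr1n.
by rewrite (le_trans _ wd)// ler_piMl.
Qed.

End Lipschitz.

(** * Uniqueness of solutions and the semiflow on K *)

Section Solutions.
Context {R : realType} {n : nat}.
Implicit Types (s t a b c : R) (x y : 'cV[R]_n) (u v : R -> 'cV[R]_n) (f : 'cV[R]_n -> 'cV[R]_n).

Definition is_sol f (u : R -> 'cV[R]_n) a b :=
  forall s, a <= s <= b -> is_derive s 1 u (f (u s)).

(** The square of the Euclidean distance of two curves is differentiable, unlike the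
supremum norm, and the dimension enters the constant through
|u.v| <= n |u| |v|. *)
Lemma gronwall_dotp (u v du dv : R -> 'cV[R]_n) (L a b : R) : a <= b ->
  (forall s, a <= s <= b -> is_derive s 1 u (du s)) ->
  (forall s, a <= s <= b -> is_derive s 1 v (dv s)) ->
  (forall s, a <= s <= b -> `|du s - dv s| <= L * `|u s - v s|) ->
  dotp (u b - v b) (u b - v b) <=
  expR (2 * n%:R * L * (b - a)) * dotp (u a - v a) (u a - v a).
Proof.
move=> ab hu hv hL.
have hd s : a <= s <= b -> is_derive s 1 (fun s => u s - v s) (du s - dv s).
  by move=> sab; have ? := hu _ sab; have ? := hv _ sab; exact: is_deriveB.
have hdot s : a <= s <= b -> is_derive s 1 (fun s => dotp (u s - v s) (u s - v s))
    (2 * dotp (du s - dv s) (u s - v s)).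
  move=> /hd h; apply: is_derive_eq (is_derive_dotp h h) _.
  by rewrite [X in _ + X]dotpC mulr2n mulrDl mul1r.
apply: (gronwall hdot) => // s sab.
have -> : 2 * n%:R * L * dotp (u s - v s) (u s - v s) =
          2 * (n%:R * (L * dotp (u s - v s) (u s - v s))) by rewrite !mulrA.
rewrite ler_pM2l//; apply: (le_trans (ler_norm _)); apply: (le_trans (ler_norm_dotp _ _)).
rewrite -mulrA ler_wpM2l//.
apply: (@le_trans _ _ (L * `|u s - v s| * `|u s - v s|)).
  by rewrite ler_wpM2r// hL.
have [L0|L0] := leP 0 L; first by rewrite -mulrA ler_wpM2l// -expr2 sqr_norm_le_dotp.
have := le_trans (normr_ge0 _) (hL _ sab).
rewrite nmulr_rge0// => uv; have -> : u s - v s = 0 by apply/eqP; rewrite -normr_le0.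
by rewrite dotp0l normr0 !mulr0.
Qed.

Lemma is_sol_sub f u a b a' b' : is_sol f u a b -> a <= a' -> b' <= b -> is_sol f u a' b'.
Proof.
move=> h aa bb s /andP[sa sb]; apply: h.
by rewrite (le_trans aa sa) (le_trans sb bb).
Qed.

Lemma is_sol_shift f u a b c :
  is_sol f u (a + c) (b + c) -> is_sol f (fun s => u (s + c)) a b.
Proof.
move=> h s /andP[sa sb].
by apply: is_derive_translate; apply: h; rewrite !lerD2r sa.
Qed.

Lemma is_sol_opp f u a b :
  is_sol f u a b -> is_sol (fun x => - f x) (fun s => u (- s)) (- b) (- a).
Proof.
move=> h s /andP[sa sb].
by apply: is_derive_reverse; apply: h; rewrite lerNr sb lerNl sa.
Qed.

Lemma is_sol_continuous f u a b : is_sol f u a b -> {in `[a, b]%classic, continuous u}.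
Proof.
by move=> h s; rewrite inE /= in_itv /= => /h; exact: is_derive_continuous.
Qed.

(** Both solutions are bounded on the compact interval, and f is Lipschitz on any
ball. *)
Lemma is_sol_unique f u v a b : C1map f -> a <= b ->
  is_sol f u a b -> is_sol f v a b -> u a = v a -> u b = v b.
Proof.
move=> fC1 ab su sv uv.
have [C1 _ uC1] := compact_norm_bounded (@segment_compact _ a b) (is_sol_continuous su).
have [C2 _ vC2] := compact_norm_bounded (@segment_compact _ a b) (is_sol_continuous sv).
have [L L0 fL] := C1_lipschitz_ball fC1 (Num.max C1 C2).
have := @gronwall_dotp u v _ _ L a b ab su sv.
rewrite uv subrr dotp0l mulr0 => H.
apply/eqP; rewrite -subr_eq0 -dotp_eq0 eq_le dotp_ge0 andbT; apply: H => s sab.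
by apply: fL; rewrite le_max ?uC1 ?vC2 ?orbT//= in_itv.
Qed.

Lemma is_sol_unique_back f u v a b : C1map f -> a <= b ->
  is_sol f u a b -> is_sol f v a b -> u b = v b -> u a = v a.
Proof.
move=> fC1 ab su sv uv.
have := is_sol_unique (C1mapN fC1) _ (is_sol_opp su) (is_sol_opp sv).
by rewrite !opprK lerN2; exact.
Qed.

(** By uniqueness the value selected by [flow] is that of any solution at hand. The
bounds min and max make the same statement serve both signs of t. *)
Lemma sol_flow f u t : C1map f -> is_sol f u (Num.min 0 t) (Num.max 0 t) ->
  flow_defined f t (u 0) /\ flow f t (u 0) = u t.
Proof.
move=> fC1 su.
have r : reaches f (u 0) t (u t) by exists u.
split; first by exists (u t).
have [v [v0 <- sv]] : reaches f (u 0) t (flow f t (u 0)) by exact: (@getPex _ [set y | reaches f (u 0) t y] (ex_intro _ (u t) r)).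
have [t0|t0] := leP 0 t.
  by rewrite min_l// max_r// in su sv; exact: (is_sol_unique fC1 t0 sv su).
rewrite min_r ?(ltW t0)// max_l ?(ltW t0)// in su sv.
exact: (is_sol_unique_back fC1 (ltW t0) sv su).
Qed.

Lemma sol_flow_ge0 f u t : C1map f -> 0 <= t -> is_sol f u 0 t ->
  flow_defined f t (u 0) /\ flow f t (u 0) = u t.
Proof. by move=> fC1 t0 su; apply: sol_flow => //; rewrite min_l// max_r. Qed.

End Solutions.

Section Semiflow.
Context {R : realType} {n : nat}.
Implicit Types (s t a b c : R) (x y v w : 'cV[R]_n).
Variables (f : 'cV[R]_n -> 'cV[R]_n) (K : set 'cV[R]_n).
Hypothesis fC1 : C1map f.

(** S agrees with the flow on K for nonnegative times; its values elsewhere are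
arbitrary, except that the derivative at time 0 is two-sided. *)
Definition is_semiflow (S : R -> 'cV[R]_n -> 'cV[R]_n) := forall x, K x ->
  [/\ S 0 x = x, forall t, 0 <= t -> is_derive t 1 (S^~ x) (f (S t x)),
      forall t, 0 <= t -> K (S t x) &
      forall t, 0 <= t -> flow_defined f t x /\ flow f t x = S t x].

(** The hypothesis of positive invariance gives one solution for each time horizon.
They agree where they overlap, and solutions are required to be differentiable
at 0 from both sides; so for t < 0 the semiflow is continued by the solution of
horizon 1, to keep the two-sided derivative at 0. *)
Lemma semiflow_exists : positively_invariant f K -> exists S, is_semiflow S.
Proof.
move=> Kinv.
suff /choice[S SP] : forall x, exists X : R -> 'cV[R]_n, K x ->
  [/\ X 0 = x, forall t, 0 <= t -> is_derive t 1 X (f (X t)),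
      forall t, 0 <= t -> K (X t) &
      forall t, 0 <= t -> flow_defined f t x /\ flow f t x = X t].
  by exists (fun t x => S x t) => x /SP.
move=> x; have [Kx|nKx] := pselect (K x); last by exists (fun=> x).
have /choice[u uP] : forall t, exists u : R -> 'cV[R]_n, 0 <= t ->
    u 0 = x /\ is_sol f u 0 t.
  move=> t; have [t0|] := leP 0 t; last by exists (fun=> x).
  have [[y [u [u0 _ su]]] _] := Kinv t x t0 Kx.
  by exists u => _; split=> //; move: su; rewrite min_l// max_r.
have uflow t s : 0 <= s -> s <= t -> u t s = flow f s x.
  move=> s0 st; have [u0 su] := uP _ (le_trans s0 st).
  have [_] := sol_flow_ge0 fC1 s0 (is_sol_sub su (lexx 0) st).
  by rewrite u0.
pose X t := if t < 0 then u 1 t else flow f t x.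
have XE t : 0 <= t -> X t = flow f t x by rewrite /X ltNge => ->.
exists X => _; split.
- by rewrite XE// -(uflow 0 0)//; have [] := uP 0 (lexx 0).
- move=> t t0.
  have t10 : 0 <= t + 1 by rewrite addr_ge0.
  have tt1 : t < t + 1 by rewrite ltrDl.
  apply: (@is_derive_near _ _ (u (t + 1))); last first.
    rewrite XE// -(uflow (t + 1))//; last exact: ltW.
    by have [_] := uP _ t10; apply; rewrite t0 ltW.
  have [->|tn0] := eqVneq t 0.
    near=> s; rewrite add0r /X; case: ltP => // s0; apply: uflow => //.
    by apply: ltW; near: s; apply: lt_nbhsl.
  near=> s; rewrite XE ?uflow//.
  + by apply: ltW; near: s; apply: lt_nbhsr; rewrite lt0r tn0.
  + by apply: ltW; near: s; apply: lt_nbhsl.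
  + by apply: ltW; near: s; apply: lt_nbhsr; rewrite lt0r tn0.
- by move=> t t0; rewrite XE//; have [_] := Kinv t x t0 Kx.
- by move=> t t0; rewrite XE//; have [] := Kinv t x t0 Kx.
Unshelve. all: by end_near. Qed.

Variable S : R -> 'cV[R]_n -> 'cV[R]_n.
Hypothesis SP : is_semiflow S.

Lemma semiflow0 x : K x -> S 0 x = x. Proof. by move=> /SP[]. Qed.
Lemma semiflowK x t : K x -> 0 <= t -> K (S t x). Proof. by move=> /SP[_ _ + _]; exact. Qed.
Lemma semiflow_derive x t : K x -> 0 <= t -> is_derive t 1 (S^~ x) (f (S t x)).
Proof. by move=> /SP[_ + _ _]; exact. Qed.

Lemma semiflow_sol x a b : K x -> 0 <= a -> is_sol f (S^~ x) a b.
Proof. by move=> Kx a0 s /andP[sa _]; apply: semiflow_derive => //; exact: le_trans sa. Qed.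

Lemma semiflowD x s t : K x -> 0 <= s -> 0 <= t -> S (s + t) x = S s (S t x).
Proof.
move=> Kx s0 t0; apply: (@is_sol_unique _ _ f (fun r => S (r + t) x) (S^~ (S t x)) 0) => //.
- by apply: (@is_sol_shift _ _ f (S^~ x)); apply: semiflow_sol; rewrite ?add0r.
- by apply: semiflow_sol => //; exact: semiflowK.
- by rewrite add0r semiflow0//; exact: semiflowK.
Qed.

Hypothesis cK : compact K.

Lemma compact_lipschitz : exists2 L, 0 < L &
  forall x y, K x -> K y -> `|f x - f y| <= L * `|x - y|.
Proof.
have [r r0 Kr] := compact_norm_bounded cK (fun x _ => @cvg_id _ (nbhs x)).
have [L L0 fL] := C1_lipschitz_ball fC1 r.
by exists L => // x y Kx Ky; apply: fL; exact: Kr.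
Qed.

(** Gronwall, with the Lipschitz constant of f on K: the solutions stay in K. *)
Lemma semiflow_dependence : exists2 L, 0 < L & forall x y t, K x -> K y -> 0 <= t ->
  `|S t x - S t y| <= n%:R * expR (L * t) * `|x - y|.
Proof.
have [L L0 fL] := compact_lipschitz.
exists (n%:R * L + 1); first by rewrite ltr_wpDl// mulr_ge0// ltW.
move=> x y t Kx Ky t0.
have := @gronwall_dotp _ _ (S^~ x) (S^~ y) _ _ L 0 t t0
  (semiflow_sol Kx (lexx 0)) (semiflow_sol Ky (lexx 0)).
rewrite !semiflow0// subr0 => H.
rewrite -(@ler_pXn2r _ 2) ?nnegrE ?mulr_ge0 ?expR_ge0//.
apply: (le_trans (sqr_norm_le_dotp _)).
apply: (@le_trans _ _ (expR (2 * n%:R * L * t) * dotp (x - y) (x - y))).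
  by apply: H => s /andP[s0 _]; apply: fL; exact: semiflowK.
have -> : (n%:R * expR ((n%:R * L + 1) * t) * `|x - y|) ^+ 2 =
    expR ((n%:R * L + 1) * t) ^+ 2 * (n%:R ^+ 2 * `|x - y| ^+ 2) by ring.
apply: ler_pM => //.
- exact: dotp_ge0.
- rewrite expr2 -expRD ler_expR.
  have -> : (n%:R * L + 1) * t + (n%:R * L + 1) * t = 2 * n%:R * L * t + 2 * t by ring.
  by rewrite lerDl mulr_ge0.
- apply: (le_trans (dotp_le_sqr_norm _)); rewrite ler_wpM2r ?sqr_ge0//.
  by case: (n) => [|k]; rewrite ?expr2 ?mul0r// ler_peMr// ler1n.
Qed.

Lemma semiflow_lipschitz_time : exists2 B, 0 < B & forall x s t, K x -> 0 <= s -> s <= t ->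
  `|S t x - S s x| <= B * (t - s).
Proof.
have [B B0 fB] := compact_norm_bounded cK (fun x _ => @C1map_continuous _ _ _ fC1 x).
exists (B + 1); first by rewrite ltr_wpDl.
move=> x s t Kx s0 st; apply: ler_norm_cV => [|i].
  by rewrite mulr_ge0 ?subr_ge0// addr_ge0.
rewrite !mxE mulrBr.
apply: (@ler_norm_is_derive _ (fun r => S r x i 0) (fun r => (B + 1) * r)
  (fun r => f (S r x) i 0) (fun=> B + 1)) => // r /andP[sr rt].
- by have /is_derive_mxP/(_ i 0) := semiflow_derive Kx (le_trans s0 sr).
- exact: is_derive_mulc.
- rewrite (le_trans (ler_norm_entry _ _ _))// (@le_trans _ _ B) ?lerDl// fB//.
  by apply: semiflowK => //; exact: le_trans sr.
Qed.

End Semiflow.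

(** * The metric and its contraction rate *)

Section Metric.
Context {R : realType} {n : nat}.
Implicit Types (s t a b c : R) (x y v w : 'cV[R]_n).
Variables (f : 'cV[R]_n -> 'cV[R]_n) (K : set 'cV[R]_n) (M : 'cV[R]_n -> 'M[R]_n).

Lemma quadf_le (A : 'M[R]_n) v : `|quadf A v| <= n%:R ^+ 2 * `|A| * `|v| ^+ 2.
Proof.
rewrite quadfE (le_trans (ler_norm_dotp _ _))//.
apply: (@le_trans _ _ (n%:R * `|v| * (n%:R * `|A| * `|v|))).
  by rewrite ler_wpM2l ?mulr_ge0// ler_norm_mulmx.
by apply: ler_of_eq; ring.
Qed.

Lemma cvg_entry (T : Type) (F : set_system T) {FF : Filter F} m k
   (A : T -> 'M[R]_(m, k)) (a : 'M[R]_(m, k)) i j :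
  A x @[x --> F] --> a -> A x i j @[x --> F] --> a i j.
Proof. by move=> hA; exact: (cvg_comp _ _ hA (@coord_continuous R m k i j a)). Qed.

Lemma mulmx_cvg (T : Type) (F : set_system T) {FF : Filter F} m k p
   (A : T -> 'M[R]_(m, k)) (B : T -> 'M[R]_(k, p)) (a : 'M[R]_(m, k)) (b : 'M[R]_(k, p)) :
  A x @[x --> F] --> a -> B x @[x --> F] --> b -> A x *m B x @[x --> F] --> a *m b.
Proof.
move=> hA hB; apply: cvg_mx => i j.
rewrite mxE (_ : (fun z => _) = fun z : T => \sum_l A z i l * B z l j); last first.
  by apply/funext => z; rewrite mxE.
apply: cvg_big => [|l _]; first exact: add_continuous.
by apply: cvgM; exact: cvg_entry.
Qed.

Lemma dotp_cvg (T : Type) (F : set_system T) {FF : Filter F}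
   (u v : T -> 'cV[R]_n) (a b : 'cV[R]_n) :
  u x @[x --> F] --> a -> v x @[x --> F] --> b -> dotp (u x) (v x) @[x --> F] --> dotp a b.
Proof.
move=> hu hv; rewrite dotpE.
rewrite (_ : (fun z => _) = fun z : T => \sum_i u z i 0 * v z i 0); last first.
  by apply/funext => z; rewrite dotpE.
apply: cvg_big => [|i _]; first exact: add_continuous.
by apply: cvgM; exact: cvg_entry.
Qed.

Hypothesis cK : compact K.
Hypothesis M_cont : {in K, continuous M}.
Hypothesis M_pos : forall x, K x -> posdefmx (M x).

Lemma compact_sphere : compact [set v : 'cV[R]_n | `|v| = 1].
Proof.
apply: (@subclosed_compact _ _ [set v : 'cV[R]_n | `|v| <= 1]).
- rewrite (_ : mkset _ = (fun v : 'cV[R]_n => `|v|) @^-1` [set 1]); last by [].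
  by apply: closed_comp => [v _|]; [exact: norm_continuous|exact: closed_eq].
- exact: compact_ball.
- by move=> v /= ->.
Qed.

(** The minimum of v^T M(x) v over the compact product of K and the unit sphere. *)
Lemma metric_lower_bound : exists2 m, 0 < m & forall x v, K x ->
  m * `|v| ^+ 2 <= quadf (M x) v.
Proof.
pose A := K `*` [set v : 'cV[R]_n | `|v| = 1].
have cA : compact A by apply: compact_setX => //; exact: compact_sphere.
have scal x v : K x -> v != 0 -> A (x, `|v|^-1 *: v) /\
    quadf (M x) v = `|v| ^+ 2 * quadf (M x) (`|v|^-1 *: v).
  move=> Kx v0; split.
    by split=> //=; rewrite normrZ normfV normr_id mulVf// normr_eq0.
  by rewrite quadfZ mulrA -exprMn divff ?normr_eq0// expr1n mul1r.
have [/eqP A0|/set0P A0] := boolP (A == set0).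
  exists 1 => // x v Kx; have [->|v0] := eqVneq v 0.
    by rewrite (quadfE (M x)) dotp0l normr0 expr0n mulr0.
  by have [Axv _] := scal x v Kx v0; rewrite A0 in Axv.
have gc : {within A, continuous (fun p : 'cV[R]_n * 'cV[R]_n => quadf (M p.1) p.2)}.
  apply: continuous_in_subspaceT => -[x v]; rewrite inE => -[/= Kx _].
  rewrite (_ : (fun p => _) = fun p : 'cV[R]_n * 'cV[R]_n => dotp p.2 (M p.1 *m p.2)); last first.
    by apply/funext => p; rewrite quadfE.
  apply: (@dotp_cvg _ (nbhs (x, v))); first exact: cvg_snd.
  apply: (@mulmx_cvg _ (nbhs (x, v))); last exact: cvg_snd.
  apply: (@continuous_cvg _ _ _ (nbhs (x, v)) _ (fun p => p.1) M); last exact: cvg_fst.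
  by apply: M_cont; rewrite inE.
have [[x0 v0]] := compact_EVT_min A0 cA gc.
rewrite inE => -[/= Kx0 v01] minP.
have v00 : v0 != 0 by rewrite -normr_eq0 v01 oner_neq0.
exists (quadf (M x0) v0); first exact: M_pos.
move=> x v Kx; have [->|vn0] := eqVneq v 0.
  by rewrite (quadfE (M x)) dotp0l normr0 expr0n mulr0.
have [Axv ->] := scal x v Kx vn0.
by rewrite mulrC ler_wpM2l ?sqr_ge0//; apply: (minP (x, _)); rewrite inE.
Qed.

Lemma metric_upper_bound : exists2 C, 0 < C & forall x, K x -> `|M x| <= C.
Proof.
have [C C0 MC] := compact_norm_bounded cK M_cont.
exists (C + 1); first by rewrite ltr_wpDl.
by move=> x /MC /le_trans; apply; rewrite lerDl.
Qed.

(** The component of [Jac f x *m v] left after projecting along [f x] in such a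
way that orthogonality to [f] is preserved along solutions of the variational
equation. *)
Definition transversal_drift x v :=
  Jac f x *m v - ((dotp (f x) (f x))^-1 *
    (dotp (f x) (Jac f x *m v) + dotp v (Jac f x *m f x))) *: f x.

(** The quantity L_M(x;v) is half the growth rate of v^T M v when v follows the
transversal drift: the two rank one terms of its definition are transposes of
each other and contribute equally. *)
Lemma LMvE x v : (M x)^T = M x -> dotp v (f x) = 0 ->
  2 * LMv f M x v = quadf (orbital_deriv f M x) v +
     2 * dotp v (M x *m transversal_drift x v).
Proof.
move=> symM vf; rewrite /LMv mulrA divff ?pnatr_eq0// mul1r.
have qD (A B : 'M[R]_n) : quadf (A + B) v = quadf A v + quadf B v.
  by rewrite !quadfE mulmxDl dotpDr.
have qN (A : 'M[R]_n) : quadf (- A) v = - quadf A v.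
  by rewrite !quadfE mulNmx dotpNr.
have qZ (k : R) (A : 'M[R]_n) : quadf (k *: A) v = k * quadf A v.
  by rewrite !quadfE -scalemxAl dotpZr.
rewrite !qD !qN !qZ.
set D := Jac f x; set g := f x.
have q1 : quadf (D^T *m M x) v = dotp v (M x *m (D *m v)).
  by rewrite quadfE -mulmxA (dotp_mulmxT D^T) trmxK (dotp_mulmxT (M x)) symM dotpC.
have q2 : quadf (M x *m D) v = dotp v (M x *m (D *m v)).
  by rewrite quadfE -mulmxA.
have gg (u1 u2 : 'cV[R]_n) (u : 'cV[R]_n) : u1 *m (u2^T *m u) = dotp u2 u *: u1.
  by rewrite [u2^T *m u]mx11_scalar mul_mx_scalar.
have sg : dotp g ((D + D^T) *m v) = dotp g (D *m v) + dotp v (D *m g).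
  by rewrite mulmxDl dotpDr; congr (_ + _); rewrite dotp_mulmxT trmxK dotpC.
have q3 : quadf (M x *m g *m g^T *m (D + D^T)) v =
    (dotp g (D *m v) + dotp v (D *m g)) * dotp v (M x *m g).
  by rewrite quadfE -!mulmxA gg -scalemxAr dotpZr sg.
have q4 : quadf ((D + D^T) *m g *m g^T *m M x) v =
    (dotp g (D *m v) + dotp v (D *m g)) * dotp v (M x *m g).
  rewrite quadfE -!mulmxA gg -scalemxAr dotpZr mulrC; congr (_ * _).
    have sT : (D + D^T)^T = D + D^T by apply/matrixP => i j; rewrite !mxE addrC.
    by rewrite (dotp_mulmxT (D + D^T)) sT dotpC sg.
  by rewrite dotp_mulmxT symM dotpC.
rewrite q1 q2 q3 q4 sqr_enorm /transversal_drift -/D -/g mulmxBr dotpBr.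
rewrite -scalemxAr dotpZr; ring.
Qed.

Variable nu : R.
Hypothesis LM_le : forall x, K x -> (LM f M x <= (- nu)%:E)%E.
Hypothesis M_sym : forall x, K x -> (M x)^T = M x.

(** The supremum defining [LM] is over normalized vectors; both sides are quadratic in
v, so scaling extends the bound to all v perpendicular to f(x). *)
Lemma LMv_le x v : K x -> dotp v (f x) = 0 -> LMv f M x v <= - nu * quadf (M x) v.
Proof.
move=> Kx vf; have [->|v0] := eqVneq v 0.
  by rewrite /LMv !quadfE !dotp0l !mulr0.
have q0 := M_pos Kx v0.
set q := quadf (M x) v in q0 *.
pose k := (Num.sqrt q)^-1.
have k2 : k ^+ 2 = q^-1 by rewrite /k exprVn sqr_sqrtr// ltW.
have h : LMv f M x (k *: v) <= - nu.
  rewrite -lee_fin; apply: le_trans (LM_le Kx); apply: ereal_sup_ubound.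
  exists (k *: v) => //; split; last by rewrite dotpZl vf mulr0.
  by rewrite quadfZ k2 mulVf// gt_eqF.
have E : LMv f M x (k *: v) = q^-1 * LMv f M x v.
  by rewrite /LMv quadfZ k2; ring.
by rewrite E mulrC ler_pdivrMr// in h.
Qed.

Lemma transversal_contraction x v : K x -> dotp v (f x) = 0 ->
  quadf (orbital_deriv f M x) v + 2 * dotp v (M x *m transversal_drift x v) <=
  - (2 * nu) * quadf (M x) v.
Proof.
move=> Kx vf; rewrite -LMvE ?M_sym//.
have := LMv_le Kx vf; lra.
Qed.

End Metric.

(** * The equation of a reparametrized neighbouring solution *)

Section TubeField.
Context {R : realType} {n : nat}.
Implicit Types (s t : R) (x y v w : 'cV[R]_n).
Variables (f : 'cV[R]_n -> 'cV[R]_n) (K : set 'cV[R]_n).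

(** The speed th' of the time change: the value for which
(th' f(x + w) - f(x)).f(x) + w.(Df(x) f(x)) = 0. *)
Definition reparam x w : R :=
  (dotp (f x) (f x) - dotp w (Jac f x *m f x)) / dotp (f (x + w)) (f x).

(** The derivative of w = z - x when x' = f(x) and z' = th' f(z). *)
Definition tube_field x w : 'cV[R]_n := reparam x w *: f (x + w) - f x.

(** The left side is the derivative of w.f along x' = f(x), w' = tube_field x w: the
choice of [reparam] keeps w perpendicular to f(x). *)
Lemma tube_field_perp x w : dotp (f (x + w)) (f x) != 0 ->
  dotp (tube_field x w) (f x) + dotp w (Jac f x *m f x) = 0.
Proof.
move=> B0; rewrite /tube_field dotpBl dotpZl /reparam divfK//; ring.
Qed.

Hypothesis fC1 : C1map f.
Hypothesis cK : compact K.
Hypothesis f_neq0 : forall x, K x -> f x != 0.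

Lemma field_bounds : exists F J k : R, [/\ 0 < F, 0 < J, 0 < k &
  forall x, K x -> [/\ `|f x| <= F, `|Jac f x| <= J & k <= dotp (f x) (f x)]].
Proof.
have [F F0 fF] := compact_norm_bounded cK (fun x _ => @C1map_continuous _ _ _ fC1 x).
have [J J0 fJ] := compact_norm_bounded cK (fun x _ => @Jac_continuous _ _ _ fC1 x).
have cinv : {in K, continuous (fun x => (dotp (f x) (f x))^-1)}.
  move=> x; rewrite inE => Kx.
  have h : dotp (f x) (f x) != 0 by rewrite dotp_eq0 f_neq0.
  have h1 : dotp (f y) (f y) @[y --> x] --> dotp (f x) (f x).
    by apply: (@dotp_cvg _ _ _ (nbhs x)); exact: (@C1map_continuous _ _ _ fC1 x).
  exact: (cvgV h h1).
have [C C0 fC] := compact_norm_bounded cK cinv.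
exists (F + 1), (J + 1), (C + 1)^-1; rewrite invr_gt0 !ltr_wpDl//; split=> // x Kx.
split; first by rewrite (le_trans (fF _ Kx))// lerDl.
  by rewrite (le_trans (fJ _ Kx))// lerDl.
have g0 := dotp_gt0 (f_neq0 Kx).
rewrite -[leRHS]invrK lef_pV2 ?posrE ?invr_gt0 ?ltr_wpDl//.
by have := fC _ Kx; rewrite ger0_norm ?invr_ge0 ?(ltW g0)// => /le_trans; apply; rewrite lerDl.
Qed.

(** Write f(x + w) = f(x) + Df(x) w + r with |r| <= e |w| uniformly on K. The numerator
and the denominator of [reparam] differ by terms of order |w|, so its deviation
from 1 is O(|w|) with a constant independent of eta; the terms of first order of
[tube_field] are those of [transversal_drift]. *)
Lemma tube_estimates : exists C k : R, [/\ 0 < C, 0 < k & forall eta, 0 < eta ->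
  exists2 d, 0 < d & forall x w, K x -> `|w| <= d ->
  [/\ k <= dotp (f (x + w)) (f x), `|reparam x w - 1| <= C * `|w| &
      `|tube_field x w - transversal_drift f x w| <= eta * `|w| ]].
Proof.
have [F [J [k [F0 J0 k0 fb]]]] := field_bounds.
pose N : R := n%:R.
have N0 : 0 <= N by [].
pose G := N * F * (N * J).
have G0 : 0 <= G by rewrite !mulr_ge0// ltW.
have NF0 : 0 <= N * F by rewrite mulr_ge0// ltW.
pose b := 2 / k.
have b0 : 0 < b by rewrite divr_gt0.
pose C := b * (2 * G + N * F) + 1.
have b0' := ltW b0; have F0' := ltW F0; have J0' := ltW J0.
have C0 : 0 < C by rewrite ltr_wpDl// mulr_ge0// addr_ge0// mulr_ge0.
exists C, (k / 2); split; rewrite ?divr_gt0// => eta eta0.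
pose C2 := 1 + b * (N * F) * F.
have C20 : 0 < C2 by rewrite ltr_wpDr// mulr_ge0// mulr_ge0.
pose C3 := C * (N * J + 1) + b * (b * (2 * G) * (G + N * F)) * F + 1.
have C30 : 0 < C3.
  apply: ltr_wpDl => //; apply: addr_ge0.
    by rewrite mulr_ge0 ?(ltW C0)// addr_ge0// mulr_ge0.
  by rewrite mulr_ge0// mulr_ge0// mulr_ge0 ?addr_ge0// mulr_ge0// mulr_ge0.
(* C2 collects the terms proportional to e, C3 those proportional to |w|; each
   gets half of eta. *)
pose e := Num.min 1 (eta / (2 * C2)).
have e0 : 0 < e by rewrite lt_min ltr01 divr_gt0// mulr_gt0.
have [d1 d10 taylor] := uniform_taylor fC1 cK e0.
pose d := Num.min d1 (Num.min (eta / (2 * C3)) (k / (2 * (G + N * F + 1)))).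
have GNF : 0 < G + N * F + 1 by rewrite ltr_wpDl// addr_ge0.
exists d; first by rewrite !lt_min d10 !divr_gt0// mulr_gt0.
move=> x w Kx; rewrite !le_min => /andP[wd1 /andP[wd2 wd3]].
have [fF fJ fk] := fb x Kx.
set g := f x in fF fk *; set D := Jac f x in fJ *.
set r := f (x + w) - g - D *m w.
have rw : `|r| <= e * `|w| by exact: taylor.
have fE : f (x + w) = g + D *m w + r.
  by rewrite /r -[f (x + w) - g - _]addrA -opprD [RHS]addrC subrK.
have W0 : 0 <= `|w| by [].
set W := `|w| in W0 wd1 wd2 wd3 rw *.
have e1 : e <= 1 by rewrite ge_min lexx.
have DW : `|D *m w| <= N * J * W.
  apply: (le_trans (ler_norm_mulmx _ _)); rewrite ler_wpM2r// ler_wpM2l//.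
have gDw : `|dotp g (D *m w)| <= G * W.
  apply: (le_trans (ler_norm_dotp _ _)).
  have -> : G * W = N * F * (N * J * W) by rewrite /G; ring.
  by apply: ler_pM => //; rewrite ?mulr_ge0// ler_wpM2l.
have wDg : `|dotp w (D *m g)| <= G * W.
  apply: (le_trans (ler_norm_dotp _ _)).
  apply: (@le_trans _ _ (N * W * (N * J * F))).
    rewrite ler_wpM2l ?mulr_ge0//; apply: (le_trans (ler_norm_mulmx _ _)).
    by apply: ler_pM => //; rewrite ?mulr_ge0// ler_wpM2l.
  by rewrite /G; apply: ler_of_eq; ring.
have rho : `|dotp r g| <= N * F * e * W.
  apply: (le_trans (ler_norm_dotp _ _)).
  have -> : N * F * e * W = N * (e * W) * F by ring.
  by apply: ler_pM => //; rewrite ?mulr_ge0// ler_wpM2l.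
set a := dotp g (D *m w) in gDw *; set a' := dotp w (D *m g) in wDg *.
set p := dotp r g in rho *; set kk := dotp g g in fk *.
have BE : dotp (f (x + w)) g = kk + a + p.
  by rewrite fE 2!dotpDl (dotpC (D *m w)).
have rhoW : `|p| <= N * F * W.
  by apply: (le_trans rho); rewrite ler_wpM2r// ler_piMr.
set B := dotp (f (x + w)) g in BE *.
have Bk : k / 2 <= B.
  have h1 : (G + N * F) * W <= k / 2.
    apply: (@le_trans _ _ ((G + N * F + 1) * W)); first by rewrite ler_wpM2r// lerDl.
    rewrite mulrC -ler_pdivlMr//; apply: (le_trans wd3).
    by rewrite invfM mulrA.
  move: gDw rhoW; rewrite !ler_norml => /andP[h2 _] /andP[h3 _]; rewrite BE.
  lra.
have B0 : 0 < B by apply: lt_le_trans Bk; rewrite divr_gt0.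
have Bb : B^-1 <= b.
  by rewrite /b -[leRHS]invrK invf_div lef_pV2 ?posrE// divr_gt0.
have kk0 : 0 < kk by exact: lt_le_trans fk.
have kb : kk^-1 <= b.
  apply: (@le_trans _ _ k^-1); first by rewrite lef_pV2.
  by rewrite /b ler_peMl ?invr_ge0 ?(ltW k0)// ler1n.
have aa' : `|a + a'| <= 2 * G * W by rewrite (le_trans (ler_normD _ _))//; lra.
have th1 : reparam x w - 1 = - (a + a' + p) / B.
  rewrite /reparam -/g -/kk -/D -/a' -/B; apply/eqP; rewrite subr_eq; apply/eqP.
  have Bn0 : B != 0 by rewrite gt_eqF.
  by rewrite -[X in _ = _ + X](divff Bn0) -mulrDl; congr (_ / _); rewrite BE; ring.
have thC : `|reparam x w - 1| <= C * W.
  rewrite th1 normrM normrN normfV (gtr0_norm B0).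
  apply: (@le_trans _ _ (b * (2 * G + N * F) * W)).
    rewrite mulrC -mulrA; apply: ler_pM => //; first by rewrite invr_ge0 ltW.
    by rewrite mulrDl (le_trans (ler_normD _ _))// lerD.
  by rewrite ler_wpM2r// lerDl.
split=> //.
set th := reparam x w in th1 thC *.
pose q := th - 1 + kk^-1 * (a + a').
have qE : q = (kk^-1 * (a + a') * (a + p) - p) / B.
  rewrite /q th1; have Bn0 : B != 0 by rewrite gt_eqF.
  have kn0 : kk != 0 by rewrite gt_eqF.
  by rewrite BE in Bn0 *; field; rewrite kn0 Bn0.
have qb : `|q| <= b * (b * (2 * G) * (G + N * F) * W + N * F * e) * W.
  rewrite qE normrM normfV (gtr0_norm B0) mulrC -[leRHS]mulrA.
  apply: ler_pM => //; first by rewrite invr_ge0 ltW.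
  apply: (le_trans (ler_normB _ _)); rewrite mulrDl; apply: lerD => //.
  have -> : b * (2 * G) * (G + N * F) * W * W = b * (2 * G * W) * ((G + N * F) * W) by ring.
  rewrite normrM; apply: ler_pM => //.
    rewrite normrM; apply: ler_pM => //.
    by rewrite normfV (gtr0_norm kk0).
  by rewrite (le_trans (ler_normD _ _))// mulrDl lerD.
have dE : tube_field x w - transversal_drift f x w = r + (th - 1) *: (D *m w + r) + q *: g.
  rewrite /tube_field /transversal_drift -/g -/D -/a -/a' -/kk -/th fE /q.
  apply/matrixP => i j; rewrite !mxE; ring.
rewrite dE.
apply: (@le_trans _ _ (e * W + C * W * ((N * J + 1) * W) +
    b * (b * (2 * G) * (G + N * F) * W + N * F * e) * W * F)).
  apply: (le_trans (ler_normD _ _)); apply: lerD; last first.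
    by rewrite normrZ; apply: ler_pM.
  apply: (le_trans (ler_normD _ _)); apply: lerD => //.
  rewrite normrZ; apply: ler_pM => //.
  rewrite (le_trans (ler_normD _ _))// mulrDl lerD// (le_trans rw)// ler_wpM2r//.
have -> : e * W + C * W * ((N * J + 1) * W) +
    b * (b * (2 * G) * (G + N * F) * W + N * F * e) * W * F =
    (e * C2 + W * (C3 - 1)) * W by rewrite /C2 /C3; ring.
rewrite ler_wpM2r// [leRHS]splitr; apply: lerD.
  rewrite -ler_pdivlMr//; apply: (@le_trans _ _ (eta / (2 * C2))).
    by rewrite ge_min lexx orbT.
  by rewrite invfM mulrA.
apply: (@le_trans _ _ (W * C3)); first by rewrite ler_wpM2l// gerBl.
rewrite -ler_pdivlMr//; apply: (le_trans wd2).
by rewrite invfM mulrA.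
Qed.

End TubeField.

Section UniformLipschitz.
Context {R : realType} {n : nat}.
Implicit Types (x y v w : 'cV[R]_n).
Variables (K : set 'cV[R]_n) (d : R).

(** Bounded and Lipschitz in w on the cube |w| <= d, uniformly for x in K. *)
Definition lip_in (phi : 'cV[R]_n -> 'cV[R]_n -> R) := exists2 C : R, 0 <= C &
  forall x w, K x -> `|w| <= d -> `|phi x w| <= C /\
  forall w', `|w'| <= d -> `|phi x w - phi x w'| <= C * `|w - w'|.

Lemma lip_in_bounded (c : 'cV[R]_n -> R) C :
  (forall x, K x -> `|c x| <= C) -> lip_in (fun x _ => c x).
Proof.
move=> cC; exists (Num.max 0 C) => [|x w Kx _]; first by rewrite le_max lexx.
split=> [|w' _]; first by rewrite le_max cC ?orbT.
by rewrite subrr normr0 mulr_ge0// le_max lexx.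
Qed.

Lemma lip_in_entry i : lip_in (fun _ w => w i 0).
Proof.
exists (Num.max d 1) => [|x w _ wd]; first by rewrite le_max ler01 orbT.
split=> [|w' _]; first by rewrite le_max (le_trans (ler_norm_entry _ _ _) wd).
apply: (@le_trans _ _ `|w - w'|).
  by apply: le_trans (ler_norm_entry _ i 0); rewrite !mxE.
by rewrite ler_peMl// le_max lexx orbT.
Qed.

Lemma lip_inD p q : lip_in p -> lip_in q -> lip_in (fun x w => p x w + q x w).
Proof.
move=> [C C0 pC] [D D0 qD]; exists (C + D) => [|x w Kx wd]; first exact: addr_ge0.
have [pC1 pC2] := pC x w Kx wd; have [qD1 qD2] := qD x w Kx wd.
split=> [|w' wd']; first by rewrite (le_trans (ler_normD _ _))// lerD.
by rewrite opprD addrACA mulrDl (le_trans (ler_normD _ _))// lerD ?pC2 ?qD2.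
Qed.

Lemma lip_inN p : lip_in p -> lip_in (fun x w => - p x w).
Proof.
move=> [C C0 pC]; exists C => // x w Kx wd.
have [pC1 pC2] := pC x w Kx wd.
by rewrite normrN; split=> // w' wd'; rewrite -opprD normrN pC2.
Qed.

Lemma lip_inM p q : lip_in p -> lip_in q -> lip_in (fun x w => p x w * q x w).
Proof.
move=> [C C0 pC] [D D0 qD]; exists (2 * C * D + C * D) => [|x w Kx wd].
  by rewrite addr_ge0// !mulr_ge0.
have [pC1 pC2] := pC x w Kx wd; have [qD1 qD2] := qD x w Kx wd.
split=> [|w' wd'].
  rewrite normrM (@le_trans _ _ (C * D)) ?ler_pM// lerDr.
  by rewrite !mulr_ge0.
have [pC1' _] := pC x w' Kx wd'.
have -> : p x w * q x w - p x w' * q x w' =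
  (p x w - p x w') * q x w + p x w' * (q x w - q x w') by ring.
apply: (le_trans (ler_normD _ _)); rewrite !normrM.
apply: (@le_trans _ _ (C * `|w - w'| * D + C * (D * `|w - w'|))).
  by apply: lerD; apply: ler_pM => //; rewrite ?pC2 ?qD2.
have -> : C * `|w - w'| * D + C * (D * `|w - w'|) = 2 * C * D * `|w - w'| by ring.
by rewrite ler_wpM2r// lerDl mulr_ge0.
Qed.

Lemma lip_inV p k : 0 < k -> (forall x w, K x -> `|w| <= d -> k <= p x w) ->
  lip_in p -> lip_in (fun x w => (p x w)^-1).
Proof.
move=> k0 pk [C C0 pC]; exists (Num.max k^-1 (C / (k * k))).
  by rewrite le_max invr_ge0 ltW.
move=> x w Kx wd; have [pC1 pC2] := pC x w Kx wd.
have pos w' : `|w'| <= d -> 0 < p x w' by move=> wd'; exact: lt_le_trans k0 (pk _ _ Kx wd').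
split=> [|w' wd'].
  rewrite normfV gtr0_norm ?pos// le_max; apply/orP; left.
  by rewrite lef_pV2 ?posrE ?pos// pk.
have p0 := pos _ wd; have p'0 := pos _ wd'.
have -> : (p x w)^-1 - (p x w')^-1 = (p x w' - p x w) / (p x w * p x w').
  by field; rewrite !gt_eqF.
rewrite normrM normfV distrC (@gtr0_norm _ (_ * _)) ?mulr_gt0//.
apply: (@le_trans _ _ (C / (k * k) * `|w - w'|)).
  rewrite mulrAC; apply: ler_pM; rewrite ?invr_ge0 ?mulr_ge0 ?(ltW p0) ?(ltW p'0)//.
    exact: pC2.
  rewrite lef_pV2 ?posrE ?mulr_gt0// ler_pM ?(ltW k0)//; exact: pk.
by rewrite ler_wpM2r// le_max lexx orbT.
Qed.

(** Together with the preceding closure properties this reduces the Lipschitz bound on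
the tube field to that on its ingredients. *)
Lemma lip_in_sum (I : finType) (p : I -> 'cV[R]_n -> 'cV[R]_n -> R) :
  (forall i, lip_in (p i)) -> lip_in (fun x w => \sum_i p i x w).
Proof.
move=> pl; elim: (index_enum I) => [|i r ih].
  by exists 0 => // x w _ _; split=> [|w' _]; rewrite !big_nil ?subrr normr0 ?mul0r.
have [C C0 H] := lip_inD (pl i) ih.
by exists C => // x w Kx wd; have [h1 h2] := H x w Kx wd; split=> [|w' wd'];
  rewrite !big_cons//; exact: h2.
Qed.

Lemma lip_in_vector (p : 'cV[R]_n -> 'cV[R]_n -> 'cV[R]_n) :
  (forall i, lip_in (fun x w => p x w i 0)) ->
  exists2 C : R, 0 < C & forall x w, K x -> `|w| <= d -> `|p x w| <= C /\
    forall w', `|w'| <= d -> `|p x w - p x w'| <= C * `|w - w'|.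
Proof.
move=> pl.
have /choice[C CP] : forall i, exists C : R, 0 <= C /\
  forall x w, K x -> `|w| <= d -> `|p x w i 0| <= C /\
  forall w', `|w'| <= d -> `|p x w i 0 - p x w' i 0| <= C * `|w - w'|.
  by move=> i; have [C C0 H] := pl i; exists C.
have C0 : 0 <= \sum_i C i by apply: sumr_ge0 => i _; case: (CP i).
have Ci i : C i <= \sum_i C i + 1.
  rewrite (bigD1 i)//= -addrA lerDl addr_ge0//.
  by apply: sumr_ge0 => j _; case: (CP j).
exists (\sum_i C i + 1) => [|x w Kx wd]; first by rewrite ltr_wpDl.
split=> [|w' wd']; apply: ler_norm_cV; rewrite ?mulr_ge0 ?addr_ge0//.
- by move=> i; apply: le_trans (Ci i); have [_ /(_ x w Kx wd)[]] := CP i.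
- move=> i; have [_ /(_ x w Kx wd)[_ /(_ _ wd') h]] := CP i.
  by rewrite !mxE (le_trans h)// ler_wpM2r.
Qed.

Definition clamp w : 'cV[R]_n := \col_i Num.max (- d) (Num.min d (w i 0)).

Hypothesis d0 : 0 <= d.

Lemma clamp_le w : `|clamp w| <= d.
Proof.
apply: ler_norm_cV => // i; rewrite mxE ler_norml le_max lexx /=.
by rewrite ge_max ge_min lexx/= andbT (le_trans _ d0)// oppr_le0.
Qed.

Lemma clamp_id w : `|w| <= d -> clamp w = w.
Proof.
move=> wd; apply/matrixP => i j; rewrite ord1 mxE.
have := le_trans (ler_norm_entry w i 0) wd; rewrite ler_norml => /andP[h1 h2].
by rewrite min_r// max_r.
Qed.

Lemma clamp_lipschitz w w' : `|clamp w - clamp w'| <= `|w - w'|.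
Proof.
apply: ler_norm_cV => // i; rewrite !mxE.
have hmax (c a b : R) : `|Num.max c a - Num.max c b| <= `|a - b|.
  have h1 := ler_norm (a - b); have h2 := ler_norm (b - a); rewrite distrC in h2.
  by case: (leP c a) => ?; case: (leP c b) => ?; rewrite // ler_norml; lra.
have hmin (c a b : R) : `|Num.min c a - Num.min c b| <= `|a - b|.
  have h1 := ler_norm (a - b); have h2 := ler_norm (b - a); rewrite distrC in h2.
  by case: (leP c a) => ?; case: (leP c b) => ?; rewrite // ler_norml; lra.
apply: (le_trans (hmax _ _ _)); apply: (le_trans (hmin _ _ _)).
by apply: le_trans (ler_norm_entry _ i 0); rewrite !mxE.
Qed.

End UniformLipschitz.

Section TubeSolution.
Context {R : realType} {n : nat}.
Implicit Types (s t : R) (x y v w : 'cV[R]_n).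
Variables (f : 'cV[R]_n -> 'cV[R]_n) (K : set 'cV[R]_n).
Hypothesis fC1 : C1map f.
Hypothesis cK : compact K.
Hypothesis f_neq0 : forall x, K x -> f x != 0.
Variables (d k : R).
Hypothesis d0 : 0 < d.
Hypothesis k0 : 0 < k.
Hypothesis den : forall x w, K x -> `|w| <= d -> k <= dotp (f (x + w)) (f x).

(** On the cube |w| <= d the denominator of the reparametrization is bounded below, so
the tube field is obtained from bounded Lipschitz functions by sums, products and
one admissible inverse. *)
Lemma tube_field_lipschitz : exists2 C : R, 0 < C & forall x w, K x -> `|w| <= d ->
  `|tube_field f x w| <= C /\
  forall w', `|w'| <= d -> `|tube_field f x w - tube_field f x w'| <= C * `|w - w'|.
Proof.
have [F [J [kk [F0 J0 kk0 fb]]]] := field_bounds fC1 cK f_neq0.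
have [r r0 Kr] := compact_norm_bounded cK (fun x _ => @cvg_id _ (nbhs x)).
have [L L0 fL] := C1_lipschitz_ball fC1 (r + d).
have F0' := ltW F0; have L0' := ltW L0; have d0' := ltW d0; have J0' := ltW J0.
have fentry i : lip_in K d (fun x w => f (x + w) i 0).
  exists (F + L * d + L) => [|x w Kx wd]; first by rewrite !addr_ge0// mulr_ge0.
  have xw w' : `|w'| <= d -> `|x + w'| <= r + d.
    by move=> wd'; rewrite (le_trans (ler_normD _ _))// lerD// Kr.
  split=> [|w' wd'].
    apply: (le_trans (ler_norm_entry _ _ _)).
    have -> : f (x + w) = f x + (f (x + w) - f x) by rewrite [RHS]addrC subrK.
    apply: (le_trans (ler_normD _ _)); rewrite -addrA; apply: lerD.
      by have [] := fb x Kx.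
    apply: (@le_trans _ _ (L * d)); last by rewrite lerDl.
    apply: (le_trans (fL _ _ (xw _ wd) _)).
      by have := xw 0; rewrite normr0 addr0; apply; exact: ltW.
    by rewrite addrC addKr ler_wpM2l// ltW.
  apply: (@le_trans _ _ (L * `|w - w'|)).
    have -> : w - w' = (x + w) - (x + w') by rewrite opprD addrACA subrr add0r.
    apply: le_trans (fL _ _ (xw _ wd) (xw _ wd')).
    by apply: le_trans (ler_norm_entry _ i 0); rewrite !mxE.
  by rewrite ler_wpM2r// lerDr addr_ge0// mulr_ge0.
have gentry i : lip_in K d (fun x _ => f x i 0).
  apply: (@lip_in_bounded _ _ _ _ _ F) => x Kx; apply: (le_trans (ler_norm_entry _ _ _)).
  by have [] := fb x Kx.
have gdot : lip_in K d (fun x _ => dotp (f x) (f x)).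
  apply: (@lip_in_bounded _ _ _ _ _ (n%:R * F * F)) => x Kx; apply: (le_trans (ler_norm_dotp _ _)).
  by have [fF _ _] := fb x Kx; apply: ler_pM; rewrite ?mulr_ge0 ?ler_wpM2l.
have Jentry i : lip_in K d (fun x _ => (Jac f x *m f x) i 0).
  apply: (@lip_in_bounded _ _ _ _ _ (n%:R * J * F)) => x Kx; apply: (le_trans (ler_norm_entry _ _ _)).
  have [fF fJ _] := fb x Kx; apply: (le_trans (ler_norm_mulmx _ _)).
  by apply: ler_pM; rewrite ?mulr_ge0 ?ler_wpM2l.
have dotl (p q : 'cV[R]_n -> 'cV[R]_n -> 'cV[R]_n) :
    (forall i, lip_in K d (fun x w => p x w i 0)) ->
    (forall i, lip_in K d (fun x w => q x w i 0)) ->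
    lip_in K d (fun x w => dotp (p x w) (q x w)).
  move=> hp hq.
  rewrite (_ : (fun x w => _) = fun x w => \sum_i p x w i 0 * q x w i 0).
    by apply: lip_in_sum => i; apply: lip_inM.
  by apply/funext => x; apply/funext => w; rewrite dotpE.
have repl : lip_in K d (reparam f).
  apply: lip_inM.
    apply: lip_inD => //; apply: lip_inN.
    apply: (dotl (fun _ w => w) (fun x _ => Jac f x *m f x)) => // i.
    exact: lip_in_entry.
  apply: (@lip_inV _ _ _ _ _ k) => //.
  exact: (dotl (fun x w => f (x + w)) (fun x _ => f x)).
apply: lip_in_vector => i.
rewrite (_ : (fun x w => _) = fun x w => reparam f x w * f (x + w) i 0 + - f x i 0).
  by apply: lip_inD; [exact: lip_inM|exact: lip_inN].
by apply/funext => x; apply/funext => w; rewrite !mxE.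
Qed.

Lemma reparam_continuous (P om : R -> 'cV[R]_n) : continuous P -> continuous om ->
  (forall t, K (P t)) -> (forall t, `|om t| <= d) ->
  continuous (fun t => reparam f (P t) (om t)).
Proof.
move=> cP com KP omd t.
have fP : f (P s) @[s --> t] --> f (P t).
  by apply: continuous_cvg; [exact: (@C1map_continuous _ _ _ fC1)|exact: cP].
have JP : Jac f (P s) @[s --> t] --> Jac f (P t).
  by apply: continuous_cvg; [exact: (@Jac_continuous _ _ _ fC1)|exact: cP].
have fPo : f (P s + om s) @[s --> t] --> f (P t + om t).
  apply: continuous_cvg; first exact: (@C1map_continuous _ _ _ fC1).
  by apply: cvgD; [exact: cP|exact: com].
apply: cvgM.
  apply: cvgB; first by apply: (@dotp_cvg _ _ _ (nbhs t)).
  by apply: (@dotp_cvg _ _ _ (nbhs t)); [exact: com|exact: (@mulmx_cvg _ _ (nbhs t))].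
have h0 : dotp (f (P t + om t)) (f (P t)) != 0.
  by rewrite gt_eqF// (lt_le_trans k0)// den.
exact: (cvgV h0 (@dotp_cvg _ _ _ (nbhs t) _ _ _ _ _ fPo fP)).
Qed.

Lemma tube_field_continuous (P om : R -> 'cV[R]_n) : continuous P -> continuous om ->
  (forall t, K (P t)) -> (forall t, `|om t| <= d) ->
  continuous (fun t => tube_field f (P t) (om t)).
Proof.
move=> cP com KP omd t.
have fP : f (P s) @[s --> t] --> f (P t).
  by apply: continuous_cvg; [exact: (@C1map_continuous _ _ _ fC1)|exact: cP].
have fPo : f (P s + om s) @[s --> t] --> f (P t + om t).
  apply: continuous_cvg; first exact: (@C1map_continuous _ _ _ fC1).
  by apply: cvgD; [exact: cP|exact: com].
by apply: cvgB => //; apply: cvgZ => //; exact: reparam_continuous.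
Qed.

Lemma clamp_continuous (om : R -> 'cV[R]_n) :
  continuous om -> continuous (fun t => clamp d (om t)).
Proof.
move=> com t; apply/cvgrPdist_le => e e0.
have /cvgrPdist_le /(_ e e0) := com t; apply: filterS => s h.
exact: le_trans (clamp_lipschitz _ _ _) h.
Qed.

(** Clamping makes the equation globally Lipschitz and bounded, so [picard] applies. *)
Lemma tube_solution (P : R -> 'cV[R]_n) w0 : continuous P -> (forall t, K (P t)) ->
  exists w : R -> 'cV[R]_n, w 0 = w0 /\
    forall t, is_derive t 1 w (tube_field f (P t) (clamp d (w t))).
Proof.
move=> cP KP; have [C C0 H] := tube_field_lipschitz.
apply: (@picard _ _ (fun t w => tube_field f (P t) (clamp d w)) C C) => //.
- exact: ltW.
- move=> t x y; have [_ h] := H _ _ (KP t) (clamp_le (ltW d0) x).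
  apply: (le_trans (h _ (clamp_le (ltW d0) y))); apply: ler_wpM2l; first exact: ltW.
  exact: clamp_lipschitz _ _ _.
- by move=> t; have [] := H _ _ (KP t) (clamp_le (ltW d0) w0).
- move=> y cy; apply: tube_field_continuous => //; first exact: clamp_continuous.
  by move=> t; exact: clamp_le (ltW d0) _.
Qed.

End TubeSolution.

(** * Shadowing *)

Section RealLemmas.
Context {R : realType}.
Implicit Types (s t : R).

(** At the first time where g reaches d the bound g <= d holds up to that time, and the
hypothesis makes it strict. *)
Lemma continuity_bootstrap (g : R -> R) (d : R) : continuous g -> g 0 < d ->
  (forall t, 0 <= t -> (forall s, 0 <= s <= t -> g s <= d) -> g t < d) ->
  forall t, 0 <= t -> g t < d.
Proof.
move=> cg g0 step t t0; rewrite ltNge; apply/negP => dt.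
pose A := [set s | 0 <= s /\ d <= g s].
have hA : has_inf A by split; [exists t|exists 0 => s []].
pose a := inf A.
have a0 : 0 <= a by apply: lb_le_inf; [exists t|move=> s []].
have lta s : 0 <= s -> s < a -> g s < d.
  move=> s0 sa; rewrite ltNge; apply/negP => ds.
  by have := ge_inf hA.2 (conj s0 ds : A s); rewrite leNgt sa.
have ga : g a <= d.
  rewrite leNgt; apply/negP => da.
  have [a00|an0] := eqVneq a 0; first by move: da; rewrite a00 ltNge ltW.
  have ap : 0 < a by rewrite lt0r an0.
  have H1 : \forall s \near a, d < g s by apply: (cvgr_gt _ (cg a)).
  have H2 : \forall s \near a, 0 < s by exact: lt_nbhsr.
  have /nbhs_ballP[e /= e0 He] : \forall s \near a, 0 < s /\ d < g s by apply: filterI.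
  have [|s0 sd] := He (a - e / 2).
    by rewrite /ball /= opprB addrC subrK gtr0_norm; lra.
  by have := lta (a - e / 2) (ltW s0); lra.
have gad : g a < d.
  apply: step => // s /andP[s0]; rewrite le_eqVlt => /orP[/eqP->//|sa].
  exact/ltW/lta.
have H1 : \forall s \near a, g s < d by apply: (cvgr_lt _ (cg a)).
have /nbhs_ballP[e /= e0 He] := H1.
have : a + e / 2 <= a.
  apply: lb_le_inf; first by exists t.
  move=> s [s0 ds]; rewrite leNgt; apply/negP => sae.
  have as_ : a <= s by apply: (ge_inf hA.2); split.
  have : g s < d by apply: He; rewrite /ball /= distrC ger0_norm; lra.
  by rewrite ltNge ds.
by lra.
Qed.

(** A function with derivative at least 1/2 everywhere is a bijection of the line. *)
Lemma expanding_inverse (th q : R -> R) : (forall t, is_derive t 1 th (q t)) ->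
  (forall t, 2^-1 <= q t) ->
  exists psi : R -> R, [/\ forall t, psi (th t) = t, forall s, th (psi s) = s &
    forall t, is_derive (th t) 1 psi (q t)^-1].
Proof.
move=> thd q12.
have grow a b : a <= b -> (b - a) / 2 <= th b - th a.
  move=> ab; have := @ler_is_derive _ (fun s => 2^-1 * s) th (fun=> 2^-1) q a b.
  rewrite -mulrBr mulrC; apply => // s _.
  exact: is_derive_mulc.
have cth : continuous th by move=> t; exact: is_derive_continuous (thd t).
have inj : injective th.
  move=> a b E; apply/eqP; rewrite eq_le.
  have gE c e : c <= e -> th c = th e -> e <= c.
    by move=> ce E'; have := grow _ _ ce; rewrite E' subrr pmulr_lle0 ?invr_gt0// subr_le0.
  by case/orP: (le_total a b) => ab; rewrite ab gE.
have surj s : exists t, th t = s.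
  (* th - th 0 exceeds |s - th 0| in absolute value at - c and c *)
  pose c := 2 * `|s - th 0| + 1.
  have c0 : 0 <= c by rewrite addr_ge0// mulr_ge0.
  have [|||t _ <-] := @IVT R th (- c) c s.
  - by rewrite (le_trans _ c0)// oppr_le0.
  - exact: continuous_subspaceT.
  - have h1 : (0 - - c) / 2 <= th 0 - th (- c) by apply: grow; rewrite oppr_le0.
    have h2 : (c - 0) / 2 <= th c - th 0 by apply: grow.
    have := ler_norm (s - th 0); have := ler_norm (th 0 - s); rewrite distrC.
    rewrite /c in h1 h2 *; move=> h3 h4.
    by rewrite ge_min le_max; apply/andP; split; apply/orP; [left|right]; lra.
  - by exists t.
have /choice[psi psiP] := surj.
have psiK t : psi (th t) = t by apply: inj; rewrite psiP.
exists psi; split=> // t.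
apply: is_derive_inverse (thd t) _.
- by near=> s; exact: psiK.
- by near=> s; exact: cth.
- by rewrite gt_eqF// (lt_le_trans _ (q12 t)).
Unshelve. all: by end_near. Qed.

End RealLemmas.

Section Shadowing.
Context {R : realType} {n : nat}.
Implicit Types (s t : R) (x y v w : 'cV[R]_n).
Variables (f : 'cV[R]_n -> 'cV[R]_n) (K : set 'cV[R]_n) (M : 'cV[R]_n -> 'M[R]_n) (nu : R).
Variable S : R -> 'cV[R]_n -> 'cV[R]_n.
Hypothesis fC1 : C1map f.
Hypothesis cK : compact K.
Hypothesis SP : is_semiflow f K S.
Hypothesis f_neq0 : forall x, K x -> f x != 0.
Hypothesis M_diff : forall x, K x -> differentiable M x.
Hypothesis M_sym : forall x, K x -> (M x)^T = M x.
Hypothesis M_pos : forall x, K x -> posdefmx (M x).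
Hypothesis nu0 : 0 < nu.
Hypothesis LM_le : forall x, K x -> (LM f M x <= (- nu)%:E)%E.

Lemma tube_orthogonal x (w : R -> 'cV[R]_n) t : K x ->
  (forall s, 0 <= s <= t -> is_derive s 1 w (tube_field f (S s x) (w s))) ->
  (forall s, 0 <= s <= t -> dotp (f (S s x + w s)) (f (S s x)) != 0) ->
  dotp (w 0) (f x) = 0 ->
  forall s, 0 <= s <= t -> dotp (w s) (f (S s x)) = 0.
Proof.
move=> Kx wd den w0 s /andP[s0 st].
pose h r := dotp (w r) (f (S r x)).
have hd r : 0 <= r <= s -> is_derive r 1 h 0.
  move=> /andP[r0 rs]; have rt : 0 <= r <= t by rewrite r0 (le_trans rs).
  have := is_derive_dotp (wd r rt) (is_derive_Jac (fC1.1 _) (semiflow_derive SP Kx r0)).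
  by rewrite tube_field_perp// den.
have := @ler_norm_is_derive _ h (fun=> 0) (fun=> 0) (fun=> 0) 0 s hd.
rewrite subrr normr0 => /(_ (fun r _ => is_derive_cst 0 r 1) (fun r _ => lexx 0) s0).
rewrite normr_le0 subr_eq0 => /eqP; rewrite /h => ->.
by rewrite (semiflow0 SP).
Qed.

(** The drift contracts at rate 2 nu; a relative error eta as small as assumed costs at
most nu of it. *)
Lemma tube_quadf_decay x (w : R -> 'cV[R]_n) t (m C eta : R) : K x -> 0 <= t ->
  (forall z v, K z -> m * `|v| ^+ 2 <= quadf (M z) v) ->
  (forall z, K z -> `|M z| <= C) ->
  0 <= C -> 2 * n%:R ^+ 2 * C * eta <= nu * m ->
  (forall s, 0 <= s <= t -> is_derive s 1 w (tube_field f (S s x) (w s))) ->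
  (forall s, 0 <= s <= t -> dotp (w s) (f (S s x)) = 0) ->
  (forall s, 0 <= s <= t -> `|tube_field f (S s x) (w s) -
     transversal_drift f (S s x) (w s)| <= eta * `|w s|) ->
  quadf (M (S t x)) (w t) <= expR (- nu * t) * quadf (M x) (w 0).
Proof.
move=> Kx t0 Mm MC C0 small wd perp err.
have KS s : 0 <= s <= t -> K (S s x) by move=> /andP[s0 _]; exact: semiflowK SP _ _ Kx s0.
pose Nq s := quadf (M (S s x)) (w s).
have Nd s : 0 <= s <= t -> is_derive s 1 Nq (quadf (orbital_deriv f M (S s x)) (w s) +
    2 * dotp (w s) (M (S s x) *m tube_field f (S s x) (w s))).
  move=> st; apply: (@is_derive_quadf _ _ (fun s => M (S s x)) w) => //.
  - by apply: M_sym; exact: KS.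
  - apply: (is_derive_orbital (u := S^~ x)) => //; first by apply: M_diff; exact: KS.
    by case/andP: st => s0 _; exact: semiflow_derive SP _ _ Kx s0.
  - exact: wd.
have Nle s : 0 <= s <= t -> quadf (orbital_deriv f M (S s x)) (w s) +
    2 * dotp (w s) (M (S s x) *m tube_field f (S s x) (w s)) <= - nu * Nq s.
  move=> st; have df := err s st.
  have con := transversal_contraction M_pos LM_le M_sym (KS s st) (perp s st).
  set z := S s x in df con *; set u := w s in df con *.
  have Kz : K z := KS s st.
  have -> : tube_field f z u = transversal_drift f z u +
      (tube_field f z u - transversal_drift f z u) by rewrite [RHS]addrC subrK.
  set e := tube_field f z u - transversal_drift f z u in df *.
  rewrite mulmxDr dotpDr mulrDr addrA.
  (* half of the contraction rate 2 nu pays for the error term *)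
  have eb : 2 * dotp u (M z *m e) <= nu * Nq s.
    apply: (@le_trans _ _ (2 * (n%:R * `|u| * (n%:R * C * (eta * `|u|))))).
      rewrite ler_pM2l//; apply: (le_trans (ler_norm _)).
      apply: (le_trans (ler_norm_dotp _ _)); apply: ler_wpM2l; first by rewrite mulr_ge0.
      apply: (le_trans (ler_norm_mulmx _ _)); apply: ler_pM => //.
      by rewrite ler_wpM2l// MC.
    apply: (@le_trans _ _ (nu * (m * `|u| ^+ 2))); last first.
      by rewrite ler_pM2l//; exact: Mm.
    have -> : 2 * (n%:R * `|u| * (n%:R * C * (eta * `|u|))) =
      (2 * n%:R ^+ 2 * C) * eta * `|u| ^+ 2 by ring.
    by rewrite [leRHS]mulrA ler_wpM2r ?sqr_ge0.
  rewrite /Nq -/z -/u in eb con *; lra.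
by have := gronwall Nd Nle t0; rewrite subr0 /Nq (semiflow0 SP).
Qed.

(** The constants: eta is the relative error admitted by [tube_quadf_decay]; on the cube
of size d the tube field has that error and the time change has speed between
1/2 and 3/2; A compares the supremum norm with the metric, so that an initial
deviation of at most d / (2 A) never leaves the cube. *)
Lemma shadowing : exists delta C mu : R, [/\ 0 < delta, 0 < C, 0 < mu &
  forall x y, K x -> dotp (y - x) (f x) = 0 -> `|y - x| <= delta ->
  exists (Y : R -> 'cV[R]_n) (th : R -> R),
  [/\ Y 0 = y, th 0 = 0, forall s, 0 <= s -> is_derive s 1 Y (f (Y s)) &
    forall t, 0 <= t -> [/\ t / 2 <= th t <= 2 * t,
      exists2 r, 0 <= r & th r = t, `|th t - t| <= C * `|y - x| &
      `|Y (th t) - S t x| <= C * expR (- mu * t) * `|y - x| ]]].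
Proof.
have M_cont : {in K, continuous M}.
  by move=> x; rewrite inE => Kx; exact/differentiable_continuous/M_diff.
have [C1 [k [C10 k0 est]]] := tube_estimates fC1 cK f_neq0.
have [m m0 Mm] := metric_lower_bound cK M_cont M_pos.
have [CM CM0 MC] := metric_upper_bound cK M_cont.
pose N : R := n%:R; have N0 : 0 <= N by [].
pose eta := nu * m / (2 * N ^+ 2 * CM + 1).
have den0 : 0 < 2 * N ^+ 2 * CM + 1 by rewrite ltr_wpDl// !mulr_ge0 ?sqr_ge0// ltW.
have eta0 : 0 < eta by rewrite divr_gt0// mulr_gt0.
have [d1 d10 dest] := est eta eta0.
pose d := Num.min d1 (1 / (2 * C1)).
have d0 : 0 < d by rewrite lt_min d10 divr_gt0// mulr_gt0.
have dd1 w : `|w| <= d -> `|w| <= d1 by move=> /le_trans; apply; rewrite ge_min lexx.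
have den x w : K x -> `|w| <= d -> k <= dotp (f (x + w)) (f x).
  by move=> Kx /dd1 wd; have [] := dest x w Kx wd.
pose A := Num.sqrt (N ^+ 2 * CM / m) + 1.
have A1 : 1 <= A by rewrite lerDr sqrtr_ge0.
have A0 : 0 < A by exact: lt_le_trans A1.
have A2 : N ^+ 2 * CM / m <= A ^+ 2.
  have h : 0 <= N ^+ 2 * CM / m by rewrite divr_ge0 ?(ltW m0)// mulr_ge0 ?sqr_ge0// ltW.
  rewrite -[leLHS]sqr_sqrtr// ler_pXn2r ?nnegrE ?sqrtr_ge0 ?(ltW A0)//.
  by rewrite lerDl.
pose mu := nu / 2; have mu0 : 0 < mu by rewrite divr_gt0.
exists (d / (2 * A)), (C1 * A / mu + A), mu.
have CC0 : 0 < C1 * A / mu by rewrite divr_gt0// mulr_gt0.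
split=> //; [by rewrite divr_gt0// mulr_gt0|by rewrite addr_gt0|].
move=> x y Kx yx yxd.
(* Constant for t <= 0, so that the equation for w is defined for all times. *)
pose P t := S (Num.max 0 t) x.
have KP t : K (P t) by apply: (semiflowK SP) => //; rewrite le_max lexx.
have PE t : 0 <= t -> P t = S t x by move=> t0; rewrite /P max_r.
have cP : continuous P.
  move=> t; apply: (@continuous_comp _ _ _ (fun t => Num.max 0 t) (S^~ x)).
    exact: (@continuous_max _ _ (fun=> 0) id t (@cst_continuous _ _ _ _) (@cvg_id _ _)).
  by apply: is_derive_continuous (semiflow_derive SP Kx _); rewrite le_max lexx.
have [w [w0 wd]] := tube_solution fC1 cK f_neq0 d0 k0 den (y - x) cP KP.
have cw : continuous w by move=> t; exact: is_derive_continuous (wd t).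
have decay t : 0 <= t -> (forall s, 0 <= s <= t -> `|w s| <= d) ->
    `|w t| <= A * expR (- mu * t) * `|y - x|.
  move=> t0 wsd.
  have KS s : 0 <= s <= t -> K (S s x) by move=> /andP[s0 _]; exact: semiflowK SP _ _ Kx s0.
  have wds s : 0 <= s <= t -> is_derive s 1 w (tube_field f (S s x) (w s)).
    by move=> st; have := wd s; rewrite clamp_id ?wsd// PE//; case/andP: st.
  have NN : quadf (M (S t x)) (w t) <= expR (- nu * t) * quadf (M x) (w 0).
    apply: (@tube_quadf_decay x w t m CM eta Kx t0 Mm MC (ltW CM0) _ wds) => [||s st].
    - rewrite /eta mulrA ler_pdivrMr// [leLHS]mulrC ler_wpM2l ?lerDl//.
      by rewrite mulr_ge0 ?ltW.
    - apply: tube_orthogonal wds _ _ => // [s st|]; last by rewrite w0.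
      by rewrite gt_eqF// (lt_le_trans k0)// den// ?wsd//; exact: KS.
    - by have [] := dest _ _ (KS s st) (dd1 _ (wsd s st)).
  have st : 0 <= t <= t by rewrite t0 lexx.
  have h1 := Mm _ (w t) (KS t st).
  have h2 : quadf (M x) (w 0) <= N ^+ 2 * CM * `|y - x| ^+ 2.
    rewrite w0; apply: (le_trans (ler_norm _)).
    apply: (le_trans (quadf_le _ _)); rewrite ler_wpM2r ?sqr_ge0// ler_wpM2l ?sqr_ge0//.
    exact: MC.
  have rhs0 : 0 <= A * expR (- mu * t) * `|y - x|.
    by rewrite !mulr_ge0 ?expR_ge0// ltW.
  rewrite -(@ler_pXn2r _ 2) ?nnegrE//.
  have -> : (A * expR (- mu * t) * `|y - x|) ^+ 2 = A ^+ 2 * expR (- nu * t) * `|y - x| ^+ 2.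
    rewrite !exprMn; congr (_ * _ * _); rewrite expr2 -expRD; congr expR.
    by rewrite /mu; field.
  rewrite -(ler_pM2l m0); apply: (le_trans h1); apply: (le_trans NN).
  apply: (@le_trans _ _ (expR (- nu * t) * (N ^+ 2 * CM * `|y - x| ^+ 2))).
    by rewrite ler_wpM2l ?expR_ge0.
  have -> : m * (A ^+ 2 * expR (- nu * t) * `|y - x| ^+ 2) =
     expR (- nu * t) * (m * A ^+ 2 * `|y - x| ^+ 2) by ring.
  rewrite ler_wpM2l ?expR_ge0// ler_wpM2r ?sqr_ge0// [leRHS]mulrC -ler_pdivrMr//.
have Ayx : A * `|y - x| <= d / 2.
  rewrite mulrC -ler_pdivlMr// (le_trans yxd)//; apply: ler_of_eq.
  by field; rewrite gt_eqF.
have exp1 t : 0 <= t -> expR (- mu * t) <= 1.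
  by move=> t0; rewrite -expR0 ler_expR mulNr oppr_le0 mulr_ge0// ltW.
have wlt t : 0 <= t -> `|w t| < d.
  apply: (@continuity_bootstrap _ (fun t => `|w t|)).
  - by move=> r; apply: continuous_comp; [exact: cw|exact: norm_continuous].
  - rewrite w0; apply: (@le_lt_trans _ _ (A * `|y - x|)); first by rewrite ler_peMl.
    by apply: (le_lt_trans Ayx); lra.
  - move=> r r0 rd; apply: (le_lt_trans (decay r r0 rd)).
    apply: (@le_lt_trans _ _ (A * `|y - x|)); last by apply: (le_lt_trans Ayx); lra.
    by rewrite mulrAC ler_piMr ?exp1// mulr_ge0// ltW.
have wdec t : 0 <= t -> `|w t| <= A * expR (- mu * t) * `|y - x|.
  by move=> t0; apply: decay => // s /andP[s0 _]; exact/ltW/wlt.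
pose q t := reparam f (P t) (clamp d (w t)).
have cld t : `|clamp d (w t)| <= d by apply: clamp_le; exact: ltW.
have q1 t : `|q t - 1| <= C1 * `|clamp d (w t)|.
  by have [_ + _] := dest (P t) (clamp d (w t)) (KP t) (dd1 _ (cld t)).
have q12 t : `|q t - 1| <= 2^-1.
  apply: (le_trans (q1 t)); rewrite mulrC -ler_pdivlMr// (le_trans (cld t))//.
  by rewrite ge_min; apply/orP; right; rewrite div1r invfM.
have cq : continuous q.
  by apply: (reparam_continuous fC1 k0 den) => //; exact: clamp_continuous.
have [th [th0 thd]] := antiderivative1 cq.
have [psi [psiK thK psid]] : exists psi : R -> R, [/\ forall t, psi (th t) = t,
    forall s, th (psi s) = s & forall t, is_derive (th t) 1 psi (q t)^-1].
  by apply: expanding_inverse => // t; have := q12 t; rewrite ler_norml; lra.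
have th_lo a b : a <= b -> (b - a) / 2 <= th b - th a.
  move=> ab; have := @ler_is_derive _ (fun s => 2^-1 * s) th (fun=> 2^-1) q a b.
  rewrite -mulrBr mulrC; apply => // s _; first exact: is_derive_mulc.
  by have := q12 s; rewrite ler_norml; lra.
have th_hi a b : a <= b -> th b - th a <= 2 * (b - a).
  move=> ab; have := @ler_is_derive _ th (fun s => 2 * s) q (fun=> 2) a b.
  rewrite mulrBr; apply => // s _; first exact: is_derive_mulc.
  by have := q12 s; rewrite ler_norml; lra.
have psi_ge0 s : 0 <= s -> 0 <= psi s.
  move=> s0; rewrite leNgt; apply/negP => p0.
  by have := th_lo _ _ (ltW p0); rewrite thK th0; lra.
exists (fun s => S (psi s) x + w (psi s)), th; split=> //.
- by rewrite -th0 psiK (semiflow0 SP)// w0 [LHS]addrC subrK.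
- move=> s s0; pose t := psi s; have t0 : 0 <= t := psi_ge0 s s0.
  have zd : is_derive t 1 (fun r => S r x + w r) (q t *: f (S t x + w t)).
    have h1 := semiflow_derive SP Kx t0; have h2 := wd t.
    have h3 : clamp d (w t) = w t by apply: clamp_id; exact/ltW/wlt.
    rewrite h3 PE// in h2; apply: is_derive_eq (is_deriveD h1 h2) _.
    by rewrite /tube_field addrC subrK /q h3 PE.
  have hs : is_derive s 1 psi (q t)^-1 by have := psid t; rewrite thK.
  have := is_derive_comp1 hs zd.
  by rewrite scalerA mulVf ?scale1r//; have := q12 t; rewrite ler_norml => h; apply/eqP => E; lra.
- move=> t t0; split.
  + have := th_lo 0 t t0; have := th_hi 0 t t0; rewrite th0 !subr0 => -> ->.
    by [].
  + by exists (psi t); [exact: psi_ge0|exact: thK].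
  + pose h s := - (C1 * A / mu * `|y - x|) * expR (- mu * s).
    have hd s : is_derive s 1 h (C1 * A * expR (- mu * s) * `|y - x|).
      have := is_derive_mul (is_derive_cst (- (C1 * A / mu * `|y - x|)) s 1) (is_derive_expRM (- mu) s).
      rewrite mul0r add0r => H; apply: is_derive_eq H _.
      by rewrite /cst; field; rewrite gt_eqF.
    have gd s : is_derive s 1 (fun r => th r - r) (q s - 1).
      by have ? := thd s; exact: is_deriveB.
    have H := @ler_norm_is_derive _ (fun r => th r - r) h (fun s => q s - 1) _ 0 t
      (fun s _ => gd s) (fun s _ => hd s) _ t0.
    rewrite th0 subrr subr0 in H; apply: (le_trans (H _)).
      move=> s /andP[s0 st]; apply: (le_trans (q1 s)).
      have -> : clamp d (w s) = w s by apply: clamp_id; exact/ltW/wlt.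
      rewrite -2!(mulrA C1); apply: ler_wpM2l; [exact: ltW|exact: wdec].
    rewrite /h mulr0 expR0 mulr1 opprK mulNr addrC.
    apply: (@le_trans _ _ (C1 * A / mu * `|y - x|)).
      by rewrite gerBl !mulr_ge0 ?expR_ge0 ?invr_ge0// ltW.
    by rewrite ler_wpM2r// lerDl ltW.
  + rewrite psiK addrC addKr; apply: (le_trans (wdec t t0)).
    by rewrite ler_wpM2r// ler_wpM2r ?expR_ge0// lerDr ltW.
Qed.

End Shadowing.

(** * Distance to a set *)

Section Distance.
Context {R : realType} {n : nat}.
Implicit Types (s t r : R) (x y v w : 'cV[R]_n) (X : set 'cV[R]_n).

(** The Cauchy-Schwarz inequality, from the norm of the component of x perpendicular to
y. *)
Lemma ler_enormD x y : enorm (x + y) <= enorm x + enorm y.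
Proof.
rewrite -(@ler_pXn2r _ 2) ?nnegrE ?addr_ge0 ?enorm_ge0// sqrrD !sqr_enorm.
rewrite dotpDl !dotpDr (dotpC y x) mulr2n.
suff h : dotp x y <= enorm x * enorm y by lra.
apply: (le_trans (ler_norm _)).
rewrite -(@ler_pXn2r _ 2) ?nnegrE ?mulr_ge0 ?enorm_ge0// exprMn !sqr_enorm real_normK ?num_real//.
have [->|y0] := eqVneq y 0; first by rewrite !dotp0r expr0n mulr0.
have yy := dotp_gt0 y0.
have := dotp_ge0 (x - (dotp x y / dotp y y) *: y).
rewrite dotpBl !dotpBr !dotpZl !dotpZr (dotpC y x).
have -> : dotp x x - dotp x y / dotp y y * dotp x y -
  (dotp x y / dotp y y * dotp x y - dotp x y / dotp y y * (dotp x y / dotp y y * dotp y y)) =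
  (dotp x x * dotp y y - dotp x y ^+ 2) / dotp y y by field; rewrite gt_eqF.
by rewrite pmulr_lge0 ?invr_gt0// subr_ge0.
Qed.

Lemma enorm_continuous (x : 'cV[R]_n) : continuous (fun y : 'cV[R]_n => enorm (x - y)).
Proof.
move=> y; rewrite (_ : (fun y => _) = fun y : 'cV[R]_n => Num.sqrt (dotp (x - y) (x - y))).
  apply: (@continuous_comp _ _ _ (fun y : 'cV[R]_n => dotp (x - y) (x - y)) Num.sqrt).
    by apply: (@dotp_cvg _ _ _ (nbhs y)); apply: cvgB; [exact: cvg_cst|exact: cvg_id|
      exact: cvg_cst|exact: cvg_id].
  exact: sqrt_continuous.
by apply/funext => z; rewrite enormE.
Qed.

Lemma edistance_le x y X : X y -> edistance x X <= enorm (x - y).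
Proof.
move=> Xy; apply: ge_inf; last by exists y.
by exists 0 => _ [z _ <-]; exact: enorm_ge0.
Qed.

Lemma edistance_ge0 x X : X !=set0 -> 0 <= edistance x X.
Proof.
move=> [y Xy]; apply: lb_le_inf; first by exists (enorm (x - y)), y.
by move=> _ [z _ <-]; exact: enorm_ge0.
Qed.

Lemma edistance_triangle x y X : X !=set0 ->
  edistance x X <= enorm (x - y) + edistance y X.
Proof.
move=> [z Xz]; rewrite -lerBlDl; apply: lb_le_inf; first by exists (enorm (y - z)), z.
move=> _ [w Xw <-]; rewrite lerBlDl (le_trans (edistance_le x Xw))//.
have -> : x - w = (x - y) + (y - w) by rewrite subrKA.
exact: ler_enormD.
Qed.

Lemma edistance_attained x X : compact X -> X !=set0 ->
  exists2 y, X y & edistance x X = enorm (x - y).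
Proof.
move=> cX X0.
have [y Xy ymin] := compact_EVT_min X0 cX (continuous_subspaceT (@enorm_continuous x)).
rewrite inE in Xy; exists y => //; apply/eqP; rewrite eq_le edistance_le//=.
apply: lb_le_inf; first by exists (enorm (x - y)), y.
by move=> _ [z Xz <-]; apply: ymin; rewrite inE.
Qed.

Lemma enorm_eq0 x : enorm x = 0 -> x = 0.
Proof. by move=> x0; apply/eqP; rewrite -dotp_eq0 -sqr_enorm x0 expr0n. Qed.

Lemma edistance_eq0 x X : compact X -> X !=set0 -> edistance x X = 0 -> X x.
Proof.
move=> cX X0; have [y Xy ->] := edistance_attained x cX X0.
by move=> /enorm_eq0/eqP; rewrite subr_eq0 => /eqP ->.
Qed.

Lemma edistance0 x X : X x -> edistance x X = 0.
Proof.
move=> Xx; apply/eqP; rewrite eq_le edistance_ge0 ?andbT; last by exists x.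
by apply: le_trans (edistance_le x Xx) _; rewrite subrr enormE dotp0l sqrtr0.
Qed.

Lemma compact_cluster_seq (T : topologicalType) (A : set T) (u : nat -> T) :
  compact A -> (forall k, A (u k)) ->
  exists2 p, A p & forall U N, nbhs p U -> exists2 k, (N <= k)%N & U (u k).
Proof.
move=> cA Au; have [|p [Ap cl]] := cA (u @ \oo) _; first by exists 0%N => // k _; exact: Au.
exists p => // U N pU.
have [||_ [/= [k Nk <-] Uk]] := cl (u @` [set k | (N <= k)%N]) U => //.
  by exists N => // k Nk; exists k.
by exists k.
Qed.

End Distance.

(** * Closing almost periodic orbits *)

Section Recurrence.
Context {R : realType} {n : nat}.
Implicit Types (s t r : R) (x y v w : 'cV[R]_n).
Variables (f : 'cV[R]_n -> 'cV[R]_n) (K : set 'cV[R]_n).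
Variable S : R -> 'cV[R]_n -> 'cV[R]_n.
Hypothesis fC1 : C1map f.
Hypothesis cK : compact K.
Hypothesis SP : is_semiflow f K S.
Hypothesis f_neq0 : forall x, K x -> f x != 0.

(** The function s |-> (S_s y - S_h x).f(S_h x) grows at a speed close to |f(S_h x)|^2.
It is about - h |f|^2 at s = 0 and h |f|^2 at s = 2 h, up to errors that are small
if first h and then |y - x| is small, so it vanishes in between. Moving x by h
forward leaves room to move y by s >= 0 only: K is not invariant backwards in
time. *)
Lemma transversal_crossing e : 0 < e -> exists h eta : R, [/\ 0 < h, h <= 4^-1, 0 < eta &
  forall x y, K x -> K y -> `|y - x| <= eta ->
  exists s, [/\ 0 <= s, s <= 2 * h, dotp (S s y - S h x) (f (S h x)) = 0 &
    `|S s y - S h x| <= e]].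
Proof.
move=> e0.
have [F [J [k [F0 J0 k0 fb]]]] := field_bounds fC1 cK f_neq0.
have [B B0 SB] := semiflow_lipschitz_time fC1 SP cK.
have [L L0 fL] := compact_lipschitz fC1 cK.
pose N : R := n%:R + 1; have N0 : 0 < N by rewrite ltr_wpDl.
(* Up to time 2 h both orbits stay within 3 B h + eta of S_h x; h and eta make
   this at most e and the variation of f.f(S_h x) at most k / 4. *)
pose h := Num.min 4^-1 (Num.min (e / (6 * B)) (k / (24 * (N * L * F * B)))).
have NLF : 0 < N * L * F by rewrite !mulr_gt0.
have h0 : 0 < h by rewrite !lt_min; apply/and3P; split; rewrite ?invr_gt0// divr_gt0 ?mulr_gt0.
pose eta := Num.min (e / 2) (Num.min (k / (8 * (N * L * F))) (h * k / (4 * (N * F)))).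
have NF : 0 < N * F by rewrite mulr_gt0.
have eta0 : 0 < eta by rewrite !lt_min; apply/and3P; split; rewrite divr_gt0 ?mulr_gt0.
have h1 : h <= e / (6 * B) by rewrite /h !ge_min lexx orbT.
have h2 : h <= k / (24 * (N * L * F * B)) by rewrite /h !ge_min lexx !orbT.
have e1 : eta <= e / 2 by rewrite /eta !ge_min lexx.
have e2 : eta <= k / (8 * (N * L * F)) by rewrite /eta !ge_min lexx orbT.
have e3 : eta <= h * k / (4 * (N * F)) by rewrite /eta !ge_min lexx !orbT.
exists h, eta; split=> //; first by rewrite /h ge_min lexx.
move=> x y Kx Ky yx.
set p := S h x.
have Kp : K p by apply: (semiflowK SP) => //; exact: ltW.
have [fF _ fk] := fb p Kp.
set kap := dotp (f p) (f p) in fk *.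
have close z : K z -> `|z - p| <= 3 * B * h + eta -> `|dotp (f z) (f p) - kap| <= k / 4.
  move=> Kz zp; rewrite -dotpBl (le_trans (ler_norm_dotp _ _))//.
  apply: (@le_trans _ _ (N * (L * (3 * B * h + eta)) * F)).
    apply: ler_pM => //.
    apply: ler_pM => //; first by rewrite lerDl.
    by apply: (le_trans (fL _ _ Kz Kp)); rewrite ler_wpM2l// ltW.
  have a1 : N * L * F * (3 * B * h) <= k / 8.
    apply: (@le_trans _ _ (N * L * F * (3 * B * (k / (24 * (N * L * F * B)))))).
      by rewrite ler_wpM2l ?(ltW NLF)// ler_wpM2l// mulr_ge0// ltW.
    apply: ler_of_eq; field.
    by rewrite !gt_eqF.
  have a2 : N * L * F * eta <= k / 8.
    apply: (@le_trans _ _ (N * L * F * (k / (8 * (N * L * F))))).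
      by rewrite ler_wpM2l ?(ltW NLF).
    apply: ler_of_eq; field.
    by rewrite !gt_eqF.
  have -> : N * (L * (3 * B * h + eta)) * F = N * L * F * (3 * B * h) + N * L * F * eta by ring.
  lra.
have xp r : 0 <= r <= h -> `|S r x - p| <= 3 * B * h + eta.
  move=> /andP[r0 rh]; rewrite distrC (le_trans (SB _ _ _ Kx r0 rh))//.
  have : B * (h - r) <= B * h by rewrite ler_wpM2l ?(ltW B0)// gerBl.
  have := mulr_gt0 B0 h0; lra.
have yp r : 0 <= r <= 2 * h -> `|S r y - p| <= 3 * B * h + eta.
  move=> /andP[r0 rh].
  have b1 : `|S r y - y| <= 2 * B * h.
    have := SB _ _ _ Ky (lexx 0) r0; rewrite (semiflow0 SP)// subr0 => /le_trans; apply.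
    by rewrite (mulrC 2) -mulrA ler_wpM2l ?(ltW B0).
  have b2 : `|x - p| <= B * h.
    by have := SB _ _ _ Kx (lexx 0) (ltW h0); rewrite (semiflow0 SP)// subr0 distrC.
  have -> : S r y - p = (S r y - y) + (y - x) + (x - p) by rewrite !subrKA.
  apply: (le_trans (ler_normD _ _)); have := ler_normD (S r y - y) (y - x); lra.
pose gx r := dotp (S r x) (f p).
pose gy r := dotp (S r y) (f p).
have dS z r : K z -> 0 <= r -> is_derive r 1 (fun r => dotp (S r z) (f p)) (dotp (f (S r z)) (f p)).
  move=> Kz r0; have := is_derive_dotp (semiflow_derive SP Kz r0) (is_derive_cst (f p) r 1).
  by rewrite dotp0r addr0.
have gxlo : (kap - k / 4) * h <= gx h - gx 0.
  have := @ler_is_derive _ (fun r => (kap - k / 4) * r) gx (fun=> kap - k / 4) (fun r => dotp (f (S r x)) (f p)) 0 h.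
  rewrite mulr0 subr0; apply; rewrite ?ltW// => r r01; have /andP[r0 _] := r01;
    try exact: is_derive_mulc; try exact: dS.
  have := close (S r x) (semiflowK SP Kx r0) (xp r r01); rewrite ler_norml; lra.
have gxhi : gx h - gx 0 <= (kap + k / 4) * h.
  have := @ler_is_derive _ gx (fun r => (kap + k / 4) * r) (fun r => dotp (f (S r x)) (f p)) (fun=> kap + k / 4) 0 h.
  rewrite mulr0 subr0; apply; rewrite ?ltW// => r r01; have /andP[r0 _] := r01;
    try exact: is_derive_mulc; try exact: dS.
  have := close (S r x) (semiflowK SP Kx r0) (xp r r01); rewrite ler_norml; lra.
have h20 : 0 <= 2 * h by rewrite mulr_ge0// ltW.
have gylo : (kap - k / 4) * (2 * h) <= gy (2 * h) - gy 0.
  have := @ler_is_derive _ (fun r => (kap - k / 4) * r) gy (fun=> kap - k / 4) (fun r => dotp (f (S r y)) (f p)) 0 (2 * h).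
  rewrite mulr0 subr0; apply => // r r01; have /andP[r0 _] := r01;
    try exact: is_derive_mulc; try exact: dS.
  have := close (S r y) (semiflowK SP Ky r0) (yp r r01); rewrite ler_norml; lra.
have g0 : `|gy 0 - gx 0| <= h * k / 4.
  rewrite /gx /gy !(semiflow0 SP)// -dotpBl (le_trans (ler_norm_dotp _ _))//.
  apply: (@le_trans _ _ (N * eta * F)).
    apply: ler_pM => //.
    by apply: ler_pM => //; rewrite lerDl.
  apply: (@le_trans _ _ (N * (h * k / (4 * (N * F))) * F)).
    by rewrite ler_wpM2r ?(ltW F0)// ler_wpM2l// ltW.
  apply: ler_of_eq; field.
  by rewrite !gt_eqF.
have kh : k * h <= kap * h by rewrite ler_wpM2r// ltW.
move: g0; rewrite ler_norml => /andP[g01 g02].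
have [||| s] := @IVT R gy 0 (2 * h) (gx h).
- exact: h20.
- apply: continuous_in_subspaceT => r; rewrite inE /= in_itv /= => /andP[r0 _].
  exact: is_derive_continuous (dS _ _ Ky r0).
- rewrite ge_min le_max; apply/andP; split; apply/orP; [left|right]; lra.
rewrite in_itv /= => s01 gs; have /andP[s0 s1] := s01.
exists s; split=> //; first by rewrite dotpBl -/(gy s) gs /gx subrr.
apply: (le_trans (yp s s01)).
have -> : e = 3 * B * (e / (6 * B)) + e / 2 by field; rewrite gt_eqF.
by rewrite lerD// ler_wpM2l// mulr_ge0// ltW.
Qed.

(** Only S_t q with t >= 0 is available, so u t is read off at t + k tau for any k large
enough; the values do not depend on k. *)
Lemma periodic_extension q tau : K q -> 0 < tau -> S tau q = q ->
  exists u : R -> 'cV[R]_n, [/\ forall t, is_derive t 1 u (f (u t)),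
    forall t, u (t + tau) = u t, forall t, 0 <= t -> u t = S t q & forall t, K (u t)].
Proof.
move=> Kq tau0 Sq.
have per1 t : 0 <= t -> S (t + tau) q = S t q.
  by move=> t0; rewrite (semiflowD fC1 SP) ?Sq// ltW.
have per (k : nat) t : 0 <= t -> S (t + k%:R * tau) q = S t q.
  move=> t0; elim: k => [|k ih]; first by rewrite mul0r addr0.
  by rewrite -natr1 mulrDl mul1r addrA per1 ?ih// addr_ge0// mulr_ge0// ltW.
have perE (i j : nat) t : 0 <= t + i%:R * tau -> 0 <= t + j%:R * tau ->
    S (t + i%:R * tau) q = S (t + j%:R * tau) q.
  wlog ij : i j / (i <= j)%N.
    by move=> H h1 h2; case/orP: (leq_total i j) => ij; [exact: H|apply/esym; exact: H].
  by move=> h1 _; rewrite -(subnKC ij) natrD mulrDl addrA; exact/esym/per.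
have ex t : exists k : nat, 1 <= t + k%:R * tau.
  exists (Num.truncn ((1 + `|t|) / tau)).+1.
  have := truncnS_gt ((1 + `|t|) / tau); rewrite ltr_pdivrMr// => h.
  by have := ler_norm (- t); rewrite normrN; lra.
have /choice[k kP] := ex.
pose u t := S (t + (k t)%:R * tau) q.
have uE (j : nat) t : 0 <= t + j%:R * tau -> u t = S (t + j%:R * tau) q.
  by move=> h; apply: perE => //; apply: le_trans (kP t).
exists u; split.
- move=> t.
  apply: (@is_derive_near _ _ (fun s => S (s + (k t)%:R * tau) q)).
    near=> s; apply/esym/uE.
    have : `|t - s| < 1.
      by near: s; apply: (@cvgr_dist_lt _ _ _ _ _ id); [exact: cvg_id|].
    by have := kP t; have := ler_norm (t - s); lra.
  have h : is_sol f (S^~ q) (t + (k t)%:R * tau) (t + (k t)%:R * tau).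
    by apply: semiflow_sol SP _ _ _ Kq _; apply: le_trans (kP t).
  have := is_sol_shift h; apply.
  by rewrite lexx.
- move=> t; rewrite (uE (k t)).
    by rewrite addrAC per1//; apply: le_trans (kP t).
  by have := kP t; lra.
- by move=> t t0; rewrite (uE 0%N) ?mul0r ?addr0.
- by move=> t; apply: (semiflowK SP) => //; apply: le_trans (kP t).
Unshelve. all: by end_near. Qed.

(** A cluster point of almost periods tau and points q in the compact set [1, b] x K; the
bound 1 <= tau keeps the limit period away from 0. *)
Lemma almost_periodic_closes b :
  (forall e, 0 < e -> exists q tau, [/\ K q, 1 <= tau, tau <= b & `|S tau q - q| <= e]) ->
  exists q tau, [/\ K q, 1 <= tau & S tau q = q].
Proof.
move=> H.
have [B B0 SB] := semiflow_lipschitz_time fC1 SP cK.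
have [L L0 dep] := semiflow_dependence fC1 SP cK.
have /choice[z zP] : forall k : nat, exists z : R * 'cV[R]_n,
    [/\ `[1, b]%classic z.1, K z.2 & `|S z.1 z.2 - z.2| <= k.+1%:R^-1].
  move=> k; have [|q [tau [Kq t1 tb tq]]] := H k.+1%:R^-1; rewrite ?invr_gt0//.
  by exists (tau, q); split=> //=; rewrite in_itv /= t1.
have cA : compact (`[1, b]%classic `*` K) by apply: compact_setX => //; exact: segment_compact.
have [|[tau q] [/= tb Kq] cl] := compact_cluster_seq cA (u := z).
  by move=> k; have [h1 h2 _] := zP k.
move: tb; rewrite in_itv /= => /andP[t1 tb].
have t0 : 0 <= tau by exact: le_trans t1.
exists q, tau; split=> //; apply/eqP; rewrite -subr_eq0 -normr_le0.
rewrite leNgt; apply/negP => e0; set e := `|S tau q - q| in e0 *.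
pose D := n%:R * expR (L * tau) + 1.
have D0 : 0 < D by rewrite ltr_wpDl// mulr_ge0// expR_ge0.
(* Four terms of size e / 8 contradict |S tau q - q| = e. *)
pose d1 := e / (8 * D); pose d2 := e / (8 * B).
have d10 : 0 < d1 by rewrite divr_gt0// mulr_gt0.
have d20 : 0 < d2 by rewrite divr_gt0// mulr_gt0.
pose N := (Num.truncn (8 / e)).+1.
have [|k Nk [/= h1 h2]] := cl (ball tau d2 `*` ball q d1) N.
  by exists (ball tau d2, ball q d1) => //=; split; apply: nbhsx_ballx.
have [hb Kz zk] := zP k.
set tk := (z k).1 in h1 hb zk *; set qk := (z k).2 in h2 Kz zk *.
move: hb; rewrite /= in_itv /= => /andP[tk1 tkb].
have tk0 : 0 <= tk by exact: le_trans tk1.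
have a0 : `|q - qk| <= d1 by apply/ltW; move: h2; rewrite -ball_normE.
have a1 : `|S tau q - S tau qk| <= e / 8.
  apply: (le_trans (dep _ _ _ Kq Kz t0)).
  apply: (@le_trans _ _ (D * d1)).
    by apply: ler_pM => //; rewrite ?mulr_ge0 ?expR_ge0// lerDl.
  by apply: ler_of_eq; rewrite /d1; field; rewrite gt_eqF.
have a2 : `|S tau qk - S tk qk| <= e / 8.
  have tt : `|tau - tk| <= d2 by exact: ltW.
  have E : B * d2 = e / 8 by rewrite /d2; field; rewrite gt_eqF.
  have := ler_norm (tau - tk); have := ler_norm (tk - tau); rewrite distrC => n1 n2.
  rewrite -E; have [tt'|tt'] := leP tk tau.
    by rewrite (le_trans (SB _ _ _ Kz tk0 tt'))// ler_wpM2l ?(ltW B0)//; lra.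
  by rewrite distrC (le_trans (SB _ _ _ Kz t0 (ltW tt')))// ler_wpM2l ?(ltW B0)//; lra.
have a3 : `|S tk qk - qk| <= e / 8.
  apply: (le_trans zk); rewrite -[leRHS]invrK lef_pV2 ?posrE ?invr_gt0 ?divr_gt0// invf_div.
  apply/ltW/(lt_le_trans (truncnS_gt _)).
  by rewrite ler_nat (leq_trans Nk).
have a4 : `|q - qk| <= e / 8.
  apply: (le_trans a0); rewrite /d1 ler_pM2l// lef_pV2 ?posrE ?mulr_gt0//.
  by rewrite ler_pMr// lerDr mulr_ge0// expR_ge0.
have : e <= e / 8 + e / 8 + e / 8 + e / 8.
  rewrite {1}/e; have -> : S tau q - q = (S tau q - S tau qk) + (S tau qk - S tk qk) +
    (S tk qk - qk) + (qk - q) by rewrite !subrKA.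
  apply: (le_trans (ler_normD _ _)); apply: lerD; last by rewrite distrC.
  apply: (le_trans (ler_normD _ _)); apply: lerD => //.
  by apply: (le_trans (ler_normD _ _)); apply: lerD.
lra.
Qed.

End Recurrence.

(** * The periodic orbit and its basin of attraction *)

Section Attraction.
Context {R : realType} {n : nat}.
Implicit Types (s t r : R) (x y v w : 'cV[R]_n) (Om : set 'cV[R]_n).
Variables (f : 'cV[R]_n -> 'cV[R]_n) (K : set 'cV[R]_n) (M : 'cV[R]_n -> 'M[R]_n) (nu : R).
Variable S : R -> 'cV[R]_n -> 'cV[R]_n.
Hypothesis fC1 : C1map f.
Hypothesis cK : compact K.
Hypothesis K0 : K !=set0.
Hypothesis SP : is_semiflow f K S.
Hypothesis f_neq0 : forall x, K x -> f x != 0.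
Hypothesis M_diff : forall x, K x -> differentiable M x.
Hypothesis M_sym : forall x, K x -> (M x)^T = M x.
Hypothesis M_pos : forall x, K x -> posdefmx (M x).
Hypothesis nu0 : 0 < nu.
Hypothesis LM_le : forall x, K x -> (LM f M x <= (- nu)%:E)%E.

(** Both points are moved forward by at most 1/2 to make their difference perpendicular
to f, so that [shadowing] applies. *)
Lemma near_points_shadow : exists eta C mu : R, [/\ 0 < eta, 0 < C, 0 < mu &
  forall x y, K x -> K y -> `|y - x| <= eta ->
  exists (s h : R) (th : R -> R), [/\ 0 <= s <= 2^-1, 0 <= h <= 2^-1 &
   forall t, 0 <= t -> [/\ 0 <= th t, `|th t - t| <= 2^-1,
     exists2 r, 0 <= r & th r = t &
     `|S (th t + s) y - S (t + h) x| <= C * expR (- mu * t)] ]].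
Proof.
have [delta [C [mu [delta0 C0 mu0 sh]]]] :=
  shadowing fC1 cK SP f_neq0 M_diff M_sym M_pos nu0 LM_le.
pose e := Num.min delta (2 * C)^-1.
have e0 : 0 < e by rewrite lt_min delta0 invr_gt0 mulr_gt0.
have [h [eta [h0 h4 eta0 meet]]] := transversal_crossing fC1 cK SP f_neq0 e0.
exists eta, (C * e), mu; split; rewrite ?mulr_gt0// => x y Kx Ky yx.
have [s [s0 s2 perp se]] := meet x y Kx Ky yx.
have Kx' : K (S h x) by apply: (semiflowK SP) => //; exact: ltW.
have Ky' : K (S s y) by apply: (semiflowK SP).
have [|Y [th [Y0 th0 Yd thP]]] := sh _ _ Kx' perp.
  by rewrite (le_trans se)// ge_min lexx.
exists s, h, th; split.
- by rewrite s0/=; lra.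
- by rewrite ltW//=; lra.
move=> t t0; have [/andP[th1 th2] thr tht dist] := thP t t0.
have tht0 : 0 <= th t by apply: le_trans th1; rewrite divr_ge0.
split=> //.
- rewrite (le_trans tht)//; apply: (@le_trans _ _ (C * (2 * C)^-1)).
    by rewrite ler_wpM2l ?(ltW C0)// (le_trans se)// ge_min lexx orbT.
  by apply: ler_of_eq; field; rewrite gt_eqF.
- rewrite (semiflowD fC1 SP Ky tht0 s0) (semiflowD fC1 SP Kx t0 (ltW h0)).
  have -> : S (th t) (S s y) = Y (th t).
    apply: (is_sol_unique fC1 tht0 (semiflow_sol SP Ky' (lexx 0))).
      by move=> r /andP[r0 _]; exact: Yd.
    by rewrite Y0 (semiflow0 SP).
  apply: (le_trans dist); rewrite mulrAC ler_wpM2r ?expR_ge0// ler_wpM2l//.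
  exact: ltW.
Qed.

Lemma expR_decay_le (C mu e : R) : 0 < C -> 0 < mu -> 0 < e ->
  exists2 T, 0 <= T & forall t, T <= t -> C * expR (- mu * t) <= e.
Proof.
move=> C0 mu0 e0; exists (C / (mu * e)); first by rewrite divr_ge0 ?mulr_ge0 ?ltW.
move=> t Tt.
have h1 : 1 + mu * t <= expR (mu * t) by exact: expR_ge1Dx.
rewrite mulNr expRN ler_pdivrMr ?expR_gt0//.
apply: (@le_trans _ _ (e * (mu * t))); last by rewrite ler_wpM2l ?(ltW e0)//; lra.
have := Tt; rewrite ler_pdivrMr ?mulr_gt0// => /le_trans; apply.
by apply: ler_of_eq; ring.
Qed.

(** Two of the points S_k x0, with k integer, are close and at least 2 apart in time. If
y = S_m x is close to x, then S_(th t + s + m) x and S_(t + h) x approach each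
other, and their time difference stays within [m - 1, m + 1]. *)
Lemma periodic_point_exists : exists q tau, [/\ K q, 1 <= tau & S tau q = q].
Proof.
have [eta [C [mu [eta0 C0 mu0 meet]]]] := near_points_shadow.
have [x0 Kx0] := K0.
have Kseq (k : nat) : K (S k%:R x0) by apply: (semiflowK SP).
have [p Kp cl] := compact_cluster_seq cK Kseq.
have eta20 : 0 < eta / 2 by rewrite divr_gt0.
have [i _ ip] := cl (ball p (eta / 2)) 0%N (nbhsx_ballx p _ eta20).
have [j ij jp] := cl (ball p (eta / 2)) i.+2 (nbhsx_ballx p _ eta20).
set x := S i%:R x0 in ip; set y := S j%:R x0 in jp.
have Kx : K x by exact: Kseq.
have yx : `|y - x| <= eta.
  move: ip jp; rewrite -ball_normE /= => ip jp.
  have -> : y - x = (y - p) + (p - x) by rewrite subrKA.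
  by apply: (le_trans (ler_normD _ _)); rewrite (distrC y); lra.
pose m : R := (j - i)%:R.
have m2 : 2 <= m by rewrite /m ler_nat; apply: (leq_trans _ (leq_sub2r i ij)); rewrite !subSn// ?subnn// leqnSn.
have yE : y = S m x.
  rewrite /y /x /m -(semiflowD fC1 SP Kx0)//.
  by rewrite -natrD subnK// (leq_trans _ ij)// (leq_trans (leqnSn _))// leqnSn.
have [s [h [th [/andP[s0 s1] /andP[h0 h1] thP]]]] := meet x y Kx (Kseq j) yx.
apply: (almost_periodic_closes fC1 cK SP (b := m + 2)) => e e0.
have [T T0 small] := expR_decay_le C0 mu0 e0.
have [thT0 thT _ dist] := thP T T0.
move: thT; rewrite ler_norml => /andP[th1 th2].
have Th0 : 0 <= T + h by exact: addr_ge0.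
have Kq : K (S (T + h) x) by apply: (semiflowK SP).
exists (S (T + h) x), (th T + s + m - (T + h)); split=> //; [lra|lra|].
have m0 : 0 <= m by exact: le_trans m2.
rewrite -(semiflowD fC1 SP Kx _ Th0); last by lra.
rewrite subrK (semiflowD fC1 SP Kx (addr_ge0 thT0 s0) m0).
by rewrite -yE (le_trans dist)// small.
Qed.

Lemma compact_periodic_range (u : R -> 'cV[R]_n) (tau : R) : 0 < tau ->
  continuous u -> (forall t, u (t + tau) = u t) ->
  compact (range u) /\ forall t0 t, exists2 r, t0 <= r & u r = u t.
Proof.
move=> tau0 cu per.
have perN (k : nat) t : u (t + k%:R * tau) = u t.
  elim: k => [|k ih]; first by rewrite mul0r addr0.
  by rewrite -natr1 mulrDl mul1r addrA per ih.
have large t0 t : exists k : nat, t0 <= t + k%:R * tau.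
  exists (Num.truncn (`|t0 - t| / tau)).+1.
  have := truncnS_gt (`|t0 - t| / tau); rewrite ltr_pdivrMr// => h.
  by have := ler_norm (t0 - t); lra.
split; last first.
  by move=> t0 t; have [k kt] := large t0 t; exists (t + k%:R * tau).
rewrite (_ : range u = u @` `[0, tau]%classic).
  by apply: continuous_compact; [exact: continuous_subspaceT|exact: segment_compact].
apply/seteqP; split=> [_ [t _ <-]|_ [t _ <-]]; last by exists t.
have [k kt] := large 0 t; set r := t + k%:R * tau in kt.
pose j := Num.truncn (r / tau).
have /andP[j1 j2] : j%:R <= r / tau < j.+1%:R by apply: truncn_itv; rewrite divr_ge0// ltW.
exists (r - j%:R * tau); last first.
  by rewrite -(perN k t) -/r -[in RHS](subrK (j%:R * tau) r) perN.
rewrite ler_pdivlMr// in j1; rewrite ltr_pdivrMr// -natr1 mulrDl mul1r in j2.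
by rewrite /= in_itv /= subr_ge0 j1 /=; lra.
Qed.

Lemma sol_not_constant (u : R -> 'cV[R]_n) : (forall t, is_derive t 1 u (f (u t))) ->
  f (u 0) != 0 -> exists t, u t != u 0.
Proof.
move=> ud fu0; apply: contrapT => /forallNP H.
have uE : u = cst (u 0).
  by apply/funext => t; apply/eqP; have := H t => /negP/negPn.
have := ud 0; rewrite {1}uE => -[_]; rewrite derive_cst => E.
by rewrite -E eqxx in fu0.
Qed.

Section GivenOrbit.
Variables (Om : set 'cV[R]_n) (u : R -> 'cV[R]_n) (tau : R).
Hypothesis tau0 : 0 < tau.
Hypothesis u_sol : forall t, is_derive t 1 u (f (u t)).
Hypothesis u_per : forall t, u (t + tau) = u t.
Hypothesis OmE : Om = range u.
Hypothesis OmK : Om `<=` K.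

Let cu : continuous u. Proof. by move=> t; exact: is_derive_continuous (u_sol t). Qed.
Let cOm : compact Om. Proof. by rewrite OmE; have [] := compact_periodic_range tau0 cu u_per. Qed.
Let Om0 : Om !=set0. Proof. by exists (u 0); rewrite OmE; exists 0. Qed.
Let uK t : K (u t). Proof. by apply: OmK; rewrite OmE; exists t. Qed.

Lemma semiflow_orbit s t : 0 <= t -> S t (u s) = u (s + t).
Proof.
move=> t0; have := is_sol_unique fC1 t0 (semiflow_sol SP (uK s) (lexx 0)) (v := fun r => u (r + s)).
rewrite (addrC s); apply; last by rewrite add0r (semiflow0 SP).
by apply: is_sol_shift => r _; exact: u_sol.
Qed.

Definition attracted x := forall e, 0 < e -> exists2 T, 0 <= T &
  forall t, T <= t -> edistance (S t x) Om <= e.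

Lemma attracted_orbit s : attracted (u s).
Proof.
move=> e e0; exists 0 => // t t0; rewrite semiflow_orbit// edistance0 ?ltW//.
by rewrite OmE; exists (s + t).
Qed.

(** A solution that shadows an attracted one is attracted, since the time change is onto. *)
Lemma attracted_near : exists2 eta, 0 < eta & forall x y, K x -> K y -> `|y - x| <= eta ->
  attracted x -> attracted y.
Proof.
have [eta [C [mu [eta0 C0 mu0 meet]]]] := near_points_shadow.
exists eta => // x y Kx Ky yx ax e e0.
have [s [h [th [/andP[s0 s1] /andP[h0 h1] thP]]]] := meet x y Kx Ky yx.
have [T1 T10 H1] := ax (e / 2) (divr_gt0 e0 (ltr0Sn _ 1)).
have nC0 : 0 < (n%:R + 1) * C by rewrite mulr_gt0// ltr_wpDl.
have [T2 T20 H2] := expR_decay_le nC0 mu0 (divr_gt0 e0 (ltr0Sn _ 1)).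
exists (T1 + T2 + 1) => [|t tT]; first by rewrite !addr_ge0.
have ts0 : 0 <= t - s by lra.
have [_ _ [r r0 thr] _] := thP _ ts0.
have [_ thr1 _ dist] := thP _ r0.
rewrite thr subrK in dist; rewrite thr ler_norml in thr1; case/andP: thr1 => q1 q2.
apply: (le_trans (edistance_triangle (S t y) (S (r + h) x) Om0)).
rewrite [leRHS]splitr; apply: lerD; last by apply: H1; lra.
apply: (le_trans (enorm_le_norm _)).
apply: (@le_trans _ _ ((n%:R + 1) * (C * expR (- mu * r)))).
  by apply: ler_pM => //; rewrite lerDl.
by rewrite mulrA H2//; lra.
Qed.

Hypothesis conK : connected K.

(** By [attracted_near] the attracted points and their complement in K both contain,
with each point, all points of K within a fixed distance. *)
Lemma all_attracted x : K x -> attracted x.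
Proof.
have [eta eta0 near_att] := attracted_near.
pose B := [set x | K x /\ attracted x].
suff -> : K = B by move=> [].
apply/esym/conK.
- by exists (u 0); split; [exact: uK|exact: attracted_orbit].
- exists (\bigcup_(x in B) (ball x eta)^°).
    by apply: bigcup_open => z _; exact: open_interior.
  apply/seteqP; split=> [z [Kz az]|z [Kz [p [Kp ap] /interior_subset]]].
    by split=> //; exists z => //; exact: nbhsx_ballx.
  rewrite -ball_normE /= => pz; split=> //; apply: (near_att p) => //.
  by rewrite distrC ltW.
- exists (~` \bigcup_(x in K `\` B) (ball x eta)^°).
    by apply: open_closedC; apply: bigcup_open => z _; exact: open_interior.
  apply/seteqP; split=> [z [Kz az]|z [Kz nz]].
    split=> // -[p [Kp nBp] /interior_subset]; rewrite -ball_normE /= => pz.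
    by apply: nBp; split=> //; apply: (near_att z) => //; exact: ltW.
  apply: contrapT => nBz; apply: nz; exists z; first by split.
  exact: nbhsx_ballx.
Qed.

Lemma basin_contains : K `<=` basin f Om.
Proof.
move=> x Kx; have [_ _ _ fl] := SP Kx; split=> [t t0|]; first by have [] := fl t t0.
apply/cvgrPdist_le => e e0; have [T T0 H] := all_attracted Kx e0.
near=> t; rewrite sub0r normrN.
have tT : T <= t by near: t; apply: nbhs_pinfty_ge; rewrite num_real.
have [_ ->] := fl t (le_trans T0 tT).
by rewrite ger0_norm ?edistance_ge0// H.
Unshelve. all: by end_near. Qed.

(** The distance to Omega is periodic along the second orbit and tends to 0, so it
vanishes: the second orbit lies in Omega, and a solution that meets Omega runs
through all of it. *)
Lemma periodic_orbit_unique Om' : periodic_orbit f Om' -> Om' `<=` K -> Om' = Om.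
Proof.
move=> [v [T [T0 vd vper _ OmE']]] OmK'.
have cv : continuous v by move=> t; exact: is_derive_continuous (vd t).
have [_ larg'] := compact_periodic_range T0 cv vper.
have [_ larg] := compact_periodic_range tau0 cu u_per.
have Kv t : K (v t) by apply: OmK'; rewrite OmE'; exists t.
have Sv t : 0 <= t -> S t (v 0) = v t.
  move=> t0; apply: (is_sol_unique fC1 t0 (semiflow_sol SP (Kv 0) (lexx 0))).
    by move=> r _; exact: vd.
  by rewrite (semiflow0 SP).
have vOm t : Om (v t).
  apply: edistance_eq0 => //; apply/eqP; rewrite eq_le edistance_ge0// andbT.
  rewrite leNgt; apply/negP => d0.
  have [T1 T10 H] := all_attracted (Kv 0) (divr_gt0 d0 (ltr0Sn _ 1)).
  have [r r1 vr] := larg' T1 t.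
  have := H r r1; rewrite Sv ?(le_trans T10)// vr; lra.
have sub1 : Om' `<=` Om by rewrite OmE' => _ [t _ <-]; exact: vOm.
apply/seteqP; split=> //.
have := vOm 0; rewrite OmE => -[s0 _ us0] _ [t _ <-].
have [r r1 <-] := larg s0 t.
have rs : 0 <= r - s0 by rewrite subr_ge0.
rewrite OmE'; exists (r - s0) => //.
by rewrite -Sv// -us0 semiflow_orbit// addrC subrK.
Qed.

(** A point p of Omega nearest to x minimizes the squared distance along the orbit, so
x - p is perpendicular to f(p). Since the time change at most doubles time, the
rate mu becomes mu / 2. *)
Lemma orbit_exponentially_stable : exponentially_stable f Om.
Proof.
have [delta [C [mu [delta0 C0 mu0 sh]]]] :=
  shadowing fC1 cK SP f_neq0 M_diff M_sym M_pos nu0 LM_le.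
exists delta, ((n%:R + 1) * C), (mu / 2).
split; rewrite ?divr_gt0 ?mulr_gt0 ?ltr_wpDl// => x xd t t0.
have [p Omp dE] := edistance_attained x cOm Om0.
have [s _ us] : range u p by rewrite -OmE.
have perp : dotp (x - p) (f p) = 0.
  pose g r := dotp (x - u r) (x - u r).
  have gd r : is_derive r 1 g (- 2 * dotp (f (u r)) (x - u r)).
    have h : is_derive r 1 (fun r => x - u r) (- f (u r)).
      by have := is_deriveB (is_derive_cst x r 1) (u_sol r); rewrite sub0r.
    apply: is_derive_eq (is_derive_dotp h h) _.
    by rewrite (dotpC (x - u r)) !dotpNl; ring.
  have := @derive1_at_min R g (s - 1) (s + 1) s.
  move=> /(_ _ _ _ _) [].
  - lra.
  - by move=> r _; case: (gd r).
  - by rewrite in_itv /=; lra.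
  - move=> r _; rewrite /g us -!sqr_enorm ler_pXn2r ?nnegrE ?enorm_ge0//.
    by rewrite -dE edistance_le// OmE; exists r.
  - move=> _; have [_ ->] := gd s; rewrite us dotpC => /eqP.
    by rewrite mulf_eq0 oppr_eq0 pnatr_eq0 /= => /eqP.
have xp : `|x - p| <= delta.
  by rewrite (le_trans (norm_le_enorm _))// -dE ltW.
have Kp : K p by exact: OmK.
have [Y [th [Y0 th0 Yd thP]]] := sh p x Kp perp xp.
have [fd fE] := sol_flow_ge0 fC1 t0 (u := Y) (fun r h => Yd r (proj1 (andP h))).
rewrite Y0 in fd fE; split=> //; rewrite fE.
have [_ [r r0 thr] _ _] := thP t t0.
have [/andP[_ r2] _ _ dist] := thP r r0; rewrite thr in r2 dist.
have OmS : Om (S r p) by rewrite -us semiflow_orbit// OmE; exists (s + r).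
apply: (le_trans (edistance_le (Y t) OmS)); apply: (le_trans (enorm_le_norm _)).
apply: (@le_trans _ _ ((n%:R + 1) * (C * expR (- mu * r) * `|x - p|))).
  by apply: ler_pM => //; rewrite lerDl.
rewrite !mulrA; apply: ler_pM; rewrite ?mulr_ge0 ?expR_ge0 ?addr_ge0 ?(ltW C0)//.
  rewrite ler_wpM2l ?mulr_ge0 ?addr_ge0 ?(ltW C0)// ler_expR.
  by rewrite !mulNr lerN2; have := ler_wpM2l (ltW mu0) r2; lra.
by rewrite dE norm_le_enorm.
Qed.

End GivenOrbit.

Lemma periodic_orbit_exists : exists Om (u : R -> 'cV[R]_n) (tau : R),
  [/\ 0 < tau, forall t, is_derive t 1 u (f (u t)), forall t, u (t + tau) = u t,
      exists t, u t != u 0 & Om = range u /\ Om `<=` K].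
Proof.
have [q [tau [Kq tau1 Sq]]] := periodic_point_exists.
have tau0 : 0 < tau by exact: lt_le_trans tau1.
have [u [ud uper _ uK]] := periodic_extension fC1 SP Kq tau0 Sq.
exists (range u), u, tau; split=> //; last by split=> // _ [t _ <-].
by apply: sol_not_constant => //; exact: f_neq0.
Qed.

End Attraction.

(** * Eigenvalues and complex exponentials *)

Section Spectrum.

(** With C = X - A, so that C g = (X - 1) g, take determinants in two factorizations of
the block matrix ((C, - g), (h, 1)): eliminating its last row gives
det(C + g h), and multiplying by ((1, g), (0, X - 1)) gives the rows (C, 0) and
(h, X). *)
Lemma char_poly_deflation (F : comNzRingType) n (A : 'M[F]_n) (g : 'cV[F]_n) (h : 'rV[F]_n) :
  A *m g = g -> h *m g = 1%:M ->
  char_poly (A - g *m h) * ('X - 1) = char_poly A * 'X.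
Proof.
move=> Ag hg.
set C := char_poly_mx A.
pose gp := map_mx (@polyC F) g; pose hp := map_mx (@polyC F) h.
have Cg : C *m gp = gp *m ('X - 1)%:M.
  rewrite /C /char_poly_mx mulmxBl -map_mxM Ag mul_scalar_mx.
  by rewrite mul_mx_scalar scalerBl scale1r.
have hgp : hp *m gp = 1%:M by rewrite -map_mxM hg map_mx1.
have CE : char_poly_mx (A - g *m h) = C + gp *m hp.
  by rewrite /char_poly_mx map_mxB map_mxM opprB addrA addrAC.
pose L : 'M[{poly F}]_(n + 1) := block_mx C (- gp) hp 1%:M.
have L1 : L *m block_mx 1%:M 0 (- hp) 1%:M = block_mx (C + gp *m hp) (- gp) 0 1%:M.
  rewrite mulmx_block !mulmx1 !mulmx0 mulmxN mulNmx opprK mul1mx subrr.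
  by rewrite !add0r.
have L2 : L *m block_mx 1%:M gp 0 ('X - 1)%:M = block_mx C 0 hp 'X%:M.
  rewrite mulmx_block !mulmx1 !mulmx0 !addr0 Cg mulNmx subrr hgp mul1mx.
  by rewrite -raddfD /= addrC subrK.
have := congr1 determinant L1; have := congr1 determinant L2.
rewrite !det_mulmx !det_ublock !det_lblock !det1 !det_scalar1 !mul1r !mulr1.
by rewrite /char_poly CE => h2 h1; rewrite -h1 h2.
Qed.

Lemma char_poly_tr (F : comNzRingType) n (A : 'M[F]_n) : char_poly A^T = char_poly A.
Proof.
rewrite /char_poly -det_tr; congr (\det _); apply/matrixP => i j.
by rewrite !mxE eq_sym.
Qed.

Variable R : realType.

Lemma complex_ReD (x y : complex R) : complex.Re (x + y) = complex.Re x + complex.Re y.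
Proof. by case: x; case: y. Qed.

Lemma complex_ImD (x y : complex R) : complex.Im (x + y) = complex.Im x + complex.Im y.
Proof. by case: x; case: y. Qed.

(** The real and imaginary parts of an eigenvector. *)
Lemma real_eigenplane n (B : 'M[R]_n) (z : complex R) :
  root (char_poly (map_mx (real_complex R) B)) z ->
  exists a b : 'cV[R]_n, [/\ (a != 0) || (b != 0),
    B *m a = complex.Re z *: a - complex.Im z *: b &
    B *m b = complex.Im z *: a + complex.Re z *: b].
Proof.
rewrite -char_poly_tr -eigenvalue_root_char => /eigenvalueP[v vB v0].
pose a : 'cV[R]_n := \col_i complex.Re (v 0 i).
pose b : 'cV[R]_n := \col_i complex.Im (v 0 i).
have E i : \sum_j v 0 j * real_complex R (B i j) = z * v 0 i.
  by have /matrixP/(_ 0 i) := vB; rewrite !mxE => <-; apply: eq_bigr => j _; rewrite !mxE.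
exists a, b; split.
- apply: contraNT v0; rewrite negb_or !negbK => /andP[/eqP a0 /eqP b0].
  apply/eqP/matrixP => i j; rewrite ord1 [RHS]mxE.
  have := congr1 (fun x : 'cV[R]_n => x j 0) a0; have := congr1 (fun x : 'cV[R]_n => x j 0) b0.
  by rewrite !mxE; case: (v 0 j) => p q /= -> ->.
- apply/matrixP => i j; rewrite ord1 !mxE.
  have := congr1 (@complex.Re R) (E i).
  rewrite (big_morph _ complex_ReD (erefl : complex.Re (0 : complex R) = 0)).
  case: z {vB} E => zr zi E; case: (v 0 i) => p q /= <-.
  apply: eq_bigr => k _; rewrite !mxE; case: (v 0 k) => r s /=.
  by rewrite mulr0 subr0 mulrC.
- apply/matrixP => i j; rewrite ord1 !mxE.
  have := congr1 (@complex.Im R) (E i).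
  rewrite (big_morph _ complex_ImD (erefl : complex.Im (0 : complex R) = 0)).
  case: z {vB} E => zr zi E; case: (v 0 i) => p q /= h.
  rewrite addrC -h.
  apply: eq_bigr => k _; rewrite !mxE; case: (v 0 k) => r s /=.
  by rewrite mulr0 add0r mulrC.
Qed.

(** Polar coordinates; acos covers the upper half plane, its opposite the lower one. *)
Lemma cexp_surjective (z : complex R) : z != 0 -> exists l, cexp l = z.
Proof.
case: z => a b z0; pose q := a ^+ 2 + b ^+ 2.
have q0 : 0 < q.
  rewrite lt0r /q addr_ge0 ?sqr_ge0// andbT paddr_eq0 ?sqr_ge0// !sqrf_eq0.
  by apply: contra z0 => /andP[/eqP -> /eqP ->].
pose rho := Num.sqrt q; have rho0 : 0 < rho by rewrite sqrtr_gt0.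
have rho2 : rho ^+ 2 = q by rewrite sqr_sqrtr// ltW.
pose c := a / rho.
have c2 : 1 - c ^+ 2 = (b / rho) ^+ 2.
  by rewrite /c !exprMn exprVn rho2 /q; field; rewrite gt_eqF.
have c1 : -1 <= c <= 1.
  rewrite -ler_norml -(@ler_pXn2r _ 2) ?nnegrE// real_normK ?num_real// expr1n.
  by rewrite -subr_ge0 c2 sqr_ge0.
have cosE : rho * cos (acos c) = a.
  by rewrite acosK ?in_itv// /c mulrC divfK// gt_eqF.
have sinE : rho * sin (acos c) = `|b|.
  rewrite sin_acos// c2 sqrtr_sqr normrM normfV (gtr0_norm rho0) mulrC divfK//.
  by rewrite gt_eqF.
have [b0|b0] := leP 0 b.
  exists (Complex (ln rho) (acos c)); rewrite /cexp /= lnK ?posrE//.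
  by rewrite cosE sinE ger0_norm.
exists (Complex (ln rho) (- acos c)); rewrite /cexp /= lnK ?posrE// cosN sinN.
by rewrite cosE mulrN sinE ltr0_norm// opprK.
Qed.

Lemma cexp_mul_surjective (z : complex R) (T : R) : z != 0 -> T != 0 ->
  exists l, cexp (l * real_complex R T) = z.
Proof.
move=> /cexp_surjective[l <-] T0; exists (l / real_complex R T).
by rewrite divfK// fmorph_eq0.
Qed.

Lemma cexp0 : cexp (0 : complex R) = 1.
Proof. by rewrite /cexp /= expR0 cos0 sin0 mulr1 mulr0. Qed.

Lemma cexp_sqr_modulus (l : complex R) (T : R) :
  complex.Re (cexp (l * real_complex R T)) ^+ 2 +
  complex.Im (cexp (l * real_complex R T)) ^+ 2 = expR (2 * (complex.Re l * T)).
Proof.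
case: l => a b; rewrite /cexp /= mulr0 subr0.
rewrite !exprMn -mulrDr cos2Dsin2 mulr1 expr2 -expRD; congr expR; ring.
Qed.

(** A contraction of a positive quadratic form has spectral radius at most its
contraction factor; the hyperplane on which the form is contracted only needs to
contain the range of the matrix because eigenvectors of nonzero eigenvalues lie
in the range. *)
Lemma contracted_eigenvalue n (B : 'M[R]_n) (Q : 'M[R]_n) (g : 'cV[R]_n) (rho : R) z :
  Q^T = Q -> posdefmx Q -> (forall w, dotp (B *m w) g = 0) ->
  (forall w, dotp w g = 0 -> quadf Q (B *m w) <= rho * quadf Q w) ->
  z != 0 -> root (char_poly (map_mx (real_complex R) B)) z ->
  complex.Re z ^+ 2 + complex.Im z ^+ 2 <= rho.
Proof.
move=> symQ posQ rangeB con z0 /real_eigenplane[a [b [ab Ba Bb]]].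
set p := complex.Re z in Ba Bb *; set q := complex.Im z in Ba Bb *.
have pq0 : p ^+ 2 + q ^+ 2 != 0.
  rewrite paddr_eq0 ?sqr_ge0// !sqrf_eq0; apply: contra z0 => /andP[/eqP p0 /eqP q0].
  have -> : z = Complex p q by rewrite /p /q; case: (z).
  by rewrite p0 q0.
have ha := rangeB a; have hb := rangeB b.
rewrite Ba dotpBl !dotpZl in ha; rewrite Bb dotpDl !dotpZl in hb.
have ga : dotp a g = 0.
  apply/eqP; have : (p ^+ 2 + q ^+ 2) * dotp a g = 0.
    have -> : (p ^+ 2 + q ^+ 2) * dotp a g =
       p * (p * dotp a g - q * dotp b g) + q * (q * dotp a g + p * dotp b g) by ring.
    by rewrite ha hb !mulr0 addr0.
  by move/eqP; rewrite mulf_eq0 (negPf pq0).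
have gb : dotp b g = 0.
  apply/eqP; have : (p ^+ 2 + q ^+ 2) * dotp b g = 0.
    have -> : (p ^+ 2 + q ^+ 2) * dotp b g =
       p * (q * dotp a g + p * dotp b g) - q * (p * dotp a g - q * dotp b g) by ring.
    by rewrite ha hb !mulr0 subr0.
  by move/eqP; rewrite mulf_eq0 (negPf pq0).
have ca := con a ga; have cb := con b gb; rewrite Ba in ca; rewrite Bb in cb.
have s0 : 0 < quadf Q a + quadf Q b.
  have q_ge0 w : 0 <= quadf Q w.
    have [->|w0] := eqVneq w 0; first by rewrite quadfE dotp0l.
    by rewrite ltW// posQ.
  by case/orP: ab => /posQ h; [apply: ltr_wpDr|apply: ltr_wpDl].
rewrite -(ler_pM2r s0).
have qsum : quadf Q (p *: a - q *: b) + quadf Q (q *: a + p *: b) =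
    (p ^+ 2 + q ^+ 2) * (quadf Q a + quadf Q b).
  have sym : dotp b (Q *m a) = dotp a (Q *m b) by rewrite dotp_mulmxT symQ dotpC.
  rewrite !quadfE mulmxBr mulmxDr -!scalemxAr.
  rewrite !(dotpBl, dotpBr, dotpDl, dotpDr, dotpZl, dotpZr) sym; ring.
by rewrite -qsum mulrDr lerD.
Qed.

End Spectrum.

(** * Floquet theory of the periodic orbit *)

Section Monodromy.
Context {R : realType} {n : nat}.
Implicit Types (s t r : R) (x y v w : 'cV[R]_n).
Variables (f : 'cV[R]_n -> 'cV[R]_n) (K : set 'cV[R]_n) (M : 'cV[R]_n -> 'M[R]_n) (nu : R).
Hypothesis fC1 : C1map f.
Hypothesis cK : compact K.
Hypothesis f_neq0 : forall x, K x -> f x != 0.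
Variable u : R -> 'cV[R]_n.
Hypothesis u_sol : forall t, is_derive t 1 u (f (u t)).
Hypothesis uK : forall t, K (u t).

Lemma Jac_orbit_bounded : exists2 J, 0 < J & forall t, `|Jac f (u t)| <= J.
Proof.
have [F [J [k [F0 J0 k0 fb]]]] := field_bounds fC1 cK f_neq0.
by exists J => // t; have [] := fb _ (uK t).
Qed.

Lemma flow_along_orbit s t : flow_defined f t (u s) /\ flow f t (u s) = u (s + t).
Proof.
have h a b : is_sol f (fun r => u (r + s)) a b.
  by apply: is_sol_shift => r _; exact: u_sol.
have := sol_flow fC1 (h (Num.min 0 t) (Num.max 0 t)).
by rewrite add0r addrC.
Qed.

(** The infimum of the positive return times is positive, since u leaves p with speed
f(p) <> 0, and it is a return time by continuity. *)
Lemma minimal_period_exists (tau : R) : 0 < tau -> u tau = u 0 ->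
  exists T, minimal_period f (u 0) T.
Proof.
move=> tau0 utau; set p := u 0.
have cu : continuous u by move=> t; exact: is_derive_continuous (u_sol t).
have fp0 := dotp_gt0 (f_neq0 (uK 0)); rewrite -/p in fp0.
set k := dotp (f p) (f p) in fp0.
have [e e0 eP] : exists2 e : R, 0 < e & forall t, `|t| < e -> k / 2 <= dotp (f (u t)) (f p).
  have h : dotp (f (u t)) (f p) @[t --> (0 : R)] --> k.
    apply: (@dotp_cvg _ _ _ (nbhs (0 : R))); last exact: cvg_cst.
    by apply: continuous_cvg; [exact: (@C1map_continuous _ _ _ fC1)|exact: cu].
  have /nbhs_ballP[e /= e0 He] : \forall t \near (0 : R), k / 2 < dotp (f (u t)) (f p).
    by apply: (cvgr_gt _ h); rewrite ltr_pdivrMr// ltr_pMr// ltr1n.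
  exists e => // t te; apply/ltW/He.
  by rewrite /ball /= sub0r normrN.
have noret t : 0 < t -> t < e -> u t != p.
  move=> t0 te; apply/eqP => up.
  have := @ler_is_derive _ (fun r => k / 2 * r) (fun r => dotp (u r) (f p)) (fun=> k / 2)
    (fun r => dotp (f (u r)) (f p)) 0 t.
  rewrite up -/p subrr mulr0 subr0 => H.
  have : k / 2 * t <= 0.
    apply: H; last exact: ltW.
    - by move=> r _; exact: is_derive_mulc.
    - move=> r _; have := is_derive_dotp (u_sol r) (is_derive_cst (f p) r 1).
      by rewrite dotp0r addr0.
    - by move=> r /andP[r0 rt]; apply: eP; rewrite ger0_norm// (le_lt_trans rt).
  by rewrite leNgt mulr_gt0// divr_gt0.
pose P := [set t | 0 < t /\ u t = p].
have hP : has_inf P by split; [exists tau|exists 0 => t [/ltW]].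
pose T := inf P.
have eT : e <= T.
  apply: lb_le_inf; first by exists tau.
  move=> t [t0 ut]; rewrite leNgt; apply/negP => te.
  by have := noret t t0 te; rewrite ut eqxx.
have T0 : 0 < T by exact: lt_le_trans eT.
have uT : u T = p.
  apply/eqP; rewrite -subr_eq0 -normr_eq0; apply/negP => /negP d0.
  have d0' : 0 < `|u T - p| by rewrite lt0r d0 normr_ge0.
  have H : \forall t \near T, `|u T - u t| < `|u T - p| by apply: (@cvgr_dist_lt _ _ _ _ _ _ _ (cu T)).
  have /nbhs_ballP[d /= dd Hd] := H.
  have [t [t0 ut] tT] := inf_adherent dd hP.
  have Tt : T <= t by apply: (ge_inf hP.2); split.
  have := Hd t; rewrite ut ltxx => Hf; have : false by apply: Hf; rewrite /ball /= distrC ger0_norm ?subr_ge0//; rewrite -/T in tT; lra.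
  by [].
exists T; split=> //.
- by have [] := flow_along_orbit 0 T.
- by have [_ ->] := flow_along_orbit 0 T; rewrite add0r.
- move=> s /andP[s0 sT]; have [_ ->] := flow_along_orbit 0 s; rewrite add0r.
  apply/eqP => us; have : T <= s by apply: (ge_inf hP.2); split.
  by rewrite leNgt sT.
Qed.

Lemma fundamental_matrix_exists : exists Phi : R -> 'M[R]_n,
  Phi 0 = 1%:M /\ forall t, is_derive t 1 Phi (Jac f (u t) *m Phi t).
Proof.
have [J J0 uJ] := Jac_orbit_bounded.
have NJ : 0 < n%:R * J + 1 by rewrite ltr_wpDl// mulr_ge0// ltW.
have uJv t v : `|Jac f (u t) *m v| <= (n%:R * J + 1) * `|v|.
  apply: (le_trans (ler_norm_mulmx _ _)); rewrite ler_wpM2r//.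
  by rewrite (@le_trans _ _ (n%:R * J)) ?lerDl// ler_wpM2l.
have cu : continuous u by move=> t; exact: is_derive_continuous (u_sol t).
have /choice[phi phiP] : forall j : 'I_n, exists y : R -> 'cV[R]_n,
    y 0 = delta_mx j 0 /\ forall t, is_derive t 1 y (Jac f (u t) *m y t).
  move=> j; apply: (@picard _ _ (fun t y => Jac f (u t) *m y) (n%:R * J + 1)
    ((n%:R * J + 1) * `|delta_mx j 0 : 'cV[R]_n|)) => //.
  - by rewrite mulr_ge0// ltW.
  - by move=> t x y; rewrite -mulmxBr.
  - move=> y cy t; apply: (@mulmx_cvg _ _ (nbhs t)); last exact: cy.
    by apply: continuous_cvg; [exact: (@Jac_continuous _ _ _ fC1)|exact: cu].
exists (fun t => \matrix_(i, j) phi j t i 0); split.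
  by apply/matrixP => i j; rewrite !mxE (phiP j).1 mxE eqxx andbT.
move=> t; apply/is_derive_mxP => i j.
rewrite (_ : (fun s => _) = fun s => phi j s i 0); last by apply/funext => s; rewrite mxE.
have /is_derive_mxP/(_ i 0) := (phiP j).2 t.
move=> H; apply: is_derive_eq H _; rewrite [LHS]mxE [RHS]mxE.
by apply: eq_bigr => k _; congr (_ * _); rewrite mxE.
Qed.

(** The second implication is the first one for reversed time; it makes the monodromy
matrix injective. *)
Lemma linear_unique (v w : R -> 'cV[R]_n) a b : a <= b ->
  (forall t, is_derive t 1 v (Jac f (u t) *m v t)) ->
  (forall t, is_derive t 1 w (Jac f (u t) *m w t)) ->
  (v a = w a -> v b = w b) /\ (v b = w b -> v a = w a).
Proof.
move=> ab vd wd; have [J J0 uJ] := Jac_orbit_bounded.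
have L t (x y : 'cV[R]_n) : `|Jac f (u t) *m x - Jac f (u t) *m y| <= n%:R * J * `|x - y|.
  rewrite -mulmxBr; apply: (le_trans (ler_norm_mulmx _ _)); rewrite ler_wpM2r//.
  by rewrite ler_wpM2l.
split=> E; apply/eqP; rewrite -subr_eq0 -dotp_eq0 eq_le dotp_ge0 andbT.
  have := @gronwall_dotp _ _ v w _ _ (n%:R * J) a b ab (fun s _ => vd s) (fun s _ => wd s)
    (fun s _ => L s _ _).
  by rewrite E subrr dotp0l mulr0.
have rev (z : R -> 'cV[R]_n) s : (forall t, is_derive t 1 z (Jac f (u t) *m z t)) ->
    is_derive s 1 (fun r => z (- r)) (- (Jac f (u (- s)) *m z (- s))).
  by move=> zd; apply: is_derive_reverse.
have ba : - b <= - a by rewrite lerN2.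
have := @gronwall_dotp _ _ (fun s => v (- s)) (fun s => w (- s)) _ _ (n%:R * J) (- b) (- a) ba
  (fun s _ => rev v s vd) (fun s _ => rev w s wd).
rewrite !opprK E subrr dotp0l mulr0; apply => s _.
by rewrite -opprD normrN L.
Qed.

Variables (Phi : R -> 'M[R]_n) (T : R).
Hypothesis Phi0 : Phi 0 = 1%:M.
Hypothesis Phid : forall t, is_derive t 1 Phi (Jac f (u t) *m Phi t).
Hypothesis T0 : 0 < T.
Hypothesis uT : u T = u 0.

Let phid w t : is_derive t 1 (fun t => Phi t *m w) (Jac f (u t) *m (Phi t *m w)).
Proof.
have := is_derive_mulmx (Phid t) (is_derive_cst w t 1).
by rewrite mulmx0 addr0 mulmxA.
Qed.

Let fud t : is_derive t 1 (fun t => f (u t)) (Jac f (u t) *m f (u t)).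
Proof. exact: is_derive_Jac (fC1.1 _) (u_sol t). Qed.

(** The curve f(u t) solves the variational equation. *)
Lemma monodromy_tangent : Phi T *m f (u 0) = f (u 0).
Proof.
have [+ _] := linear_unique (ltW T0) (phid (f (u 0))) fud.
by rewrite Phi0 mul1mx uT; exact.
Qed.

Lemma monodromy_injective w : Phi T *m w = 0 -> w = 0.
Proof.
move=> h; have [_ +] := linear_unique (ltW T0) (phid w) (phid 0).
by rewrite !mulmx0 Phi0 mul1mx; exact.
Qed.

(** The monodromy matrix followed by the orthogonal projection along [f (u 0)]. *)
Definition transversal_monodromy :=
  Phi T - f (u 0) *m ((dotp (f (u 0)) (f (u 0)))^-1 *: ((f (u 0))^T *m Phi T)).

Let g := f (u 0).
Let gg0 : dotp g g != 0. Proof. by rewrite dotp_eq0 f_neq0. Qed.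

Lemma transversal_monodromyE w : transversal_monodromy *m w =
  Phi T *m w - (dotp (Phi T *m w) g / dotp g g) *: g.
Proof.
rewrite /transversal_monodromy -/g mulmxBl; congr (_ - _).
rewrite -mulmxA -scalemxAl -mulmxA -scalemxAr.
rewrite [g^T *m _]mx11_scalar mul_mx_scalar scalerA; congr (_ *: _).
by rewrite mulrC -/(dotp g (Phi T *m w)) dotpC.
Qed.

Lemma transversal_monodromy_perp w : dotp (transversal_monodromy *m w) g = 0.
Proof. by rewrite transversal_monodromyE dotpBl dotpZl divfK// subrr. Qed.

Lemma char_poly_transversal :
  char_poly transversal_monodromy * ('X - 1) = char_poly (Phi T) * 'X.
Proof.
apply: char_poly_deflation; first exact: monodromy_tangent.
rewrite -scalemxAl -mulmxA monodromy_tangent [_^T *m _]mx11_scalar.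
by rewrite scale_scalar_mx -/(dotp (f (u 0)) (f (u 0))) mulVf.
Qed.

Hypothesis M_diff : forall x, K x -> differentiable M x.
Hypothesis M_sym : forall x, K x -> (M x)^T = M x.
Hypothesis M_pos : forall x, K x -> posdefmx (M x).
Hypothesis LM_le : forall x, K x -> (LM f M x <= (- nu)%:E)%E.

(** The variational solution projected along f, z = phi - a f, stays perpendicular to f;
differentiating z.f = 0 identifies the derivative of a, and z follows the
transversal drift. So z^T M z decays at rate 2 nu. *)
Lemma transversal_monodromy_contraction w : dotp w g = 0 ->
  quadf (M (u 0)) (transversal_monodromy *m w) <=
  expR (- (2 * nu) * T) * quadf (M (u 0)) w.
Proof.
move=> wg.
pose ff t := dotp (f (u t)) (f (u t)).
have ff0 t : ff t != 0 by rewrite dotp_eq0 f_neq0.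
pose a t := dotp (Phi t *m w) (f (u t)) / ff t.
pose z t := Phi t *m w - a t *: f (u t).
have ad t : is_derive t 1 a ('D_1 a t).
  apply: derivableP; apply: derivableM.
    by have [] := is_derive_dotp (phid w t) (fud t).
  by apply: derivableV => //; have [] := is_derive_dotp (fud t) (fud t).
have zd0 t : is_derive t 1 z (Jac f (u t) *m z t - 'D_1 a t *: f (u t)).
  have := is_deriveB (phid w t) (is_derive_scale (ad t) (fud t)).
  move=> H; apply: is_derive_eq H _.
  by rewrite /z mulmxBr -scalemxAr opprD addrCA addrC.
have zperp t : dotp (z t) (f (u t)) = 0.
  by rewrite /z dotpBl dotpZl /a -/(ff t) divfK// subrr.
have zd t : is_derive t 1 z (transversal_drift f (u t) (z t)).
  apply: is_derive_eq (zd0 t) _; rewrite /transversal_drift; congr (_ - _ *: _).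
  have := is_derive_dotp (zd0 t) (fud t).
  rewrite (_ : (fun s => _) = cst 0); last by apply/funext => s; exact: zperp.
  move=> [_]; rewrite derive_cst dotpBl dotpZl -/(ff t) (dotpC _ (f (u t))) => E.
  have -> : dotp (f (u t)) (Jac f (u t) *m z t) + dotp (z t) (Jac f (u t) *m f (u t)) =
     'D_1 a t * ff t by lra.
  by rewrite mulrC mulfK.
pose N t := quadf (M (u t)) (z t).
have Nd t : is_derive t 1 N (quadf (orbital_deriv f M (u t)) (z t) +
    2 * dotp (z t) (M (u t) *m transversal_drift f (u t) (z t))).
  apply: (@is_derive_quadf _ _ (fun t => M (u t)) z) => //; first by apply: M_sym; exact: uK.
  by apply: (is_derive_orbital (u := u)) => //; apply: M_diff; exact: uK.
have NN : N T <= expR (- (2 * nu) * (T - 0)) * N 0.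
  apply: gronwall (fun s _ => Nd s) _ (ltW T0) => s _.
  have H := transversal_contraction M_pos LM_le M_sym (uK s) (zperp s).
  exact: H.
have z0 : z 0 = w by rewrite /z /a Phi0 mul1mx -/g wg mul0r scale0r subr0.
have zT : z T = transversal_monodromy *m w by rewrite transversal_monodromyE /z /a /ff uT.
by rewrite /N z0 zT uT subr0 in NN.
Qed.

Lemma floquet_multiplier_bound (Ls : seq (complex R)) l :
  char_poly (map_mx (real_complex R) (Phi T)) =
    \prod_(l <- 0 :: Ls) ('X - (cexp (l * real_complex R T))%:P) ->
  l \in Ls -> complex.Re l <= - nu.
Proof.
move=> cp lLs; set z := cexp (l * real_complex R T).
have mod := cexp_sqr_modulus l T; rewrite -/z in mod.
have z0 : z != 0.
  apply/eqP => zE; move: mod; rewrite zE /= expr0n addr0 => /esym/eqP.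
  by rewrite gt_eqF// expR_gt0.
have rz : root (char_poly (map_mx (real_complex R) transversal_monodromy)) z.
  have E := congr1 (map_poly (real_complex R)) char_poly_transversal.
  rewrite !rmorphM /= rmorphB rmorph1 /= map_polyX !map_char_poly cp big_cons mul0r cexp0 in E.
  have X1 : 'X - 1 != 0 :> {poly complex R} by rewrite -polyC1 polyXsubC_eq0.
  move: E; rewrite mulrC -mulrA => /(mulfI X1) ->.
  rewrite rootM; apply/orP; left.
  rewrite -(big_map (fun l => cexp (l * real_complex R T)) predT (fun z => 'X - z%:P)).
  by rewrite root_prod_XsubC; apply: map_f.
have := contracted_eigenvalue (M_sym (uK 0)) (M_pos (uK 0)) transversal_monodromy_perp
  transversal_monodromy_contraction z0 rz.
rewrite mod ler_expR => h.
rewrite -(ler_pM2r T0); lra.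
Qed.

(** The characteristic polynomial splits over the complex numbers, 1 is a root because
f(u 0) is fixed, and the other roots are nonzero, hence exponentials. *)
Lemma floquet_exponents_exist : exists Ls : seq (complex R),
  char_poly (map_mx (real_complex R) (Phi T)) =
    \prod_(l <- 0 :: Ls) ('X - (cexp (l * real_complex R T))%:P).
Proof.
set A := map_mx _ _.
have [r rE] := closed_field_poly_normal (char_poly A).
rewrite (eqP (char_poly_monic A)) scale1r in rE.
have r1 : 1 \in r.
  rewrite -root_prod_XsubC -rE -char_poly_tr -eigenvalue_root_char.
  apply/eigenvalueP; exists (map_mx (real_complex R) g)^T.
    by rewrite scale1r -trmx_mul -map_mxM monodromy_tangent.
  apply: contra gg0 => /eqP/matrixP E; rewrite dotp_eq0; apply/eqP/matrixP => i j.
  by have := E j i; rewrite !mxE => /eqP; rewrite fmorph_eq0 => /eqP.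
have r0 z : z \in r -> z != 0.
  move=> zr; apply/eqP => zE; move: zr; rewrite zE -root_prod_XsubC -rE.
  rewrite /root horner_coef0 char_poly_det mulf_eq0 signr_eq0 /= det_map_mx fmorph_eq0.
  rewrite -det_tr => /det0P[v v0 vA].
  have : v^T = 0 by apply: monodromy_injective; apply: trmx_inj; rewrite trmx_mul trmxK vA trmx0.
  by move=> /(congr1 trmx); rewrite trmxK trmx0 => E; rewrite E eqxx in v0.
have T0' : T != 0 by rewrite gt_eqF.
have /choice[lg lgP] : forall z : complex R, exists l, z \in r -> cexp (l * real_complex R T) = z.
  move=> z; have [zr|] := boolP (z \in r); last by exists 0.
  by have [l lE] := cexp_mul_surjective (r0 z zr) T0'; exists l.
exists (map lg (rem 1 r)); rewrite rE (perm_big _ (perm_to_rem r1)) /= !big_cons big_map.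
rewrite mul0r cexp0; congr (_ * _).
by apply: eq_big_seq => z zr; rewrite lgP// (mem_rem zr).
Qed.

End Monodromy.

(** * Existence, uniqueness and stability of the periodic orbit *)

Theorem theorem2p1 (R : realType) (n sigma : nat)
    (f : 'cV[R]_n -> 'cV[R]_n) (K : set 'cV[R]_n)
    (M : 'cV[R]_n -> 'M[R]_n) (nu : R)
    (sigma_ge1 : (1 <= sigma)%N)
    (f_Csigma : Ck_on setT sigma f)
    (K_compact : compact K)
    (K_nonempty : K !=set0)
    (K_connected : connected K)
    (K_invariant : positively_invariant f K)
    (K_no_equilibrium : forall x, K x -> f x != 0)
    (M_C1 : C1_sym_on K M)
    (M_posdef : forall x, K x -> posdefmx (M x))
    (nu_gt0 : 0 < nu)
    (LM_le : forall x, K x -> (LM f M x <= (- nu)%:E)%E) :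
  exists Om : set 'cV[R]_n,
    [/\ (periodic_orbit f Om /\ Om `<=` K),
        (forall Om', periodic_orbit f Om' -> Om' `<=` K -> Om' = Om),
        exponentially_stable f Om,
        ((exists Ls : seq (complex R),
            floquet_exponents f Om (0 :: Ls)) /\
         (forall Ls : seq (complex R),
            floquet_exponents f Om (0 :: Ls) ->
            forall l, l \in Ls -> complex.Re l <= - nu))
      & K `<=` basin f Om].
Proof.
have fC1 := Ck_on_C1map sigma_ge1 f_Csigma.
have [U [_ KU symM [M_diff _]]] := M_C1.
have MK_diff x : K x -> differentiable M x by move=> /KU; exact: M_diff.
have MK_sym x : K x -> (M x)^T = M x by move=> /KU; exact: symM.
have [S SP] := semiflow_exists fC1 K_invariant.
have [Om [u [tau [tau0 u_sol u_per u_nc [OmE OmK]]]]] := periodic_orbit_exists fC1 K_compact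
  K_nonempty SP K_no_equilibrium MK_diff MK_sym M_posdef nu_gt0 LM_le.
have uK t : K (u t) by apply: OmK; rewrite OmE; exists t.
exists Om; split.
- by split=> //; exists u, tau.
- exact: (periodic_orbit_unique fC1 K_compact SP K_no_equilibrium MK_diff MK_sym M_posdef nu_gt0
    LM_le tau0 u_sol u_per OmE OmK K_connected).
- exact: (orbit_exponentially_stable fC1 K_compact SP K_no_equilibrium MK_diff MK_sym M_posdef
    nu_gt0 LM_le tau0 u_sol u_per OmE OmK).
- split.
    have utau : u tau = u 0 by rewrite -[tau]add0r u_per.
    have [T [T0 fdT fT minT]] := minimal_period_exists fC1 K_no_equilibrium u_sol uK tau0 utau.
    have [Phi [Phi0 Phid]] := fundamental_matrix_exists fC1 K_compact K_no_equilibrium u_sol uK.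
    have uT : u T = u 0.
      by have [_] := flow_along_orbit fC1 u_sol 0 T; rewrite add0r fT.
    have [Ls LsE] := floquet_exponents_exist fC1 K_compact K_no_equilibrium u_sol uK Phi0 Phid T0 uT.
    exists Ls, (u 0), T, Phi; split=> //; first by rewrite OmE; exists 0.
    move=> t; have [_ ->] := flow_along_orbit fC1 u_sol 0 t.
    by rewrite add0r.
  move=> Ls [p [T [Phi [Omp [T0 _ fT _] Phi0 Phid cp]]]] l lLs.
  have [s _ us] : range u p by rewrite -OmE.
  pose v t := u (t + s).
  have v_sol (t : R) : is_derive t 1 v (f (v t)).
    have h : is_sol f u (t + s) (t + s) by move=> r _; exact: u_sol.
    by have := is_sol_shift h; apply; rewrite lexx.
  have vK t : K (v t) by exact: uK.
  have v0 : v 0 = p by rewrite /v add0r.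
  have flE t : flow f t p = v t.
    by have [_] := flow_along_orbit fC1 v_sol 0 t; rewrite v0 add0r.
  have vT : v T = v 0 by rewrite -flE fT v0.
  have Phid' (t : R) : is_derive t 1 Phi (Jac f (v t) *m Phi t) by rewrite -flE.
  exact: (floquet_multiplier_bound fC1 K_compact K_no_equilibrium v_sol vK Phi0 Phid' T0 vT
    MK_diff MK_sym M_posdef LM_le cp lLs).
- exact: (basin_contains fC1 K_compact SP K_no_equilibrium MK_diff MK_sym M_posdef nu_gt0
    LM_le u_sol OmE OmK K_connected).
Qed.
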